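(* Let $n\ge 2$ and $1\le k<n$ be integers, and let $T\colon \mathbb{M}_n\to\mathbb{M}_n$ be a bijective (complex) linear map. The following conditions are equivalent. (a) $T$ preserves parallel pairs with respect to $w_k$, i.e. $T(A)\parallel T(B)$ whenever $A\parallel B$. (b) $T$ preserves TEA pairs with respect to $w_k$, i.e. $(T(A),T(B))$ is a TEA pair whenever $(A,B)$ is a TEA pair. (c) There exist a nonzero $\mu\in\mathbb{C}$ and a unitary $U\in\mathbb{M}_n$ such that either (c.1) $\mu T$ has the form $A\mapsto U^*AU$ or $A\mapsto U^*A^tU$; or (c.2) $n=2k>2$ and $\mu T$ has the form $A\mapsto \frac{1}{k}(\operatorname{tr}A)I-U^*AU$ or $A\mapsto \frac1k(\operatorname{tr}A)I-U^*A^tU$.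
   Context: $\mathbb{M}_n$ is the space of complex $n\times n$ matrices. For $A\in\mathbb{M}_n$ and $1\le k<n$, the $k$-numerical range is $W_k(A)=\{\operatorname{tr}(AP): P=P^*=P^2,\ \operatorname{tr}P=k\}$ and the $k$-numerical radius is $w_k(A)=\max\{|z|: z\in W_k(A)\}$; $w_k$ is a norm on $\mathbb{M}_n$. Two matrices $A,B$ are parallel, written $A\parallel B$, if $w_k(A+\mu B)=w_k(A)+w_k(B)$ for some $\mu\in\mathbb{C}$ with $|\mu|=1$; $(A,B)$ is a TEA (triangle equality attaining) pair if $w_k(A+B)=w_k(A)+w_k(B)$. $A^t$ denotes the transpose. *)

(* Defs.v *)
From HB Require Import structures.
From mathcomp Require Import all_boot all_order all_algebra.
From mathcomp Require Import complex.
From mathcomp Require Import reals.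
Set Implicit Arguments. Unset Strict Implicit. Unset Printing Implicit Defensive.
Import Order.TTheory GRing.Theory Num.Theory.
Local Open Scope ring_scope.

Section Defs.
Variable R : realType.
Local Notation C := R[i].

Definition adjmx (n : nat) (A : 'M[C]_n) : 'M[C]_n := map_mx Num.conj A^T.

Definition rank_k_proj (n k : nat) (P : 'M[C]_n) : Prop :=
  adjmx P = P /\ P *m P = P /\ \tr P = k%:R.

Definition knumrange (n k : nat) (A : 'M[C]_n) : C -> Prop :=
  fun z => exists P : 'M[C]_n, rank_k_proj k P /\ z = \tr (A *m P).

(* k-numerical radius w_k(A) = max { |z| : z in W_k(A) } (written as the
   supremum of this set; the maximum is attained since the set is compact) *)
Definition knumradius (n k : nat) (A : 'M[C]_n) : R :=
  reals.sup (fun r : R => exists z, knumrange k A z /\ r = ComplexField.Normc.normc z).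

Definition kparallel (n k : nat) (A B : 'M[C]_n) : Prop :=
  exists mu : C, `|mu| = 1 /\
    knumradius k (A + mu *: B) = knumradius k A + knumradius k B.

Definition kTEA (n k : nat) (A B : 'M[C]_n) : Prop :=
  knumradius k (A + B) = knumradius k A + knumradius k B.

Definition unitary (n : nat) (U : 'M[C]_n) : Prop := U *m adjmx U = 1%:M.

End Defs.

(* Main.v *)
(** By compactness, [A] and [B] are parallel if and only if [w_k(A)] and [w_k(B)] are attained
    at a common rank-[k] projection, so a parallel-pair preserver [T] is a map respecting common
    maximisers.  The identity is parallel to everything, hence so is [T(I)], which forces [T(I)]
    to be scalar; normalise to [T(I) = I].  The pairs [iP + sI], [-iP + sI] with [s] large show
    that the skew-hermitian part of [T(P)] is scalar for each projection [P], and the first-order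
    optimality condition at [P] for the matrices [P + itG] then gives
    [tr(T(A)Q) = tr(AP)] for all [A], where [Q] maximises [T(P)].  Thus the adjoint of [T] for the
    trace form permutes the rank-[k] projections; it also preserves their commutativity.

    On the diagonal algebra of an orthonormal basis such a map is a linear map of [R^n] carrying
    the indicators of [k]-subsets to indicators of [k]-subsets in another basis, so it is a
    permutation of coordinates or, when [n = 2k], a permutation followed by
    [x |-> (sum x)/k - x].  Which case occurs does not depend on the basis: if at every point
    of a real vector space one of two quadratic maps vanishes, then one of them is zero.  So
    the adjoint, possibly after the complement, preserves squares of hermitian matrices: it is
    a Jordan *-automorphism, that is [X |-> V X V^*] or [X |-> V X^t V^*]. *)
Require Import Defs.
From HB Require Import structures.
From mathcomp Require Import all_boot all_order all_algebra.
From mathcomp Require Import spectral.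
From mathcomp Require Import ring lra zify.
From mathcomp Require Import boolp.
Set Implicit Arguments. Unset Strict Implicit. Unset Printing Implicit Defensive.
Import Order.TTheory GRing.Theory Num.Theory.
Local Open Scope ring_scope.

(** The obstacle is that nothing says at the outset that [T P] has only one maximiser. The matrices
    known to have an image with a sole maximiser are the [Ti Q], and such a matrix [A] serves as an
    anchor: everything that is maximal where [A] is maximal has an image maximal at the same [Q].
    This gives a [P] for each [Q] at once, but a [Q] for each [P] only after a perturbation. At such
    a pair, optimality says that a combination of [T P], [T G] and scalars commutes with [Q]. If
    [T G] itself does not commute with [Q], its coefficient must vanish; up to a nonzero factor it
    is affine in the size [t] of the perturbation, so two values of [t] separate its two parts. A
    matrix [G] for which [T G] does commute is handled by adding one for which it does not. For
    [n = 2] the complement [X |-> (tr X) I - X] is unitarily similar to the transpose, which is why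
    the exceptional form asks for [n > 2]. *)

Lemma le0_of_small (R : realFieldType) (r K : R) :
  (forall t, 0 < t -> t <= 1 -> t * r <= K * t ^+ 2) -> r <= 0.
Proof.
move=> h; rewrite leNgt; apply/negP => r0.
have d0 : 0 < `|K| + r + 1 by have := normr_ge0 K; lra.
have t0 : 0 < r / (`|K| + r + 1) by rewrite divr_gt0.
have t1 : r / (`|K| + r + 1) <= 1 by rewrite ler_pdivrMr // mul1r; have := normr_ge0 K; lra.
have := h _ t0 t1; rewrite expr2 mulrCA ler_pM2l //.
rewrite leNgt => /negP; apply.
apply: (@le_lt_trans _ _ (`|K| * (r / (`|K| + r + 1)))).
  by rewrite ler_pM2r // ler_norm.
by rewrite mulrCA -[ltRHS]mulr1 ltr_pM2l // ltr_pdivrMr //; lra.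
Qed.

(** * Conjugate transposes, rank-[k] projections and curves of projections *)

Section Adjoint.
Variables (C : numClosedFieldType) (n : nat).
Implicit Types A B P : 'M[C]_n.

(* [adjmx] and [rank_k_proj] over an arbitrary field of complex numbers; on [R[i]] they
   are convertible to the original ones. *)
Definition hcmx (m : nat) (A : 'M[C]_m) : 'M[C]_m := map_mx Num.conj A^T.

Lemma hcmxE A i j : hcmx A i j = Num.conj (A j i).
Proof. by rewrite !mxE. Qed.
Lemma hcmxK A : hcmx (hcmx A) = A.
Proof. by apply/matrixP => i j; rewrite !hcmxE conjCK. Qed.
Lemma hcmxD A B : hcmx (A + B) = hcmx A + hcmx B.
Proof. by apply/matrixP => i j; rewrite !mxE rmorphD. Qed.
Lemma hcmxN A : hcmx (- A) = - hcmx A.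
Proof. by apply/matrixP => i j; rewrite !mxE rmorphN. Qed.
Lemma hcmxB A B : hcmx (A - B) = hcmx A - hcmx B.
Proof. by rewrite hcmxD hcmxN. Qed.
Lemma hcmxZ (a : C) A : hcmx (a *: A) = Num.conj a *: hcmx A.
Proof. by apply/matrixP => i j; rewrite !mxE rmorphM. Qed.
Lemma hcmxM A B : hcmx (A *m B) = hcmx B *m hcmx A.
Proof. by rewrite /hcmx trmx_mul map_mxM. Qed.
Lemma hcmx_scalar (a : C) : hcmx (a%:M : 'M_n) = (Num.conj a)%:M.
Proof. by rewrite /hcmx tr_scalar_mx map_scalar_mx. Qed.
Lemma hcmx1 : hcmx (1%:M : 'M[C]_n) = 1%:M.
Proof. by rewrite hcmx_scalar conjC1. Qed.
Lemma mxtrace_hc A : \tr (hcmx A) = Num.conj (\tr A).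
Proof. by rewrite /mxtrace rmorph_sum; apply: eq_bigr => i _; rewrite hcmxE. Qed.

Definition kproj (k : nat) P := hcmx P = P /\ P *m P = P /\ \tr P = k%:R.

End Adjoint.

Section DiagProj.
Variables (C : numClosedFieldType) (n k : nat).

Definition dproj (J : {set 'I_n}) : 'M[C]_n := diag_mx (\row_i (i \in J)%:R).

Lemma dproj_proj (J : {set 'I_n}) : #|J| = k -> kproj k (dproj J).
Proof.
move=> cJ; split; [|split].
- by apply/matrixP => i j; rewrite hcmxE !mxE eq_sym; case: eqP => [->|_];
    rewrite ?mulr1n ?mulr0n ?rmorph0 // rmorph_nat.
- rewrite mulmx_diag; congr diag_mx; apply/rowP => i; rewrite !mxE.
  by rewrite -natrM mulnb andbb.
- rewrite mxtrace_diag (eq_bigr (fun i => (i \in J)%:R)) => [|i _]; last by rewrite mxE.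
  by rewrite -natr_sum -cJ -sum1_card [in RHS]big_mkcond.
Qed.

Lemma proj_exists (lekn : (k <= n)%N) : exists P : 'M[C]_n, kproj k P.
Proof.
exists (dproj [set i in take k (enum 'I_n)]); apply: dproj_proj.
by rewrite cardsE (card_uniqP _) ?take_uniq ?enum_uniq // size_takel // size_enum_ord.
Qed.

End DiagProj.

Section Curve.
Variables (C : numClosedFieldType) (n k : nat).
Implicit Types A B P Q : 'M[C]_n.
Implicit Types x y : 'cV[C]_n.

Definition ctmx x : 'rV[C]_n := map_mx Num.conj x^T.

Lemma ctmxD x y : ctmx (x + y) = ctmx x + ctmx y.
Proof. by apply/matrixP => i j; rewrite !mxE rmorphD. Qed.
Lemma ctmxZ (a : C) x : ctmx (a *: x) = Num.conj a *: ctmx x.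
Proof. by apply/matrixP => i j; rewrite !mxE rmorphM. Qed.
Lemma ctmx_mul A x : ctmx (A *m x) = ctmx x *m hcmx A.
Proof. by rewrite /ctmx trmx_mul map_mxM. Qed.
Lemma hcmx_outer x y : hcmx (x *m ctmx y) = y *m ctmx x.
Proof.
apply/matrixP => i j; rewrite hcmxE !mxE rmorph_sum; apply: eq_bigr => l _.
by rewrite !mxE rmorphM [X in _ * X]conjCK mulrC.
Qed.

(** [Q] arises from [P] by turning the line of [x] in the range towards [y] in the kernel, so that
    it becomes the line of [z = x + s y]. The squared length of [z] is [1 + |s|^2]; multiplying by
    it leaves an expression of degree two in [s] and its conjugate. *)
Lemma proj_curve P x y (s : C) : kproj k P ->
  P *m x = x -> P *m y = 0 -> ctmx x *m x = 1%:M -> ctmx y *m y = 1%:M ->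
  exists2 Q, kproj k Q & forall A, (1 + s * Num.conj s) * \tr (A *m Q) =
    \tr (A *m P) + s * \tr (A *m (y *m ctmx x)) + Num.conj s * \tr (A *m (x *m ctmx y)) +
    s * Num.conj s * (\tr (A *m P) - \tr (A *m (x *m ctmx x)) + \tr (A *m (y *m ctmx y))).
Proof.
move=> [hP [iP tP]] Px Py xx yy.
have xP : ctmx x *m P = ctmx x by rewrite -[in LHS]hP -ctmx_mul Px.
have yP : ctmx y *m P = 0.
  by rewrite -[in LHS]hP -ctmx_mul Py; apply/matrixP => i j; rewrite !mxE rmorph0.
have xy : ctmx x *m y = 0 by rewrite -xP -mulmxA Py mulmx0.
have yx : ctmx y *m x = 0 by rewrite -Px mulmxA yP mul0mx.
have [N eN] : exists N : C, N = 1 + s * Num.conj s by exists (1 + s * Num.conj s).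
rewrite -eN.
have N0 : N != 0.
  by rewrite eN gt_eqF // ltr_wpDr // mul_conjC_ge0.
have cN : Num.conj N = N by rewrite eN rmorphD rmorph1 rmorphM [X in _ * X]conjCK mulrC.
have [z ez] : exists z, z = x + s *: y by exists (x + s *: y).
have zz : ctmx z *m z = N%:M.
  rewrite ez ctmxD ctmxZ mulmxDr !mulmxDl -!scalemxAl -!scalemxAr xx yy xy yx.
  rewrite !scaler0 addr0 add0r scalerA -[X in X + _]scale1r -scalerDl scalemx1.
  by rewrite eN [s * _]mulrC.
have Pz : P *m z = x by rewrite ez mulmxDr -scalemxAr Px Py scaler0 addr0.
have zP : ctmx z *m P = ctmx x by rewrite -[in LHS]hP -ctmx_mul Pz.
have xz : ctmx x *m z = 1%:M.
  by rewrite ez mulmxDr -scalemxAr xx xy scaler0 addr0.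
have zx : ctmx z *m x = 1%:M.
  by rewrite ez ctmxD ctmxZ mulmxDl -scalemxAl xx yx scaler0 addr0.
exists (P - x *m ctmx x + N^-1 *: (z *m ctmx z)); first split; [|split|].
- by rewrite hcmxD hcmxB hcmxZ !hcmx_outer fmorphV /= cN hP.
- pose E := P - x *m ctmx x.
  have EE : E *m E = E.
    rewrite mulmxBr !mulmxBl iP -!mulmxA xP (mulmxA (ctmx x)) xx mul1mx.
    by rewrite (mulmxA P) Px !subrr subr0.
  have Ez : E *m z = 0 by rewrite mulmxBl -mulmxA Pz xz mulmx1 subrr.
  have zE : ctmx z *m E = 0 by rewrite mulmxBr mulmxA zP zx mul1mx subrr.
  rewrite -/E; move: E EE Ez zE => E EE Ez zE.
  rewrite mulmxDr !mulmxDl EE -!scalemxAr -!scalemxAl.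
  rewrite (mulmxA E) Ez -(mulmxA z _ E) zE -(mulmxA z) (mulmxA (ctmx z)) zz.
  rewrite mul0mx mulmx0 !scaler0 addr0 add0r mul_scalar_mx -scalemxAr !scalerA.
  by rewrite -mulrA (mulVf N0) mulr1.
- rewrite mxtraceD mxtraceZ [\tr (_ - _)]linearB /= tP (mxtrace_mulC x) (mxtrace_mulC z) xx zz !mxtrace_scalar.
  by rewrite !mulr1n (mulVf N0) subrK.
move=> A; rewrite mulmxDr mulmxBr -scalemxAr mxtraceD mxtraceZ [\tr (_ - _)]linearB /=.
rewrite mulrDr mulrA (mulfV N0) mul1r.
have -> : z *m ctmx z = x *m ctmx x + Num.conj s *: (x *m ctmx y) +
    s *: (y *m ctmx x) + (s * Num.conj s) *: (y *m ctmx y).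
  rewrite ez ctmxD ctmxZ mulmxDl !mulmxDr -!scalemxAl -!scalemxAr scalerA.
  by rewrite addrA.
rewrite !mulmxDr -!scalemxAr !mxtraceD !mxtraceZ eN.
by ring.
Qed.

End Curve.

Lemma ex_subset_card (n k : nat) (i j : 'I_n) : (0 < k < n)%N -> i != j ->
  exists J : {set 'I_n}, [/\ #|J| = k, i \in J & j \notin J].
Proof.
move=> /andP[k0 kn] ij.
have [B [BS cB]] : exists B : {set 'I_n}, B \subset [set~ i] :\ j /\ #|B| = k.-1.
  pose s := take k.-1 (enum ([set~ i] :\ j)).
  have cc : #|[set~ i] :\ j| = n.-2.
    by have := cardsD1 j [set~ i]; rewrite cardsC1 card_ord !inE eq_sym ij; lia.
  exists [set x in s]; split.
    by apply/subsetP => x; rewrite inE => /mem_take; rewrite mem_enum.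
  rewrite cardsE (card_uniqP _) ?take_uniq ?enum_uniq // size_takel // -cardE cc.
  by lia.
have iB : i \notin B by apply/negP => /(subsetP BS); rewrite !inE eqxx andbF.
have jB : j \notin B by apply/negP => /(subsetP BS); rewrite !inE eqxx.
exists (i |: B); split; rewrite ?cardsU1 ?iB ?cB ?inE ?eqxx //=; first lia.
by rewrite negb_or jB eq_sym ij.
Qed.

Section Herm.
Variables (C : numClosedFieldType) (n k : nat).
Implicit Types A B H P Q : 'M[C]_n.
Implicit Types x y : 'cV[C]_n.

Lemma ctmx_mulE x : ctmx x *m x = (\sum_i `|x i 0| ^+ 2)%:M.
Proof.
rewrite [LHS]mx11_scalar; congr (_ %:M); rewrite mxE; apply: eq_bigr => i _.
by rewrite !mxE mulrC -normCK.
Qed.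

Lemma unit_column x : x != 0 -> exists2 a : C, a != 0 & ctmx (a *: x) *m (a *: x) = 1%:M.
Proof.
move=> x0.
have q0 : 0 < \sum_i `|x i 0| ^+ 2.
  rewrite lt_def sumr_ge0 ?andbT => [|i _]; last by rewrite exprn_ge0.
  apply: contraNneq x0 => q0; apply/eqP/matrixP => i j; rewrite ord1 mxE.
  move: q0 => /eqP; rewrite psumr_eq0 => [|l _]; last by rewrite exprn_ge0.
  by move=> /allP /(_ i (mem_index_enum _)); rewrite /= expf_eq0 normr_eq0 => /eqP.
set q := \sum_i _ in q0.
have a0 : (sqrtC q)^-1 != 0 by rewrite invr_eq0 sqrtC_eq0 gt_eqF.
exists (sqrtC q)^-1 => //.
rewrite ctmxZ -scalemxAl -scalemxAr ctmx_mulE -/q !scale_scalar_mx; congr (_%:M).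
rewrite fmorphV /= conj_Creal ?ger0_real ?sqrtC_ge0 ?ltW //.
by rewrite mulrA -expr2 exprVn sqrtCK mulVf ?gt_eqF.
Qed.

(** The block [(1 - P) H P] is tested on [P e_i] and [(1 - P) e_j], rescaled to unit vectors because
    only those generate curves of projections. With its adjoint it vanishes, so [H] is block
    diagonal. *)
Lemma comm_of_offdiag P H : kproj k P -> hcmx H = H ->
  (forall x y, P *m x = x -> P *m y = 0 -> ctmx x *m x = 1%:M -> ctmx y *m y = 1%:M ->
     \tr (H *m (x *m ctmx y)) = 0) -> P *m H = H *m P.
Proof.
move=> [hP [iP _]] hH h.
have key : (1%:M - P) *m (H *m P) = 0.
  apply/matrixP => j i; rewrite [RHS]mxE.
  pose x : 'cV[C]_n := P *m delta_mx i 0.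
  pose y : 'cV[C]_n := (1%:M - P) *m delta_mx j 0.
  have -> : ((1%:M - P) *m (H *m P)) j i = \tr (H *m (x *m ctmx y)).
    rewrite /x /y ctmx_mul hcmxB hcmx1 hP.
    rewrite (_ : ctmx (delta_mx j 0) = delta_mx 0 j); last first.
      by rewrite /ctmx trmx_delta map_delta_mx.
    transitivity (\tr (delta_mx 0 j *m ((1%:M - P) *m (H *m P)) *m delta_mx i 0 : 'M[C]_1)).
      by rewrite -rowE -colE /mxtrace big_ord1 !mxE.
    by rewrite -!mulmxA (mulmxA (delta_mx 0 j)) mxtrace_mulC !mulmxA.
  have [->|x0] := eqVneq x 0; first by rewrite mul0mx mulmx0 mxtrace0.
  have [->|y0] := eqVneq y 0.
    rewrite (_ : ctmx 0 = 0) ?mulmx0 ?mxtrace0 //.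
    by apply/matrixP => ? ?; rewrite !mxE conjC0.
  have [a a0 xa] := unit_column x0; have [b b0 yb] := unit_column y0.
  have : \tr (H *m ((a *: x) *m ctmx (b *: y))) = 0.
    apply: h => //; rewrite -scalemxAr /x /y mulmxA.
      by rewrite iP.
    by rewrite mulmxBr mulmx1 iP subrr mul0mx scaler0.
  rewrite ctmxZ -scalemxAl -!scalemxAr !mxtraceZ => /eqP.
  by rewrite !mulf_eq0 conjC_eq0 (negPf a0) (negPf b0) => /eqP.
have e1 : H *m P = P *m (H *m P).
  by apply/eqP; rewrite -subr_eq0 -[X in X - _]mul1mx -mulmxBl key.
have e2 : P *m H = P *m (H *m P).
  by have := congr1 (@hcmx C n) e1; rewrite !hcmxM hP hH mulmxA.
by rewrite e2 -e1.
Qed.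

Lemma mxtrace_delta A i j : \tr (A *m delta_mx i j) = A j i.
Proof.
rewrite /mxtrace (bigD1 j) //= mxE (bigD1 i) //= mxE !eqxx mulr1.
rewrite big1 => [|l li]; last by rewrite mxE (negPf li) mulr0.
rewrite big1 ?addr0 // => m mj; rewrite mxE big1 // => l _.
by rewrite mxE (negPf mj) andbF mulr0.
Qed.

Lemma curve_delta (J : {set 'I_n}) i j (s : C) : #|J| = k -> i \in J -> j \notin J ->
  exists2 Q, kproj k Q & forall A, (1 + s * Num.conj s) * \tr (A *m Q) =
    \tr (A *m dproj C J) + s * A i j + Num.conj s * A j i +
    s * Num.conj s * (\tr (A *m dproj C J) - A i i + A j j).
Proof.
move=> cJ iJ jJ.
have ct (l : 'I_n) : ctmx (delta_mx l 0 : 'cV[C]_n) = delta_mx 0 l.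
  by rewrite /ctmx trmx_delta map_delta_mx.
have [||||Q hQ eQ] := @proj_curve C n k (dproj C J) (delta_mx i 0) (delta_mx j 0) s
    (dproj_proj C cJ).
- apply/matrixP => a b; rewrite mul_diag_mx !mxE.
  by case: (eqVneq a i) => [->|]; rewrite ?iJ ?mul1r //= mulr0.
- apply/matrixP => a b; rewrite mul_diag_mx !mxE.
  by case: (eqVneq a j) => [->|]; rewrite ?(negPf jJ) ?mul0r //= mulr0.
- by rewrite ct mul_delta_mx; apply/matrixP => a b; rewrite !mxE !ord1.
- by rewrite ct mul_delta_mx; apply/matrixP => a b; rewrite !mxE !ord1.
by exists Q => // A; rewrite eQ !ct !mul_delta_mx !mxtrace_delta.
Qed.

Lemma scalar_of_tr A c : (0 < k < n)%N -> (forall P, kproj k P -> \tr (A *m P) = c) ->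
  exists a : C, A = a%:M.
Proof.
move=> kn h.
have key i j : i != j -> A i j = 0 /\ A i i = A j j.
  move=> ij; have [J [cJ iJ jJ]] := ex_subset_card kn ij.
  have e s : s * A i j + Num.conj s * A j i + s * Num.conj s * (A j j - A i i) = 0.
    have [Q hQ /(_ A)] := curve_delta s cJ iJ jJ.
    rewrite (h _ hQ) (h _ (dproj_proj C cJ)) => e.
    apply/eqP; rewrite -(subrr ((1 + s * Num.conj s) * c)) {1}e; apply/eqP; ring.
  (* Adding [s = 1] and [s = -1] kills the linear terms and equates the diagonal entries; then
     [s = 1] gives [A i j + A j i = 0] and [s = 'i] gives [A i j = A j i]. *)
  have := e 1; have := e (- 1); have := e 'i.
  rewrite conjCi rmorphN rmorph1 => e1 e2 e3.
  have i0 : 'i != 0 :> C := neq0Ci C.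
  have d : A j j = A i i.
    have : (A j j - A i i) *+ 2 = 0.
      by have := congr2 +%R e2 e3; rewrite addr0 => <-; ring.
    by move/eqP; rewrite mulrn_eq0 /= subr_eq0 => /eqP.
  split=> //; have /eqP : 'i * (A i j - A j i) = 0 by rewrite -e1 d; ring.
  rewrite mulf_eq0 (negPf i0) subr_eq0 /= => /eqP eij.
  have /eqP : A i j *+ 2 = 0 by rewrite -e3 d -eij; ring.
  by rewrite mulrn_eq0 => /eqP.
have [i0 n0] : exists i : 'I_n, true by exists (Ordinal (leq_ltn_trans (leq0n _) (andP kn).2)).
exists (A i0 i0); apply/matrixP => i j; rewrite mxE.
have [<-|ij] := eqVneq i j; last by rewrite (key _ _ ij).1 mulr0n.
rewrite mulr1n; have [->//|ii] := eqVneq i i0; exact: (key _ _ ii).2.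
Qed.

End Herm.

(** * The trace form: positivity, adjoints, spanning by projections *)

Section TraceForm.
Variables (C : numClosedFieldType) (n k : nat).
Implicit Types A B H P Q : 'M[C]_n.

Lemma trmul_hc_ge0 A : 0 <= \tr (A *m hcmx A).
Proof.
apply: sumr_ge0 => i _; rewrite mxE; apply: sumr_ge0 => j _.
by rewrite hcmxE mul_conjC_ge0.
Qed.

Lemma trmul_hc_eq0 A : \tr (A *m hcmx A) = 0 -> A = 0.
Proof.
have ge0 i : 0 <= (A *m hcmx A) i i.
  by rewrite mxE; apply: sumr_ge0 => j _; rewrite hcmxE mul_conjC_ge0.
move/eqP; rewrite psumr_eq0 // => /allP h; apply/matrixP => i j.
have := h i (mem_index_enum _); rewrite /= mxE psumr_eq0 => [/allP|l _]; last first.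
  by rewrite hcmxE mul_conjC_ge0.
by move=> /(_ j (mem_index_enum _)); rewrite /= hcmxE mul_conjC_eq0 mxE => /eqP.
Qed.

Lemma trmul_real A B : hcmx A = A -> hcmx B = B -> Num.conj (\tr (A *m B)) = \tr (A *m B).
Proof. by move=> hA hB; rewrite -mxtrace_hc hcmxM hA hB mxtrace_mulC. Qed.

Lemma sqr_trmul_le A B : hcmx A = A -> hcmx B = B ->
  \tr (A *m B) ^+ 2 <= \tr (A *m A) * \tr (B *m B).
Proof.
move=> hA hB; have b0 : 0 <= \tr (B *m B) by rewrite -{2}hB trmul_hc_ge0.
have [/eqP e|bn0] := boolP (\tr (B *m B) == 0).
  have -> : B = 0 by apply: trmul_hc_eq0; rewrite hB.
  by rewrite !mulmx0 mxtrace0 mulr0 expr0n.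
have {}b0 : 0 < \tr (B *m B) by rewrite lt_def bn0.
pose l := \tr (A *m B) / \tr (B *m B).
have lr : Num.conj l = l by rewrite /l rmorphM fmorphV /= !trmul_real.
have hD : hcmx (A - l *: B) = A - l *: B by rewrite hcmxB hcmxZ lr hA hB.
have := trmul_hc_ge0 (A - l *: B); rewrite hD.
rewrite mulmxBl !mulmxBr -!scalemxAl -!scalemxAr !linearB /= !mxtraceZ.
rewrite (mxtrace_mulC B A) => h; rewrite -subr_ge0 -(pmulr_lge0 _ b0).
have -> : (\tr (A *m A) * \tr (B *m B) - \tr (A *m B) ^+ 2) * \tr (B *m B) =
  (\tr (A *m A) - l * \tr (A *m B) - (l * \tr (A *m B) - l * (l * \tr (B *m B)))) *
   \tr (B *m B) ^+ 2.
  rewrite /l; field; exact: bn0.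
by rewrite mulr_ge0 // exprn_ge0 // ltW.
Qed.

Lemma trproj_ge0 P Q : kproj k P -> kproj k Q -> 0 <= \tr (P *m Q).
Proof.
move=> [hP [iP _]] [hQ [iQ _]]; have := trmul_hc_ge0 (P *m Q).
by rewrite hcmxM hP hQ mulmxA mxtrace_mulC -(mulmxA P) iQ mulmxA iP.
Qed.

(** The squared Frobenius distance; through it [tr(P Q) = k] forces [Q = P], on which the uniqueness
    of maximisers rests. *)
Lemma trproj_dist P Q : kproj k P -> kproj k Q ->
  \tr ((Q - P) *m (Q - P)) = (k%:R - \tr (P *m Q)) *+ 2.
Proof.
move=> [hP [iP tP]] [hQ [iQ tQ]].
rewrite mulmxBl !mulmxBr iP iQ !linearB /= tP tQ (mxtrace_mulC Q P); ring.
Qed.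

Lemma trproj_le P Q : kproj k P -> kproj k Q -> \tr (P *m Q) <= k%:R.
Proof.
move=> hP hQ; rewrite -subr_ge0 -(pmulrn_lge0 _ (isT : (0 < 2)%N)) -trproj_dist //.
have {2}-> : Q - P = hcmx (Q - P) by rewrite hcmxB hP.1 hQ.1.
exact: trmul_hc_ge0.
Qed.

Lemma trproj_eq P Q : kproj k P -> kproj k Q -> \tr (P *m Q) = k%:R -> Q = P.
Proof.
move=> hP hQ e; apply/eqP; rewrite -subr_eq0; apply/eqP; apply: trmul_hc_eq0.
by rewrite hcmxB hP.1 hQ.1 trproj_dist // e subrr mul0rn.
Qed.

Lemma tr_linear A B (a b : C) P :
  \tr ((a *: A + b *: B) *m P) = a * \tr (A *m P) + b * \tr (B *m P).
Proof. by rewrite mulmxDl -!scalemxAl mxtraceD !mxtraceZ. Qed.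

End TraceForm.

Section TraceDual.
Variables (C : numClosedFieldType) (n : nat).
Implicit Types A B P Q X Y : 'M[C]_n.

Lemma trmul_inj X Y : (forall A, \tr (A *m X) = \tr (A *m Y)) -> X = Y.
Proof.
move=> h; apply/matrixP => i j.
by rewrite -!mxtrace_delta mxtrace_mulC h mxtrace_mulC.
Qed.

(** The adjoint for the bilinear form [tr(A X)], without conjugation, so that it stays complex
    linear. The indices are exchanged because [tr(delta_mx j i *m Y)] is [Y i j]. *)
Definition trace_adj (T : 'M[C]_n -> 'M[C]_n) X : 'M[C]_n :=
  \matrix_(i, j) \tr (T (delta_mx j i) *m X).

Lemma trace_adj_is_linear T : linear (trace_adj T).
Proof.
move=> a X Y; apply/matrixP => i j.
by rewrite !mxE mulmxDr -scalemxAr mxtraceD mxtraceZ.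
Qed.

HB.instance Definition _ T := GRing.isLinear.Build C 'M[C]_n 'M[C]_n _ (trace_adj T)
  (trace_adj_is_linear T).

Lemma trace_adjE (T : {linear 'M[C]_n -> 'M[C]_n}) A X :
  \tr (T A *m X) = \tr (A *m trace_adj T X).
Proof.
rewrite {1}[A]matrix_sum_delta linear_sum mulmx_suml linear_sum.
rewrite [RHS]/mxtrace; apply: eq_bigr => i _.
rewrite linear_sum mulmx_suml linear_sum mxE; apply: eq_bigr => j _.
by rewrite linearZ /= -scalemxAl mxtraceZ !mxE.
Qed.

Lemma tr_idem_ge0 P Q : hcmx P = P -> P *m P = P -> hcmx Q = Q -> Q *m Q = Q ->
  0 <= \tr (P *m Q).
Proof.
move=> hP iP hQ iQ; have := trmul_hc_ge0 (P *m Q).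
by rewrite hcmxM hP hQ mulmxA mxtrace_mulC -(mulmxA P) iQ mulmxA iP.
Qed.

(** With [E = P Q] projecting on the intersection of the ranges and [F] on the orthogonal complement
    of their sum, [P + Q = 1 + E - F]. The gap between the two sides is [tr(E (1 - X)) + tr(F X)],
    two traces of products of projections. *)
Lemma tr_comm_proj_le k P Q X : kproj k P -> kproj k Q -> kproj k X -> comm_mx P Q ->
  \tr ((P + Q) *m X) <= \tr ((P + Q) *m Q).
Proof.
move=> [hP [iP tP]] [hQ [iQ tQ]] [hX [iX tX]] c.
have [E PQ] : exists E, P *m Q = E by eexists.
have QP : Q *m P = E by rewrite -c.
have PE : P *m E = E by rewrite -PQ mulmxA iP.
have QE : Q *m E = E by rewrite -QP mulmxA iQ.
have EP : E *m P = E by rewrite -QP -mulmxA iP.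
have EQ : E *m Q = E by rewrite -PQ -mulmxA iQ.
have iE : E *m E = E by rewrite -{1}PQ -mulmxA QE PE.
have hE : hcmx E = E by rewrite -{1}PQ hcmxM hP hQ QP.
have [F eF] : exists F, F = 1%:M - (P + Q - E) by eexists.
have hF : hcmx F = F by rewrite eF !hcmxB hcmxD hcmx1 hP hQ hE.
have iF : F *m F = F.
  have PF : P *m F = 0.
    by rewrite eF !mulmxBr mulmxDr mulmx1 iP PQ PE addrK subrr.
  have QF : Q *m F = 0.
    by rewrite eF !mulmxBr mulmxDr mulmx1 iQ QP QE [E + Q]addrC addrK subrr.
  have EF : E *m F = 0 by rewrite -PQ -mulmxA QF mulmx0.
  by rewrite {1}eF !mulmxBl mulmxDl mul1mx PF QF EF addr0 !subr0.
have h1 : 0 <= \tr (E *m (1%:M - X)).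
  apply: tr_idem_ge0 => //; first by rewrite hcmxB hcmx1 hX.
  by rewrite mulmxBl mul1mx mulmxBr mulmx1 iX subrr subr0.
have h2 : 0 <= \tr (F *m X) by apply: tr_idem_ge0.
have := addr_ge0 h1 h2.
have -> : \tr ((P + Q) *m Q) = \tr E + k%:R by rewrite mulmxDl iQ PQ mxtraceD tQ.
move=> h; rewrite -subr_ge0; move: h.
have -> : \tr (E *m (1%:M - X)) = \tr E - \tr (E *m X).
  by rewrite mulmxBr mulmx1 linearB.
have -> : \tr (F *m X) = k%:R - (\tr ((P + Q) *m X) - \tr (E *m X)).
  by rewrite eF mulmxBl mul1mx linearB /= tX mulmxBl linearB.
suff -> : \tr E - \tr (E *m X) + (k%:R - (\tr ((P + Q) *m X) - \tr (E *m X))) =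
  \tr E + k%:R - \tr ((P + Q) *m X) by [].
ring.
Qed.

Lemma kproj_conj k (U : 'M[C]_n) P : U *m hcmx U = 1%:M -> kproj k P ->
  kproj k (hcmx U *m P *m U).
Proof.
move=> hU [hP [iP tP]]; split; [|split].
- by rewrite !hcmxM hcmxK hP mulmxA.
- by rewrite !mulmxA -(mulmxA _ U) hU mulmx1 -(mulmxA _ P P) iP.
- by rewrite mxtrace_mulC mulmxA hU mul1mx.
Qed.

End TraceDual.

Section LinearForms.
Variables (C : numClosedFieldType) (n k : nat).

Lemma comm_all_scalar (A : 'M[C]_n) : (0 < n)%N ->
  (forall B, comm_mx A B) -> exists a : C, A = a%:M.
Proof.
move=> n0 h; pose i0 := Ordinal n0.
have key i j : A i j = A i0 i0 *+ (i == j).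
  have /matrixP /(_ i i0) := h (delta_mx j i0).
  rewrite !mxE (bigD1 j) //= big1 => [|l lj]; last by rewrite mxE (negPf lj) /= mulr0.
  rewrite [in RHS](bigD1 i0) //= big1 => [|l lj]; last by rewrite mxE (negPf lj) andbF mul0r.
  by rewrite !mxE !eqxx andbT mulr1 !addr0 mulr_natl => ->; rewrite andbT.
by exists (A i0 i0); apply/matrixP => i j; rewrite mxE key.
Qed.

Lemma linear_form_tr (f : 'M[C]_n -> C) : linear_for *%R f ->
  exists A, forall X, f X = \tr (A *m X).
Proof.
move=> lf; pose fl : {scalar 'M[C]_n} := HB.pack f (GRing.isLinear.Build _ _ _ _ f lf).
exists (\matrix_(i, j) f (delta_mx j i)) => X.
have -> : f X = \sum_i \sum_j X i j * f (delta_mx i j).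
  have -> : f X = fl X by [].
  rewrite {1}[X]matrix_sum_delta linear_sum; apply: eq_bigr => i _.
  by rewrite linear_sum; apply: eq_bigr => j _; rewrite linearZ.
rewrite exchange_big; apply: eq_bigr => i _; rewrite mxE.
by apply: eq_bigr => j _; rewrite !mxE mulrC.
Qed.

(** The rank-[k] projections thus span all matrices: the form is [tr(A X)] with [A] scalar, and its
    value at one projection kills the scalar. *)
Lemma linear_form_eq0 (f : 'M[C]_n -> C) : (0 < k < n)%N -> linear_for *%R f ->
  (forall P, kproj k P -> f P = 0) -> forall X, f X = 0.
Proof.
move=> kn lf h X; have [A fA] := linear_form_tr lf.
have [|a ea] := @scalar_of_tr _ n k A 0 kn; first by move=> P /h <-; rewrite fA.
have [P hP] := proj_exists C (ltnW (andP kn).2).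
have /eqP := h P hP; rewrite fA ea mul_scalar_mx mxtraceZ hP.2.2 mulf_eq0 pnatr_eq0.
case/orP=> [/eqP a0|/eqP k0]; last by rewrite k0 in kn.
by rewrite fA ea a0 mul_scalar_mx mxtraceZ mul0r.
Qed.

End LinearForms.

(** * Vectors whose sums over [k]-subsets are zero or one *)

Lemma ex_set_between (n k : nat) (I O : {set 'I_n}) : [disjoint I & O] ->
  (#|I| <= k)%N -> (k + #|O| <= n)%N ->
  exists J : {set 'I_n}, [/\ #|J| = k, I \subset J & [disjoint J & O]].
Proof.
move=> dIO Ik kO; pose s := take (k - #|I|) (enum (~: O :\: I)).
have IO : I \subset ~: O by rewrite subsetC -disjoints_subset disjoint_sym.
have cc : #|~: O :\: I| = (n - #|O| - #|I|)%N.
  by rewrite cardsD (setIidPr IO) cardsCs setCK card_ord.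
have sP x : x \in s -> x \in ~: O :\: I by move=> /mem_take; rewrite mem_enum.
exists (I :|: [set x in s]); split.
- rewrite cardsU (_ : I :&: _ = set0) ?cards0 ?subn0.
    rewrite cardsE (card_uniqP _) ?take_uniq ?enum_uniq // size_takel -?cardE ?cc; lia.
  by apply/setP => x; rewrite !inE; apply/negP => /andP[xI /sP]; rewrite !inE xI.
- exact: subsetUl.
- rewrite disjoints_subset subUset IO; apply/subsetP => x; rewrite inE => /sP.
  by rewrite !inE => /andP[].
Qed.

Section ZeroOne.
Variable F : numFieldType.

Definition zero_one (x : F) := x = 0 \/ x = 1.

Lemma zero_oneB x y : zero_one x -> zero_one y -> [\/ x - y = 0, x - y = 1 | x - y = -1].
Proof.
case=> -> [] ->; rewrite ?subrr ?subr0 ?sub0r; [exact: Or31|exact: Or33|exact: Or32|exact: Or31].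
Qed.

(** Each row has a single one, in a column that no other row uses, so [f] is a permutation matrix:
    the column sums are at most one and add up to [n], hence none falls short. *)
Lemma zero_one_rows (n : nat) (f : 'I_n -> 'I_n -> F) :
  (forall i a, zero_one (f i a)) -> (forall i, \sum_a f i a = 1) ->
  (forall i j, i != j -> exists a, f i a != f j a) ->
  (forall i j a, f i a * f j a = f i a *+ (i == j)) /\ (forall a, \sum_i f i a = 1).
Proof.
move=> f01 f1 fd.
have ge0 i a : 0 <= f i a by case: (f01 i a) => ->.
have le1 i a : f i a <= 1 by case: (f01 i a) => ->.
have uni i a b : f i a = 1 -> b != a -> f i b = 0.
  move=> fa ba; have := f1 i; rewrite (bigD1 a) //= fa -[RHS]addr0 => /addrI /eqP.
  by rewrite psumr_eq0 // => /allP /(_ b (mem_index_enum _)); rewrite ba => /eqP.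
have orth i j a : i != j -> f i a * f j a = 0.
  move=> /fd[b fb]; case: (f01 i a) => [->|ia]; first by rewrite mul0r.
  case: (f01 j a) => [->|ja]; first by rewrite mulr0.
  have [ba|ba] := eqVneq b a; first by rewrite ba ia ja eqxx in fb.
  by rewrite (uni _ _ _ ia ba) (uni _ _ _ ja ba) eqxx in fb.
have prodE i j a : f i a * f j a = f i a *+ (i == j).
  case: eqVneq => [<-|]; last exact: orth.
  by case: (f01 i a) => ->; rewrite ?mulr0 ?mulr1.
have col a : \sum_i f i a <= 1.
  have [/forallP h|] := boolP [forall i, f i a == 0].
    by rewrite big1 // => i _; exact/eqP.
  rewrite negb_forall => /existsP[i fi].
  have ia : f i a = 1 by case: (f01 i a) fi => ->; rewrite ?eqxx.
  rewrite (bigD1 i) //= ia big1 ?addr0 // => j ji.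
  by have := orth j i a ji; rewrite ia mulr1.
split=> // a; apply/eqP; rewrite eq_sym -subr_eq0.
have : \sum_b (1 - \sum_i f i b) = 0.
  rewrite sumrB exchange_big /= [X in _ - X](eq_bigr (fun=> 1)) ?subrr //.
move/eqP; rewrite psumr_eq0 => [/allP /(_ a (mem_index_enum _)) //|b _].
by rewrite subr_ge0.
Qed.

(** Exchanging one index of [J] shows that entries differ by [0], [1] or [-1]; exchanging two at
    once forbids two disjoint pairs with difference one. So [h] is constant up to one spike, upward
    ([x]) from level [0] or downward ([y]) from level [1/k]. Boolean flags allow spikes to be
    counted later. *)
Lemma zero_one_column (n k : nat) (h : 'I_n -> F) : (2 <= k)%N -> (k + 2 <= n)%N ->
  (forall J : {set 'I_n}, #|J| = k -> zero_one (\sum_(i in J) h i)) ->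
  exists (i0 : 'I_n) (x y : bool) (v : F),
    (forall j, h j = v + (x%:R - y%:R) * (j == i0)%:R) /\
    ((v = 0 /\ y = false) \/ (v = k%:R^-1 /\ x = false)).
Proof.
move=> k2 kn h01.
have k0 : (k%:R : F) != 0 by rewrite pnatr_eq0; lia.
have sum2 (J : {set 'I_n}) i : i \in J -> \sum_(l in J) h l = h i + \sum_(l in J :\ i) h l.
  by move=> iJ; rewrite (big_setD1 i).
have swap1 i j : i != j -> [\/ h i - h j = 0, h i - h j = 1 | h i - h j = -1].
  move=> ij; have [|||J [cJ iJ jJ]] := @ex_set_between n k [set i] [set j].
  - by rewrite disjoints1 inE.
  - by rewrite cards1; lia.
  - by rewrite cards1; lia.
  rewrite sub1set in iJ; rewrite disjoint_sym disjoints1 in jJ.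
  have jJi : j \notin J :\ i by rewrite !inE negb_and jJ orbT.
  have cJ' : #|j |: J :\ i| = k.
    by rewrite cardsU1 jJi -cJ (cardsD1 i J) iJ.
  have := zero_oneB (h01 J cJ) (h01 _ cJ').
  by rewrite (sum2 J i iJ) big_setU1 //= opprD addrACA subrr addr0.
have two_neq0 : 2 != 0 :> F by rewrite pnatr_eq0.
have two_neq1 : 2 != 1 :> F by rewrite (eqr_nat F 2 1).
have two_neqN1 : 2 != -1 :> F by rewrite -subr_eq0 opprK natr1 pnatr_eq0.
have swap2 i j l m : i \notin [:: j; l; m] -> j \notin [:: l; m] -> l != m ->
    h i - h j = 1 -> h l - h m = 1 -> False.
  rewrite !inE !negb_or => /and3P[ij il im] /andP[jl jm] lm eij elm.
  have [|||J [cJ iJ jJ]] := @ex_set_between n k [set i; l] [set j; m].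
  - by rewrite disjoints_subset subUset !sub1set !inE !negb_or ij im eq_sym jl lm.
  - by rewrite cards2 il.
  - by rewrite cards2 jm.
  move: iJ; rewrite subUset !sub1set => /andP[iJ lJ].
  move: jJ; rewrite disjoint_sym disjoints_subset subUset !sub1set !inE => /andP[jJ mJ].
  have lJi : l \in J :\ i by rewrite !inE eq_sym il.
  pose K := J :\ i :\ l.
  have mK : m \notin K by rewrite !inE (negPf mJ) !andbF.
  have jK : j \notin m |: K by rewrite !inE (negPf jJ) (negPf jm) !andbF.
  have cK : #|K| = (k - 2)%N.
    by rewrite -cJ (cardsD1 i J) iJ (cardsD1 l (J :\ i)) lJi !addSn add0n !subSS subn0.
  have cJ' : #|j |: (m |: K)| = k by rewrite !cardsU1 jK mK cK addnA addnC subnK.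
  have := zero_oneB (h01 J cJ) (h01 _ cJ').
  rewrite (sum2 J i iJ) (sum2 _ l lJi) -/K big_setU1 //= big_setU1 //=.
  have -> : h i + (h l + \sum_(x in K) h x) - (h j + (h m + \sum_(x in K) h x)) = 2.
    by rewrite -[2]/(1 + 1) -{1}eij -elm; ring.
  by case=> /eqP; rewrite ?(negPf two_neq0) ?(negPf two_neq1) ?(negPf two_neqN1).
have ncase z : z = 0 \/ z = 1 \/ z = -1 :> F -> z + 1 = 0 \/ z + 1 = 1 \/ z + 1 = -1 ->
    z = 0 \/ z = -1.
  case=> [->|[->|->]]; [by left| |by right].
  by rewrite -[1 + 1]/(2%:R); case=> [|[]] /eqP;
    rewrite ?(negPf two_neq0) ?(negPf two_neq1) ?(negPf two_neqN1).
(* A [k]-subset avoiding the spike leaves only [0] and [1/k] for the level; one containing it then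
   fixes the sign of the spike. *)
have finish i0 v (s : F) : (forall j, j != i0 -> h j = v) -> h i0 = v + s ->
    (s = 0 \/ s = 1 \/ s = -1) -> exists (i0 : 'I_n) (x y : bool) (v : F),
    (forall j, h j = v + (x%:R - y%:R) * (j == i0)%:R) /\
    ((v = 0 /\ y = false) \/ (v = k%:R^-1 /\ x = false)).
  move=> hv hi0 hs.
  have [|||J [cJ _ iJ]] := @ex_set_between n k set0 [set i0].
  - by rewrite -setI_eq0 set0I.
  - by rewrite cards0.
  - by rewrite cards1; lia.
  rewrite disjoint_sym disjoints1 in iJ.
  have sJ : zero_one (k%:R * v).
    have := h01 J cJ; rewrite (eq_bigr (fun=> v)) => [|j jJ].
      by rewrite sumr_const cJ mulr_natl.
    by apply: hv; apply: contraNneq iJ => <-.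
  have [|||K [cK iK _]] := @ex_set_between n k [set i0] set0.
  - by rewrite -setI_eq0 setI0.
  - by rewrite cards1; lia.
  - by rewrite cards0; lia.
  rewrite sub1set in iK.
  have sK : zero_one (k%:R * v + s).
    have := h01 K cK; rewrite (sum2 K i0 iK) hi0 (eq_bigr (fun=> v)) => [|j].
      rewrite sumr_const (_ : v + s + _ = k%:R * v + s) //.
      have := cardsD1 i0 K; rewrite iK cK add1n => ->.
      by rewrite -mulr_natl -natr1; ring.
    by rewrite !inE => /andP[ji _]; exact: hv.
  have vE : (v = 0 /\ (s = 0 \/ s = 1)) \/ (v = k%:R^-1 /\ (s = 0 \/ s = -1)).
    case: sJ sK => [/eqP|e]; [rewrite mulf_eq0 (negPf k0) => /eqP v0|].
      by rewrite v0 mulr0 add0r; left.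
    rewrite e addrC => h1; right; split; last first.
      apply: ncase => //; case: h1 => ->; by [left|right; left].
    by rewrite -[LHS](mulKf k0) e mulr1.
  exists i0; case: vE => [[v0 sE]|[v1 sE]].
    exists (s == 1), false, 0; split; last by left.
    move=> j; rewrite add0r subr0; have [->|ji] := eqVneq j i0.
      by rewrite mulr1 hi0 v0 add0r; case: sE => ->; rewrite ?eqxx // eq_sym oner_eq0.
    by rewrite mulr0 hv.
  exists false, (s == -1), k%:R^-1; split; last by right.
  move=> j; rewrite sub0r; have [->|ji] := eqVneq j i0.
    by rewrite mulr1 hi0 v1; case: sE => ->; rewrite ?eqxx // eq_sym oppr_eq0 oner_eq0 oppr0.
  by rewrite mulr0 addr0 hv.
have n0 : (0 < n)%N by lia.
pose z := Ordinal n0.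
have [/forallP hc|] := boolP [forall j, h j == h z].
  apply: (finish z (h z) 0); [by move=> j _; exact/eqP|by rewrite addr0|by left].
rewrite negb_forall => /existsP[j hj].
have [i [l [il eil]]] : exists i l, i != l /\ h i - h l = 1.
  have jz : j != z by apply: contraNneq hj => ->.
  case: (swap1 j z jz) => [/eqP|e|e]; first by rewrite subr_eq0 (negPf hj).
    by exists j, z.
  by exists z, j; rewrite eq_sym jz -opprB e opprK.
have other m : m != i -> m != l -> h m = h i \/ h m = h l.
  move=> mi ml; have [] : h m - h i = 0 \/ h m - h i = -1.
  - apply: ncase; first by case: (swap1 m i mi) => ->; [left|right; left|right; right].
    have -> : h m - h i + 1 = h m - h l by rewrite -eil; ring.
    by case: (swap1 m l ml) => ->; [left|right; left|right; right].
  - by move/eqP; rewrite subr_eq0 => /eqP; left.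
  - move=> e; right; apply/eqP; rewrite -subr_eq0.
    have -> : h m - h l = (h m - h i) + (h i - h l) by ring.
    by rewrite e eil addNr.
(* Either [i] alone is above the level of [l], or some other [m] has the value of [h i], and then
   [l] alone is low: another low [p] would give the disjoint pairs [(i, l)] and [(m, p)]. *)
have [/forallP hall|] := boolP [forall m, (m != i) ==> (h m == h l)].
  apply: (finish i (h l) 1); last by right; left.
    by move=> m mi; apply/eqP; have := hall m; rewrite mi.
  by rewrite -eil; ring.
rewrite negb_forall => /existsP[m]; rewrite negb_imply => /andP[mi hml].
have ml : m != l by apply: contraNneq hml => ->.
have hmi : h m = h i by case: (other m mi ml) => // e; rewrite e eqxx in hml.
apply: (finish l (h i) (-1)); last by right; right.
  move=> p pl; have [->//|pi] := eqVneq p i.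
  case: (other p pi pl) => // hpl.
  have pm : p != m by apply: contraNneq hml => <-; rewrite hpl.
  exfalso; apply: (swap2 i l m p) => //.
  - by rewrite !inE !negb_or il eq_sym mi eq_sym pi.
  - by rewrite !inE !negb_or eq_sym ml eq_sym pl.
  - by rewrite eq_sym.
  - by rewrite hmi hpl.
by rewrite -eil; ring.
Qed.

End ZeroOne.

Lemma subset_sum_const (F : numFieldType) (n k : nat) (s : 'I_n -> F) (c : F) :
  (0 < k < n)%N ->
  (forall J : {set 'I_n}, #|J| = k -> \sum_(i in J) s i = c) -> forall i, s i *+ k = c.
Proof.
move=> kn sJ.
have eq_s l m : s l = s m.
  have [->//|lm] := eqVneq l m.
  have [|||J [cJ lJ mJ]] := @ex_set_between n k [set l] [set m].
  - by rewrite disjoints1 inE.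
  - by rewrite cards1 (andP kn).1.
  - by rewrite cards1 addn1 (andP kn).2.
  rewrite sub1set in lJ; rewrite disjoint_sym disjoints1 in mJ.
  have mJl : m \notin J :\ l by rewrite !inE negb_and mJ orbT.
  have cJ' : #|m |: J :\ l| = k by rewrite cardsU1 mJl -cJ (cardsD1 l J) lJ.
  have := etrans (sJ _ cJ) (esym (sJ _ cJ')).
  by rewrite (big_setD1 l) //= big_setU1 //= => /addIr.
have [|||J [cJ _ _]] := @ex_set_between n k set0 (set0 : {set 'I_n}).
- by rewrite -setI_eq0 set0I.
- by rewrite cards0.
- by rewrite cards0 addn0 ltnW // (andP kn).2.
by move=> i; have := sJ J cJ; rewrite (eq_bigr (fun=> s i)) // sumr_const cJ.
Qed.

Section Simplex.
Variables (F : numFieldType) (n k : nat) (g : 'I_n -> 'I_n -> F).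
Hypothesis kn : (0 < k < n)%N.
Hypothesis g01 : forall (J : {set 'I_n}) a, #|J| = k -> zero_one (\sum_(i in J) g i a).
Hypothesis gk : forall J : {set 'I_n}, #|J| = k -> \sum_a \sum_(i in J) g i a = k%:R.
Hypothesis gd : forall i j, i != j -> exists a, g i a != g j a.

Let k0 : (k%:R : F) != 0.
Proof. by rewrite pnatr_eq0 -lt0n (andP kn).1. Qed.

Lemma row_sum i : \sum_a g i a = 1.
Proof.
apply: (mulIf k0); rewrite mul1r mulr_natr.
apply: (@subset_sum_const _ n k (fun l => \sum_a g l a) _ kn) => J cJ.
by rewrite -(gk cJ) exchange_big.
Qed.

Lemma orthogonal_k1 : k = 1%N -> forall i j a, g i a * g j a = g i a *+ (i == j).
Proof.
move=> k1; have [] // := @zero_one_rows F n g.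
  by move=> i a; have := @g01 [set i] a; rewrite cards1 k1 big_set1; apply.
exact: row_sum.
Qed.

(** Here [f i a] is one minus the sum over the complement of [i], so [f] is a permutation matrix.
    Its column sums force [s a = 1], which makes [f] equal to [g]. *)
Lemma orthogonal_kn1 : (k.+1 = n)%N -> forall i j a, g i a * g j a = g i a *+ (i == j).
Proof.
move=> k1; pose s a := \sum_i g i a; pose f i a := 1 - (s a - g i a).
have sE i a : s a - g i a = \sum_(j in [set~ i]) g j a.
  by rewrite /s (bigD1 i) //= addrAC subrr add0r; apply: eq_bigl => j; rewrite !inE.
have ci (i : 'I_n) : #|[set~ i]| = k by rewrite cardsC1 card_ord -k1.
have nk : (n%:R : F) = k%:R + 1 by rewrite -k1 natr1.
have [|||prodE col] := @zero_one_rows F n f.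
- move=> i a; rewrite /f sE; case: (g01 a (ci i)) => ->; [right|left]; first by rewrite subr0.
  by rewrite subrr.
- move=> i; rewrite sumrB sumr_const card_ord.
  rewrite (eq_bigr (fun a => \sum_(j in [set~ i]) g j a)) => [|a _]; last exact: sE.
  by rewrite gk // nk; ring.
- move=> i j /gd[a ga]; exists a; apply: contraNneq ga.
  by rewrite /f => /addrI/oppr_inj/addrI/oppr_inj ->.
have s1 a : s a = 1.
  have := col a; rewrite /f sumrB sumrB !sumr_const card_ord -/(s a) => e.
  apply: (mulIf k0); apply/esym/eqP; rewrite -subr_eq0 mul1r; apply/eqP.
  rewrite -[s a *+ n]mulr_natr nk in e.
  have -> : k%:R - s a * k%:R = k%:R + 1 - (s a * (k%:R + 1) - s a) - 1 by ring.
  by rewrite e subrr.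
have fg i a : f i a = g i a by rewrite /f s1; ring.
by move=> i j a; rewrite -!fg.
Qed.

(** Row [i] carries [p i] upward and [r i] downward spikes. Row sums equal to one make [p i - r i]
    independent of [i], while each column has at most one spike, which leaves at most [n] in all. A
    nonzero difference therefore uses up every column and yields a permutation matrix or its
    complement; difference zero is excluded by counting. *)
Lemma simplex_dichotomy :
  (forall i j a, g i a * g j a = g i a *+ (i == j)) \/
  [/\ n = (2 * k)%N, (2 < n)%N &
    forall i j a, (k%:R^-1 - g i a) * (k%:R^-1 - g j a) = (k%:R^-1 - g i a) *+ (i == j)].
Proof.
have [k1|k1] := eqVneq k 1%N; first by left; exact: orthogonal_k1.
have [kn1|kn1] := eqVneq k.+1 n; first by left; exact: orthogonal_kn1.
have k2 : (2 <= k)%N by case/andP: kn; lia.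
have kn2 : (k + 2 <= n)%N by case/andP: kn; lia.
have /(@fin_all_exists _ _) [i0 h1] := fun a => zero_one_column k2 kn2 (fun J cJ => g01 a cJ).
have /(@fin_all_exists _ _) [x h2] := h1.
have /(@fin_all_exists _ _) [y h3] := h2.
have /(@fin_all_exists _ _) [v h4] := h3.
have gE i a : g i a = v a + ((x a)%:R - (y a)%:R) * (i == i0 a)%:R := (h4 a).1 i.
have vE a := (h4 a).2; move=> {h1 h2 h3 h4}.
pose p i := (\sum_a (x a && (i == i0 a)))%N; pose r i := (\sum_a (y a && (i == i0 a)))%N.
have xy a : (x a + y a <= 1)%N by case: (vE a) => [] [_ ->]; case: (x a) (y a) => [] [].
have sum1 (z : 'I_n -> bool) : (\sum_i \sum_a (z a && (i == i0 a)) = \sum_a z a)%N.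
  rewrite exchange_big; apply: eq_bigr => a _ /=.
  by rewrite (bigD1 (i0 a)) //= eqxx andbT big1 ?addn0 // => i /negPf ->; rewrite andbF.
have tot : (\sum_i (p i + r i) <= n)%N.
  rewrite big_split /= !sum1 -big_split /= -[X in (_ <= X)%N]card_ord -sum1_card.
  exact: leq_sum.
have row i : \sum_a v a + (p i)%:R - (r i)%:R = 1 :> F.
  transitivity (\sum_a g i a); last exact: row_sum.
  rewrite /p /r !natr_sum -big_split /= -sumrB; apply: eq_bigr => a _.
  by rewrite gE; case: (i == i0 a); rewrite ?andbT ?andbF /=; ring.
have pr i j : (p i + r j = p j + r i)%N.
  apply/eqP; rewrite -(eqr_nat F) !natrD -subr_eq0; apply/eqP.
  have e := etrans (row i) (esym (row j)).
  have -> : (p i)%:R + (r j)%:R - ((p j)%:R + (r i)%:R) =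
    (\sum_a v a + (p i)%:R - (r i)%:R) - (\sum_a v a + (p j)%:R - (r j)%:R) :> F by ring.
  by rewrite e subrr.
have full (z : 'I_n -> bool) : (n <= \sum_a z a)%N -> forall a, z a.
  move=> nz a; apply/negPn/negP => za; move: nz; rewrite leqNgt => /negP; apply.
  rewrite (bigD1 a) //= (negPf za) add0n -[X in (_ < X)%N]card_ord -sum1_card.
  rewrite [X in (_ < X)%N](bigD1 a) //= add1n ltnS.
  by apply: leq_sum => i _; case: (z i).
have n0 : (0 < n)%N by case/andP: kn; lia.
pose i1 := Ordinal n0.
have [lt|gt|eq] := ltngtP (p i1) (r i1).
- have ally : forall a, y a.
    apply: full; rewrite -sum1 -[X in (X <= _)%N]card_ord -sum1_card.
    by apply: leq_sum => i _; have := pr i i1; rewrite -/(r i); lia.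
  have vx a : v a = k%:R^-1 /\ x a = false.
    by case: (vE a) => [[_ ya]|//]; have := ally a; rewrite ya.
  have gE' i a : k%:R^-1 - g i a = (i == i0 a)%:R.
    by rewrite gE (vx a).1 (vx a).2 ally /=; ring.
  right; split; [|lia|].
    (* The complemented array has a single one per column, total [n]; by rows the total is
       [n (n/k - 1)], whence [n = 2k]. *)
    have : \sum_a \sum_i (k%:R^-1 - g i a) = n%:R.
      rewrite (eq_bigr (fun=> 1)) => [|a _]; first by rewrite sumr_const card_ord.
      rewrite (bigD1 (i0 a)) //= gE' eqxx big1 ?addr0 // => i ii.
      by rewrite gE' (negPf ii).
    rewrite exchange_big /= (eq_bigr (fun=> n%:R / k%:R - 1)) => [|i _]; last first.
      by rewrite sumrB row_sum sumr_const card_ord mulr_natl.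
    rewrite sumr_const card_ord => e.
    have n00 : (n%:R : F) != 0 by rewrite pnatr_eq0 -lt0n.
    have e2 : n%:R / k%:R - 1 = 1 :> F.
      by apply: (mulfI n00); rewrite mulr1 [LHS]mulr_natl.
    have e3 : n%:R / k%:R = 2 :> F by rewrite -[LHS](subrK 1) e2.
    have /eqP : n%:R = (2 * k)%:R :> F by rewrite natrM -e3 mulfVK.
    by rewrite eqr_nat => /eqP.
  move=> i j a; rewrite !gE'; have [<-|ij] := eqVneq i j.
    by case: (i == i0 a); rewrite ?mulr0 ?mulr1.
  have [ii|] := eqVneq i (i0 a); last by rewrite mul0r.
  by rewrite -ii eq_sym (negPf ij) mulr0.
- have allx : forall a, x a.
    apply: full; rewrite -sum1 -[X in (X <= _)%N]card_ord -sum1_card.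
    by apply: leq_sum => i _; have := pr i i1; rewrite -/(p i); lia.
  have vy a : v a = 0 /\ y a = false.
    by case: (vE a) => [//|[_ xa]]; have := allx a; rewrite xa.
  have gE' i a : g i a = (i == i0 a)%:R.
    by rewrite gE (vy a).1 (vy a).2 allx /=; ring.
  left=> i j a; rewrite !gE'; have [<-|ij] := eqVneq i j.
    by case: (i == i0 a); rewrite ?mulr0 ?mulr1.
  have [ii|] := eqVneq i (i0 a); last by rewrite mul0r.
  by rewrite -ii eq_sym (negPf ij) mulr0.
(* With [p = r], a row with a spike has at least two, and at most one row has none since two rows
   always differ somewhere. Hence [2 (n - 1) <= n], against [n >= 4]. *)
exfalso.
have prE i : p i = r i by have := pr i i1; lia.
have hit i j : i != j -> (0 < p i + r i)%N || (0 < p j + r j)%N.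
  move=> /gd[a ga]; have [ia|ia] := eqVneq i (i0 a).
    apply/orP; left; rewrite /p /r -big_split (bigD1 a) //= ia eqxx !andbT.
    move: ga; rewrite !gE; case: (x a) (y a) => [] [] //=; rewrite ?subrr ?mul0r ?eqxx //.
  have [ja|ja] := eqVneq j (i0 a).
    apply/orP; right; rewrite /p /r -big_split (bigD1 a) //= ja eqxx !andbT.
    move: ga; rewrite !gE; case: (x a) (y a) => [] [] //=; rewrite ?subrr ?mul0r ?eqxx //.
  by move: ga; rewrite !gE (negPf ia) (negPf ja) eqxx.
have [z hz] : exists z, forall i, i != z -> (2 <= p i + r i)%N.
  have [/forallP h|] := boolP [forall i, 0 < p i + r i]%N.
    by exists i1 => i _; have := h i; rewrite prE; lia.
  rewrite negb_forall => /existsP[z hz]; exists z => i iz.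
  by have := hit i z iz; rewrite (negPf hz) orbF prE; lia.
have : (\sum_(i | i != z) 2 <= n)%N.
  apply: leq_trans tot; rewrite [X in (_ <= X)%N](bigD1 z) //=.
  by apply: leq_trans (leq_addl _ _); apply: leq_sum => i; exact: hz.
rewrite sum_nat_const (eq_card (B := [set~ z])) => [|i]; last by rewrite !inE.
rewrite cardsC1 card_ord; lia.
Qed.

End Simplex.

(** * Simultaneous diagonalisation and the image of an orthonormal basis *)

Lemma unitary_codiag (C : numClosedFieldType) (n : nat) (As : seq 'M[C]_n) :
  {in As, forall A, hcmx A = A} -> {in As &, forall A B, comm_mx A B} ->
  exists2 V : 'M[C]_n, V *m hcmx V = 1%:M &
    {in As, forall A i j, i != j -> (V *m A *m hcmx V) i j = 0}.
Proof.
move=> hA cA; have [V uV /allP tV] := cotrigonalization cA.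
exists V; first exact/unitarymxP.
move=> A AAs; have : is_trig_mx (conjmx V A) := tV A AAs.
  rewrite conjymx // => /is_trig_mxP tr.
have hV : hcmx (V *m A *m hcmx V) = V *m A *m hcmx V.
  by rewrite !hcmxM hcmxK hA // mulmxA.
move=> i j ij; case: (ltngtP i j) => [lt|gt|e]; first exact: tr.
  rewrite -hV hcmxE (_ : (V *m A *m hcmx V) j i = 0) ?conjC0 //; exact: tr.
by rewrite (val_inj e) eqxx in ij.
Qed.

Lemma diag_delta_sum (F : pzRingType) (n : nat) (K : 'M[F]_n) :
  (forall i j, i != j -> K i j = 0) -> K = \sum_i K i i *: delta_mx i i.
Proof.
move=> h; apply/matrixP => a b; rewrite summxE (bigD1 a) //= !mxE eqxx /= big1.
  by have [->|ab] := eqVneq b a; rewrite ?mulr1 addr0 // mulr0 h // eq_sym.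
by move=> i ia; rewrite !mxE eq_sym (negPf ia) mulr0.
Qed.

Lemma herm_spectral (C : numClosedFieldType) (n : nat) (A : 'M[C]_n) : hcmx A = A ->
  exists (U : 'M[C]_n) (d : 'I_n -> C), U *m hcmx U = 1%:M /\
    A = \sum_i d i *: (hcmx U *m delta_mx i i *m U).
Proof.
move=> hA; have [||V hV h] := @unitary_codiag C n [:: A].
- by move=> B; rewrite inE => /eqP ->.
- by move=> B B'; rewrite !inE => /eqP -> /eqP ->.
exists V, (fun i => (V *m A *m hcmx V) i i); split=> //.
have hV' := mulmx1C hV.
have {1}-> : A = hcmx V *m (V *m A *m hcmx V) *m V.
  by rewrite !mulmxA hV' mul1mx -mulmxA hV' mulmx1.
rewrite [in LHS](diag_delta_sum (h A (mem_head _ _))).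
rewrite mulmx_sumr mulmx_suml; apply: eq_bigr => i _.
by rewrite -scalemxAr -scalemxAl.
Qed.

Section Basis.
Variables (C : numClosedFieldType) (n k : nat) (L : {linear 'M[C]_n -> 'M[C]_n}).
Hypothesis kn : (0 < k < n)%N.
Hypothesis Lproj : forall P, kproj k P -> kproj k (L P).
Hypothesis Linj : injective L.
Hypothesis Lcomm : forall P Q, kproj k P -> kproj k Q -> comm_mx P Q -> comm_mx (L P) (L Q).
Variables (U : 'M[C]_n) (hU : U *m hcmx U = 1%:M).

Let E i := hcmx U *m delta_mx i i *m U.

(** [L] is controlled only on rank-[k] projections, so the rank-one [E i] are reached through the
    sums [PJ]. These commute, so their images share an eigenbasis [V], in which the diagonals of the
    [L (E i)] form the array [g] of [simplex_dichotomy]. *)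
Lemma basis_dichotomy :
  (forall i j, L (E i) *m L (E j) = L (E i) *+ (i == j)) \/
  [/\ n = (2 * k)%N, (2 < n)%N & forall i j,
    (k%:R^-1%:M - L (E i)) *m (k%:R^-1%:M - L (E j)) = (k%:R^-1%:M - L (E i)) *+ (i == j)].
Proof.
have hU' := mulmx1C hU.
pose PJ (J : {set 'I_n}) := \sum_(i in J) E i.
have PJE J : PJ J = hcmx U *m dproj C J *m U.
  rewrite /PJ -mulmx_suml -mulmx_sumr; congr (_ *m _ *m _).
  apply/matrixP => a b; rewrite summxE !mxE.
  have [aJ|aJ] := boolP (a \in J).
    rewrite (bigD1 a) //= mxE eqxx big1 ?addr0 => [|i /andP[_ ia]].
      by rewrite /= eq_sym; case: eqP.
    by rewrite mxE eq_sym (negPf ia).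
  rewrite mul0rn big1 // => i iJ; rewrite mxE.
  by case: eqP => // e; rewrite e iJ in aJ.
have pPJ (J : {set 'I_n}) : #|J| = k -> kproj k (PJ J).
  by move=> cJ; rewrite PJE; apply: kproj_conj => //; exact: dproj_proj.
have cPJ (J K : {set 'I_n}) : comm_mx (PJ J) (PJ K).
  rewrite /comm_mx !PJE !mulmxA -!(mulmxA _ U (hcmx U)) hU !mulmx1.
  rewrite -!(mulmxA _ (dproj C _) (dproj C _)); congr (_ *m _ *m _).
  exact: diag_mx_comm.
pose As := [seq L (PJ J) | J <- enum [pred J : {set 'I_n} | #|J| == k]].
have AsP (J : {set 'I_n}) : #|J| = k -> L (PJ J) \in As.
  by move=> cJ; apply: map_f; rewrite mem_enum inE cJ.
have [||V hV dV] := @unitary_codiag C n As.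
- by move=> A /mapP[J]; rewrite mem_enum inE => /eqP cJ ->; have [] := Lproj (pPJ J cJ).
- move=> A B /mapP[J]; rewrite mem_enum inE => /eqP cJ ->.
  move=> /mapP[K]; rewrite mem_enum inE => /eqP cK ->.
  by apply: Lcomm; [exact: pPJ|exact: pPJ|exact: cPJ].
have hV' := mulmx1C hV.
have [M eM] : exists M : 'I_n -> 'M[C]_n, forall i, M i = V *m L (E i) *m hcmx V.
  by exists (fun i => V *m L (E i) *m hcmx V).
have MJ (J : {set 'I_n}) : \sum_(i in J) M i = V *m L (PJ J) *m hcmx V.
  by rewrite /PJ linear_sum mulmx_sumr mulmx_suml; apply: eq_bigr => i _.
have k0 : (k%:R : C) != 0 by rewrite pnatr_eq0 -lt0n (andP kn).1.
(* Off the diagonal all [k]-subset sums vanish, hence all single entries. *)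
have offM i a b : a != b -> M i a b = 0.
  move=> ab; have : M i a b *+ k = 0.
    apply: (@subset_sum_const _ n k (fun i => M i a b) _ kn) => J cJ.
    by rewrite -summxE MJ dV // AsP.
  by move/eqP; rewrite mulrn_eq0 -(pnatr_eq0 C) (negPf k0) => /eqP.
pose g i a := M i a a.
have ME i : M i = diag_mx (\row_a g i a).
  apply/matrixP => a b; rewrite !mxE; case: eqVneq => [<-|ab].
    by rewrite mulr1n.
  by rewrite mulr0n offM.
have LE i : L (E i) = hcmx V *m M i *m V.
  by rewrite eM !mulmxA hV' mul1mx -mulmxA hV' mulmx1.
have [|||h|[e1 e2 h]] := @simplex_dichotomy C n k g kn.
- move=> J a cJ; have -> : \sum_(i in J) g i a = (V *m L (PJ J) *m hcmx V) a a.
    by rewrite -MJ summxE.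
  set x := _ a a; have : x * x = x.
    have [_ [iP _]] := Lproj (pPJ J cJ).
    have : (V *m L (PJ J) *m hcmx V) *m (V *m L (PJ J) *m hcmx V) = V *m L (PJ J) *m hcmx V.
      by rewrite !mulmxA -(mulmxA _ (hcmx V)) hV' mulmx1 -(mulmxA V) iP.
    move=> /matrixP /(_ a a); rewrite mxE (bigD1 a) //= -/x big1 ?addr0 // => b ba.
    by rewrite [X in X * _]dV ?mul0r ?AsP // eq_sym.
  move/eqP; rewrite -subr_eq0 -{3}[x]mulr1 -mulrBr mulf_eq0 subr_eq0.
  by case/orP => /eqP ->; [left|right].
- move=> J cJ; have [_ [_ <-]] := Lproj (pPJ J cJ).
  have -> : \tr (L (PJ J)) = \tr (V *m L (PJ J) *m hcmx V).
    by rewrite mxtrace_mulC mulmxA hV' mul1mx.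
  by rewrite -MJ; apply: eq_bigr => a _; rewrite summxE.
- move=> i j ij; apply/existsP; rewrite -[X in is_true X]negbK negb_exists.
  apply/negP => /forallP e.
  have Mij : M i = M j.
    by rewrite !ME; congr diag_mx; apply/rowP => a; rewrite !mxE; have := e a; rewrite negbK => /eqP.
  have /Linj /(congr1 (fun X => U *m X *m hcmx U)) : L (E i) = L (E j) by rewrite !LE Mij.
  rewrite /E !mulmxA hU !mul1mx -!mulmxA hU !mulmx1 => /matrixP /(_ i i).
  by rewrite !mxE !eqxx (negPf ij) => /eqP; rewrite oner_eq0.
- left=> i j; rewrite !LE !mulmxA -(mulmxA _ V) hV mulmx1 -(mulmxA _ (M i)).
  have -> : M i *m M j = M i *+ (i == j).
    rewrite !ME mulmx_diag -raddfMn; congr diag_mx; apply/rowP => a.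
    by rewrite mulmxnE !mxE h.
  by case: (i == j); rewrite ?mulr1n // !mulr0n mulmx0 mul0mx.
- right; split=> // i j.
  have LE' l : k%:R^-1%:M - L (E l) = hcmx V *m (k%:R^-1%:M - M l) *m V.
    by rewrite LE mulmxBr mulmxBl mul_mx_scalar -scalemxAl hV' scalemx1.
  rewrite !LE' !mulmxA -(mulmxA _ V) hV mulmx1 -(mulmxA _ (_ - M i)).
  have -> : (k%:R^-1%:M - M i) *m (k%:R^-1%:M - M j) = (k%:R^-1%:M - M i) *+ (i == j).
    have ME' l : k%:R^-1%:M - M l = diag_mx (\row_a (k%:R^-1 - g l a)).
      rewrite ME; apply/matrixP => a b; rewrite !mxE.
      by case: (a == b); rewrite ?mulr1n // !mulr0n subrr.
    rewrite !ME' mulmx_diag -raddfMn; congr diag_mx; apply/rowP => a.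
    by rewrite mulmxnE !mxE h.
  by case: (i == j); rewrite ?mulr1n // !mulr0n mulmx0 mul0mx.
Qed.

End Basis.

(** * Jordan homomorphisms fixing the diagonal matrix units *)

Section DeltaMx.
Variables (F : pzRingType) (n : nat).
Implicit Types (i j l m : 'I_n) (A : 'M[F]_n).

Lemma delta_mulmxE i j A a b : (delta_mx i j *m A) a b = A j b *+ (a == i).
Proof.
rewrite mxE (bigD1 j) //= big1 ?addr0 => [|l lj]; last by rewrite mxE (negPf lj) andbF mul0r.
by rewrite mxE eqxx andbT mulr_natl.
Qed.

Lemma mulmx_deltaE i j A a b : (A *m delta_mx i j) a b = A a i *+ (b == j).
Proof.
rewrite mxE (bigD1 i) //= big1 ?addr0 => [|l li]; last by rewrite mxE (negPf li) mulr0.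
by rewrite mxE eqxx /= mulr_natr.
Qed.

Lemma mul_delta i j l m : delta_mx i j *m delta_mx l m = delta_mx i m *+ (j == l) :> 'M[F]_n.
Proof.
by apply/matrixP => a b; rewrite delta_mulmxE mulmxnE !mxE; case: (a == i); case: (j == l);
  rewrite ?mulr0n ?mulr1n //= ?mul0rn.
Qed.

(** The hypothesis places [A] in the Peirce half-space of [delta_mx i i], where an entry survives
    only if exactly one of its indices is [i]. *)
Lemma peirce_entry i A a b : A = delta_mx i i *m A + A *m delta_mx i i ->
  A a b = A a b *+ (a == i) + A a b *+ (b == i).
Proof.
move=> e; rewrite {1}e mxE delta_mulmxE mulmx_deltaE.
by congr (_ + _); case: eqVneq => [->|].
Qed.

End DeltaMx.

Section JordanDiag.
Variables (C : numClosedFieldType) (n : nat).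
Implicit Types X Y : 'M[C]_n.

Record jordan_herm (M : 'M[C]_n -> 'M[C]_n) : Prop := JordanHerm {
  jh_herm : forall X, M (hcmx X) = hcmx (M X);
  jh_inj : injective M;
  jh_mul : forall X Y, M (X *m Y + Y *m X) = M X *m M Y + M Y *m M X }.

Variables (M : {linear 'M[C]_n -> 'M[C]_n}) (jM : jordan_herm M).
Hypothesis Mdiag : forall i, M (delta_mx i i) = delta_mx i i.

Let N i j := M (delta_mx i j).

(** [delta_mx i j] lies in the Peirce half-spaces of [delta_mx i i] and [delta_mx j j]; as [M] fixes
    these two, the image lies there too. *)
Lemma delta_image_support i j a b : i != j -> N i j a b != 0 ->
  (a == i) && (b == j) || (a == j) && (b == i).
Proof.
move=> ij Nab.
have ei : N i j = delta_mx i i *m N i j + N i j *m delta_mx i i.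
  have := jh_mul jM (delta_mx i i) (delta_mx i j).
  by rewrite !mul_delta eqxx eq_sym (negPf ij) mulr0n addr0 mulr1n Mdiag.
have ej : N i j = delta_mx j j *m N i j + N i j *m delta_mx j j.
  have := jh_mul jM (delta_mx j j) (delta_mx i j).
  by rewrite !mul_delta eqxx eq_sym (negPf ij) mulr0n add0r mulr1n Mdiag.
have := peirce_entry a b ei; have := peirce_entry a b ej.
have nz (x : C) : x = x + x -> x = 0.
  by move=> /(congr1 (fun z => z - x)); rewrite subrr addrK.
have [ai|ai] := eqVneq a i; have [bi|bi] := eqVneq b i; rewrite ?mulr1n ?mulr0n ?addr0 ?add0r.
- by move=> _ /nz e; rewrite e eqxx in Nab.
- rewrite ai (negPf ij) mulr0n add0r; case: (b == j) => //= e _.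
  by move: Nab; rewrite ai e mulr0n eqxx.
- rewrite bi (negPf ij) mulr0n addr0; case: (a == j) => //= e _.
  by move: Nab; rewrite bi e mulr0n eqxx.
- by move=> _ e; rewrite e eqxx in Nab.
Qed.

Lemma delta_image i j : i != j -> N i j = N i j i j *: delta_mx i j + N i j j i *: delta_mx j i.
Proof.
move=> ij; apply/matrixP => a b; rewrite !mxE.
have [/andP[/eqP-> /eqP->]|h1] := boolP ((a == i) && (b == j)).
  by rewrite (negPf ij) mulr1 mulr0 addr0.
have [/andP[/eqP-> /eqP->]|h2] := boolP ((a == j) && (b == i)).
  by rewrite mulr0 mulr1 add0r.
rewrite !mulr0 addr0; apply/eqP/negPn/negP => /(delta_image_support ij).
by rewrite (negPf h1) (negPf h2).
Qed.

Lemma delta_image_adj i j a b : N j i a b = Num.conj (N i j b a).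
Proof.
rewrite -hcmxE -jh_herm // /N; congr (M _ a b).
by apply/matrixP => l m; rewrite hcmxE !mxE rmorph_nat andbC.
Qed.

(** [delta_mx i j] squares to zero, hence so does its image; the product is the [(i, i)] entry of
    that square. *)
Lemma delta_image_prod0 i j : i != j -> N i j i j * N i j j i = 0.
Proof.
move=> ij; have := jh_mul jM (delta_mx i j) (delta_mx i j).
rewrite mul_delta eq_sym (negPf ij) mulr0n addr0 linear0 -/(N i j) => /esym e.
rewrite delta_image // !mulmxDl !mulmxDr -!scalemxAl -!scalemxAr !mul_delta in e.
rewrite !eqxx eq_sym (negPf ij) !mulr0n !mulr1n !scaler0 !addr0 !add0r in e.
move: e => /matrixP /(_ i i); rewrite !mxE !eqxx (negPf ij) !andbF !mulr0 !mulr1 !addr0.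
by move/eqP; rewrite -mulr2n mulrn_eq0 => /eqP.
Qed.

(* [M] maps [delta_mx i j] to a multiple of itself; otherwise to one of [delta_mx j i]. *)
Definition straight i j := N i j i j != 0.

Lemma straightP i j : i != j -> straight i j -> N i j = N i j i j *: delta_mx i j.
Proof.
move=> ij s; have /eqP := delta_image_prod0 ij; rewrite mulf_eq0 (negPf s) => /eqP e.
by rewrite {1}delta_image // e scale0r addr0.
Qed.

Lemma bentP i j : i != j -> ~~ straight i j -> N i j = N i j j i *: delta_mx j i.
Proof. by move=> ij /negPn/eqP s; rewrite {1}delta_image // s scale0r add0r. Qed.

Lemma delta_image_neq0 i j : N i j != 0.
Proof.
apply/eqP => e; have : delta_mx i j = 0 :> 'M[C]_n.
  by apply: (jh_inj jM); rewrite linear0.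
by move=> /matrixP /(_ i j); rewrite !mxE !eqxx => /eqP; rewrite oner_eq0.
Qed.

Lemma straight_sym i j : straight i j = straight j i.
Proof. by rewrite /straight (delta_image_adj i j) conjC_eq0. Qed.

Lemma delta_image_chain i j l : i != j -> j != l -> i != l ->
  N i l = N i j *m N j l + N j l *m N i j.
Proof.
move=> ij jl il; have := jh_mul jM (delta_mx i j) (delta_mx j l).
by rewrite !mul_delta eqxx [l == i]eq_sym (negPf il) mulr0n addr0 mulr1n.
Qed.

(** With one unit straight and the other bent, both products in [delta_image_chain] would vanish,
    although [delta_mx i l] has a nonzero image. *)
Lemma straight_chain i j l : i != j -> j != l -> i != l -> straight i j = straight j l.
Proof.
move=> ij jl il; have := delta_image_neq0 i l; rewrite (delta_image_chain ij jl il).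
have [s|s] := boolP (straight i j); have [s'|s'] := boolP (straight j l) => //.
  rewrite (straightP ij s) (bentP jl s') -!scalemxAl -!scalemxAr !mul_delta.
  by rewrite (negPf jl) [j == i]eq_sym (negPf ij) !mulr0n !scaler0 addr0 eqxx.
rewrite (bentP ij s) (straightP jl s') -!scalemxAl -!scalemxAr !mul_delta.
by rewrite (negPf ij) [l == j]eq_sym (negPf jl) !mulr0n !scaler0 addr0 eqxx.
Qed.

Lemma straight_const i j l m : i != j -> l != m -> straight i j = straight l m.
Proof.
move=> ij lm; have [li|li] := eqVneq l i.
  rewrite li in lm *; have [->//|mj] := eqVneq m j.
  by rewrite straight_sym; apply: straight_chain; rewrite // eq_sym.
have [lj|lj] := eqVneq l j.
  rewrite lj in lm *; have [->|mi] := eqVneq m i; first exact: straight_sym.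
  by apply: straight_chain => //; rewrite eq_sym.
rewrite (@straight_chain i j l) // 1?eq_sym //.
have [->|mj] := eqVneq m j; first exact: straight_sym.
by apply: straight_chain; rewrite // eq_sym.
Qed.

(** The coefficients form a unimodular cocycle: [u i j * u j l = u i l], with [u j i] conjugate to
    [u i j]. So [u i j] is [u i i0] times the conjugate of [u j i0], and the [u i i0] are the
    diagonal of [D]. *)
Lemma jordan_straight : (forall i j, i != j -> straight i j) ->
  exists2 D : 'M[C]_n, D *m hcmx D = 1%:M & forall X, M X = D *m X *m hcmx D.
Proof.
move=> st; case: (posnP n) => [n0|n0].
  exists 1%:M => [|X]; first by rewrite hcmx1 mulmx1.
  by apply/matrixP => -[i hi]; exfalso; move: hi; rewrite n0.
pose i0 := Ordinal n0; pose u i j := N i j i j.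
have NE i j : N i j = u i j *: delta_mx i j.
  have [<-|ij] := eqVneq i j; last exact/straightP/st.
  by rewrite /u /N Mdiag mxE !eqxx scale1r.
have uii i : u i i = 1 by rewrite /u /N Mdiag mxE !eqxx.
have umul i j l : u i j * u j l = u i l.
  have [<-|ij] := eqVneq i j; first by rewrite uii mul1r.
  have [<-|jl] := eqVneq j l; first by rewrite uii mulr1.
  have [<-|il] := eqVneq i l.
    have := jh_mul jM (delta_mx i j) (delta_mx j i).
    rewrite !mul_delta !eqxx !mulr1n linearD !Mdiag -/(N i j) -/(N j i) !NE.
    rewrite -!scalemxAl -!scalemxAr !mul_delta !eqxx !mulr1n.
    move=> /matrixP /(_ i i); rewrite !mxE !eqxx (negPf ij) /= !mulr0 !addr0 !mulr1.
    by rewrite uii.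
  have := delta_image_chain ij jl il; rewrite !NE -!scalemxAl -!scalemxAr !mul_delta !eqxx.
  rewrite [l == i]eq_sym (negPf il) mulr0n !scaler0 addr0 mulr1n scalerA.
  by move=> /matrixP /(_ i l); rewrite !mxE !eqxx !mulr1.
have uconj i j : Num.conj (u i j) = u j i by rewrite /u (delta_image_adj i j).
exists (diag_mx (\row_i u i i0)).
  apply/matrixP => a b; rewrite mul_diag_mx !mxE [a == b]eq_sym.
  have [->|ab] := eqVneq b a; first by rewrite !mulr1n uconj umul uii.
  by rewrite mulr0n conjC0 mulr0.
move=> X; have -> : M X = \sum_i \sum_j X i j *: N i j.
  rewrite {1}[X]matrix_sum_delta linear_sum; apply: eq_bigr => i _.
  by rewrite linear_sum; apply: eq_bigr => j _; rewrite linearZ.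
apply/matrixP => a b; rewrite summxE (bigD1 a) //= [X in _ + X]big1 => [|i ia]; last first.
  by rewrite summxE big1 // => j _; rewrite NE !mxE [a == i]eq_sym (negPf ia) !mulr0.
rewrite addr0 summxE (bigD1 b) //= [X in _ + X]big1 => [|j jb]; last first.
  by rewrite NE !mxE [b == j]eq_sym (negPf jb) andbF !mulr0.
rewrite addr0 NE !mxE !eqxx mulr1 (bigD1 b) //= big1 ?addr0 => [|j jb].
  by rewrite mul_diag_mx !mxE eqxx mulr1n uconj -(umul a i0 b); ring.
by rewrite !mxE [b == j]eq_sym (negPf jb) mulr0n conjC0 mulr0.
Qed.

End JordanDiag.

(** * Jordan *-homomorphisms and preservers of rank-[k] projections *)

Section Wigner.
Variables (C : numClosedFieldType) (n : nat).
Implicit Types (X Y : 'M[C]_n) (M : {linear 'M[C]_n -> 'M[C]_n}).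

Lemma jordan_diag M : jordan_herm M -> (forall i, M (delta_mx i i) = delta_mx i i) ->
  exists2 D : 'M[C]_n, D *m hcmx D = 1%:M &
    (forall X, M X = D *m X *m hcmx D) \/ (forall X, M X = D *m X^T *m hcmx D).
Proof.
move=> jM dM.
have [/'forall_'forall_implyP st|] := boolP [forall i, forall j, (i != j) ==> straight M i j].
  by have [D hD e] := jordan_straight jM dM st; exists D => //; left.
rewrite negb_forall => /existsP[i]; rewrite negb_forall => /existsP[j].
rewrite negb_imply => /andP[ij sij].
pose M' : {linear 'M[C]_n -> 'M[C]_n} := M \o trmx.
have jM' : jordan_herm M'.
  split=> [X|X Y /= /(jh_inj jM) /(can_inj trmxK) //|X Y] /=.
    by rewrite -(jh_herm jM); congr (M _); rewrite /hcmx map_trmx.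
  by rewrite linearD /= !trmx_mul addrC (jh_mul jM) addrC.
have dM' l : M' (delta_mx l l) = delta_mx l l by rewrite /= trmx_delta dM.
have [l m lm|D hD e] := jordan_straight jM' dM'.
  have ml : m != l by rewrite eq_sym.
  have sml : ~~ straight M m l by rewrite -(straight_const jM dM ij ml).
  rewrite /straight /= trmx_delta; apply: contraNneq (delta_image_neq0 jM m l) => z.
  by rewrite (bentP jM dM ml sml) z scale0r.
by exists D => //; right=> X; rewrite -e /= trmxK.
Qed.

Lemma mulmx_entry (p q r : nat) (A : 'M[C]_(p, q)) (B : 'M[C]_(q, r)) i j :
  (A *m B) i j = (row i A *m col j B) 0 0.
Proof. by rewrite !mxE; apply: eq_bigr => l _; rewrite !mxE. Qed.

(** The [p i] are [n] nonzero, pairwise orthogonal projections, so a unit vector from each range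
    gives an orthonormal basis. In that basis [M] fixes the diagonal units. *)
Lemma jordan_wigner M : jordan_herm M -> exists2 V : 'M[C]_n, V *m hcmx V = 1%:M &
  (forall X, M X = hcmx V *m X *m V) \/ (forall X, M X = hcmx V *m X^T *m V).
Proof.
move=> jM; pose p i := M (delta_mx i i).
have two (X Y : 'M[C]_n) : X + X = Y + Y -> X = Y.
  rewrite -!mulr2n -[X *+ 2]scaler_nat -[Y *+ 2]scaler_nat; apply: scalerI.
  by rewrite pnatr_eq0.
have hp i : hcmx (p i) = p i.
  by rewrite -(jh_herm jM); congr (M _); apply/matrixP => a b; rewrite hcmxE !mxE rmorph_nat andbC.
have pp i : p i *m p i = p i.
  apply: two; rewrite -(jh_mul jM) mul_delta eqxx mulr1n linearD //.
have pij i j : i != j -> p i *m p j = 0.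
  (* Multiplying [p_i p_j + p_j p_i = 0] by [p i] on either side expresses both products as minus
     [p_i p_j p_i]. They are thus equal as well as opposite. *)
  move=> ij; have e : p i *m p j + p j *m p i = 0.
    by rewrite -(jh_mul jM) !mul_delta [j == i]eq_sym (negPf ij) addr0 linear0.
  have e1 : p i *m p j + p i *m p j *m p i = 0.
    by rewrite -[RHS](mulmx0 _ (p i)) -e mulmxDr !mulmxA pp.
  have e2 : p i *m p j *m p i + p j *m p i = 0.
    by rewrite -[RHS](mul0mx _ (p i)) -e mulmxDl -!mulmxA pp.
  have e3 : p i *m p j = p j *m p i.
    by apply: (addrI (p i *m p j *m p i)); rewrite e2 addrC.
  by apply: two; rewrite {2}e3 e addr0.
have [x xP] : exists x : 'I_n -> 'cV[C]_n, forall i,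
    p i *m x i = x i /\ ctmx (x i) *m x i = 1%:M.
  apply: (@fin_all_exists _ (fun=> 'cV[C]_n) (fun i y => p i *m y = y /\ ctmx y *m y = 1%:M)).
  move=> i; have : p i != 0.
    apply/eqP => p0; have : delta_mx i i = 0 :> 'M[C]_n.
      by apply: (jh_inj jM); rewrite linear0.
    by move=> /matrixP /(_ i i); rewrite !mxE !eqxx => /eqP; rewrite oner_eq0.
  move=> p0; have [j pj] : exists j, p i *m delta_mx j 0 != 0 :> 'cV[C]_n.
    apply/existsP; rewrite -[X in is_true X]negbK negb_exists; apply/negP => /forallP h.
    case/eqP: p0; apply/matrixP => a j; have := h j; rewrite negbK -colE => /eqP.
    by move=> /matrixP /(_ a 0); rewrite !mxE.
  have [c c0 hc] := unit_column pj; exists (c *: (p i *m delta_mx j 0)); split=> //.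
  by rewrite -scalemxAr mulmxA pp.
have xx i j : ctmx (x i) *m x j = (i == j)%:R%:M.
  have [<-|ij] := eqVneq i j; first exact: (xP i).2.
  rewrite -(xP i).1 -(xP j).1 ctmx_mul hp mulmxA -(mulmxA _ (p i)) pij //.
  by rewrite mulmx0 mul0mx; apply/matrixP => a b; rewrite !mxE mul0rn.
pose W : 'M[C]_n := \matrix_i ctmx (x i).
have rW i : row i W = ctmx (x i) by rewrite rowK.
have cW j : col j (hcmx W) = x j.
  by apply/matrixP => a b; rewrite ord1 mxE hcmxE !mxE conjCK.
have hW : W *m hcmx W = 1%:M.
  apply/matrixP => i j; rewrite mulmx_entry rW cW xx !mxE.
  by case: (i == j).
have hW' := mulmx1C hW.
pose M' : {linear 'M[C]_n -> 'M[C]_n} := mulmxr (hcmx W) \o mulmx W \o M.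
have M'E X : M' X = W *m M X *m hcmx W by [].
have jM' : jordan_herm M'.
  split=> [X|X Y|X Y]; rewrite !M'E.
  - by rewrite (jh_herm jM) !hcmxM hcmxK mulmxA.
  - move=> /(congr1 (fun Z => hcmx W *m Z *m W)).
    by rewrite !mulmxA hW' !mul1mx -!mulmxA hW' !mulmx1 => /(jh_inj jM).
  - have e Y1 Y2 : (W *m Y1 *m hcmx W) *m (W *m Y2 *m hcmx W) = W *m (Y1 *m Y2) *m hcmx W.
      by rewrite !mulmxA -(mulmxA _ (hcmx W)) hW' mulmx1.
    by rewrite !e (jh_mul jM) mulmxDr mulmxDl.
have dM' i : M' (delta_mx i i) = delta_mx i i.
  rewrite M'E -/(p i); apply/matrixP => a b.
  rewrite mulmx_entry row_mul rW cW -mulmxA.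
  have [<-|ib] := eqVneq i b.
    by rewrite (xP i).1 xx !mxE !eqxx andbT mulr1n.
  have -> : p i *m x b = 0 by rewrite -(xP b).1 mulmxA pij // mul0mx.
  by rewrite mulmx0 !mxE [b == i]eq_sym (negPf ib) andbF.
have [D hD e] := jordan_diag jM' dM'.
have hD' := mulmx1C hD.
have MM' X : M X = hcmx W *m M' X *m W.
  by rewrite M'E !mulmxA hW' mul1mx -mulmxA hW' mulmx1.
exists (hcmx D *m W); first by rewrite hcmxM hcmxK mulmxA -(mulmxA _ W) hW mulmx1.
by case: e => e; [left|right] => X; rewrite MM' e hcmxM hcmxK !mulmxA.
Qed.

(** Polarisation gives the identity on hermitian pairs; both sides being complex bilinear, the
    decomposition [A + 'i *: B] extends it. *)
Lemma jordan_of_square M : (forall X, hcmx X = X -> M (X *m X) = M X *m M X) ->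
  forall X Y, M (X *m Y + Y *m X) = M X *m M Y + M Y *m M X.
Proof.
move=> sq.
have hh X Y : hcmx X = X -> hcmx Y = Y -> M (X *m Y + Y *m X) = M X *m M Y + M Y *m M X.
  move=> hX hY; have := sq (X + Y); rewrite hcmxD hX hY => /(_ erefl).
  have -> : (X + Y) *m (X + Y) = X *m X + (X *m Y + Y *m X) + Y *m Y.
    by rewrite mulmxDl !mulmxDr !addrA.
  have -> : M (X + Y) *m M (X + Y) = M X *m M X + (M X *m M Y + M Y *m M X) + M Y *m M Y.
    by rewrite linearD mulmxDl !mulmxDr !addrA.
  by rewrite 2!linearD !sq // => /addIr /addrI.
have split X : exists A B, [/\ hcmx A = A, hcmx B = B & X = A + 'i *: B].
  exists (2^-1 *: (X + hcmx X)), ((2 * 'i)^-1 *: (X - hcmx X)).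
  have c2 : Num.conj (2 : C) = 2 by rewrite rmorph_nat.
  have i0 : 'i != 0 :> C := neq0Ci C.
  have t0 : 2 != 0 :> C by rewrite pnatr_eq0.
  split.
  - by rewrite hcmxZ hcmxD hcmxK fmorphV /= c2 addrC.
  - rewrite hcmxZ hcmxB hcmxK fmorphV /= rmorphM /= c2 conjCi mulrN invrN scaleNr.
    by rewrite -scalerN opprB.
  - rewrite scalerA invfM mulrCA mulfV // mulr1 -scalerDr addrACA subrr addr0.
    by rewrite -mulr2n -scaler_nat scalerA mulVf // scale1r.
move=> X Y; have [A [B [hA hB ->]]] := split X; have [A' [B' [hA' hB' ->]]] := split Y.
have e1 := hh _ _ hA hA'; have e2 := hh _ _ hA hB'.
have e3 := hh _ _ hB hA'; have e4 := hh _ _ hB hB'.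
have -> : (A + 'i *: B) *m (A' + 'i *: B') + (A' + 'i *: B') *m (A + 'i *: B) =
    (A *m A' + A' *m A) + 'i *: (A *m B' + B' *m A) + 'i *: (B *m A' + A' *m B) +
    'i *: ('i *: (B *m B' + B' *m B)).
  rewrite !mulmxDl !mulmxDr -!scalemxAl -!scalemxAr !scalerDr.
  by apply/matrixP => a b; rewrite !mxE; ring.
have lin4 P1 P2 P3 P4 : M (P1 + 'i *: P2 + 'i *: P3 + 'i *: ('i *: P4)) =
    M P1 + 'i *: M P2 + 'i *: M P3 + 'i *: ('i *: M P4) by rewrite !linearD !linearZ.
have lin2 P1 P2 : M (P1 + 'i *: P2) = M P1 + 'i *: M P2 by rewrite linearD linearZ.
rewrite lin4 e1 e2 e3 e4 !lin2 !mulmxDl !mulmxDr -!scalemxAl -!scalemxAr !scalerDr.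
by apply/matrixP => a b; rewrite !mxE; ring.
Qed.

Definition square_defect M X := M (X *m X) - M X *m M X.

Lemma square_defect_line M X Y i j (t : C) :
  square_defect M (X + t *: Y) i j = square_defect M X i j +
    t * (M (X *m Y + Y *m X) - (M X *m M Y + M Y *m M X)) i j +
    t ^+ 2 * square_defect M Y i j.
Proof.
have lin P1 P2 P3 : M (P1 + t *: P2 + t ^+ 2 *: P3) = M P1 + t *: M P2 + t ^+ 2 *: M P3.
  by rewrite !linearD !linearZ.
have lin2 P1 P2 : M (P1 + t *: P2) = M P1 + t *: M P2 by rewrite linearD linearZ.
have sq (P1 P2 : 'M[C]_n) : (P1 + t *: P2) *m (P1 + t *: P2) =
    P1 *m P1 + t *: (P1 *m P2 + P2 *m P1) + t ^+ 2 *: (P2 *m P2).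
  rewrite mulmxDl !mulmxDr -!scalemxAl -!scalemxAr scalerDr scalerA -expr2.
  by rewrite !addrA.
rewrite /square_defect lin2 !sq lin.
move: (M (X *m X)) (M (X *m Y + Y *m X)) (M (Y *m Y)) => A1 A2 A3.
move: (M X *m M X) (M X *m M Y + M Y *m M X) (M Y *m M Y) => B1 B2 B3.
by rewrite !mxE; ring.
Qed.

(* A real quadratic map cannot vanish on a real vector space only where another one
   does not: restricted to a line, each has at most two zeros. *)
Lemma square_alternative M1 M2 :
  (forall X, hcmx X = X -> square_defect M1 X = 0 \/ square_defect M2 X = 0) ->
  (forall X, hcmx X = X -> square_defect M1 X = 0) \/
  (forall X, hcmx X = X -> square_defect M2 X = 0).
Proof.
move=> alt; have [|n1] := pselect (forall X, hcmx X = X -> square_defect M1 X = 0); first by left.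
have [|n2] := pselect (forall X, hcmx X = X -> square_defect M2 X = 0); first by right.
exfalso.
move/existsNP: n1 => [X /not_implyP[hX /eqP]].
rewrite -subr_eq0 subr0 => X0; move/existsNP: n2 => [Y /not_implyP[hY /eqP Y0]].
have ent (A : 'M[C]_n) : A != 0 -> exists i j, A i j != 0.
  move=> A0; have [i hi] : exists i, [exists j, A i j != 0].
    apply/existsP; apply: contraNT A0; rewrite negb_exists => /forallP h.
    apply/eqP/matrixP => a b; have := h a; rewrite negb_exists => /forallP /(_ b).
    by rewrite negbK mxE => /eqP.
  by have /existsP[j hj] := hi; exists i, j.
have [i [j Xij]] := ent _ X0; have [a [b Yab]] := ent _ Y0.
pose q M i j : {poly C} := Poly [:: square_defect M X i j;
  (M (X *m Y + Y *m X) - (M X *m M Y + M Y *m M X)) i j; square_defect M Y i j].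
have qE (M : {linear 'M[C]_n -> 'M[C]_n}) l m t :
    (q M l m).[t] = square_defect M (X + t *: Y) l m.
  by rewrite square_defect_line /q horner_Poly /=; ring.
have q1 : q M1 i j != 0.
  apply: contraNneq Xij => e; have := qE M1 i j 0.
  by rewrite e horner0 scale0r addr0 => <-.
have q2 : q M2 a b != 0.
  apply: contraNneq Yab => e; have : (q M2 a b)`_2 = 0 by rewrite e coef0.
  by rewrite coef_Poly /= => ->.
(* Five points against at most four roots of the product; being real, they keep [X + t Y]
   hermitian. *)
pose rs := [seq (m%:R : C) | m <- iota 0 5].
have urs : uniq rs.
  by rewrite map_inj_uniq ?iota_uniq // => x y /eqP; rewrite eqr_nat => /eqP.
have ars : all (root (q M1 i j * q M2 a b)) rs.
  apply/allP => t /mapP[m _ ->]; rewrite rootM /root !qE.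
  have hZ : hcmx (X + m%:R *: Y) = X + m%:R *: Y.
    by rewrite hcmxD hcmxZ rmorph_nat hX hY.
  by case: (alt _ hZ) => e; apply/orP; [left|right]; rewrite e mxE.
have := max_poly_roots (mulf_neq0 q1 q2) ars urs.
rewrite size_map size_iota size_mul // => lt.
have s1 : (size (q M1 i j) <= 3)%N by exact: size_Poly.
have s2 : (size (q M2 a b) <= 3)%N by exact: size_Poly.
move: lt s1 s2; move: (size (q M1 i j)) (size (q M2 a b)) => u v; clear; lia.
Qed.

Lemma tr_delta1 (i : 'I_n) : \tr (delta_mx i i : 'M[C]_n) = 1.
Proof. by rewrite -[delta_mx i i]mul1mx mxtrace_delta mxE eqxx. Qed.

Lemma sum_idem (A : 'I_n -> 'M[C]_n) (d : 'I_n -> C) :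
  (forall i j, A i *m A j = A i *+ (i == j)) ->
  (\sum_i d i *: A i) *m (\sum_i d i *: A i) = \sum_i d i ^+ 2 *: A i.
Proof.
move=> AA; rewrite mulmx_suml; apply: eq_bigr => i _.
rewrite mulmx_sumr (bigD1 i) //= big1 ?addr0 => [|j ji].
  by rewrite -scalemxAl -scalemxAr AA eqxx mulr1n scalerA.
by rewrite -scalemxAl -scalemxAr AA eq_sym (negPf ji) !scaler0.
Qed.

Section Structure.
Variables (k : nat) (L : {linear 'M[C]_n -> 'M[C]_n}).
Hypothesis kn : (0 < k < n)%N.
Hypothesis Lproj : forall P, kproj k P -> kproj k (L P).
Hypothesis Linj : injective L.
Hypothesis Lherm : forall X, L (hcmx X) = hcmx (L X).
Hypothesis Lcomm : forall P Q, kproj k P -> kproj k Q -> comm_mx P Q -> comm_mx (L P) (L Q).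

(** On rank-[k] projections this is [1 - L P], again of rank [k] when [n = 2k]; the trace makes it
    linear. *)
Definition trace_flip X : 'M[C]_n := (k%:R^-1 * \tr X)%:M - L X.

Lemma trace_flip_is_linear : linear trace_flip.
Proof.
move=> a X Y; rewrite /trace_flip (linearP L) mxtraceD mxtraceZ; apply/matrixP => i j.
by rewrite !mxE; case: (i == j); rewrite ?mulr1n ?mulr0n; ring.
Qed.

HB.instance Definition _ := GRing.isLinear.Build C 'M[C]_n 'M[C]_n _ trace_flip trace_flip_is_linear.

(** In an eigenbasis of [X], squaring acts on the eigenvalues, and a map sending the spectral
    projections to orthogonal idempotents respects it. *)
Lemma square_dichotomy X : hcmx X = X -> square_defect L X = 0 \/
  [/\ n = (2 * k)%N, (2 < n)%N & square_defect trace_flip X = 0].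
Proof.
move=> hX; have [U [d [hU eX]]] := herm_spectral hX.
pose E i := hcmx U *m delta_mx i i *m U.
have EE i j : E i *m E j = E i *+ (i == j).
  rewrite /E !mulmxA -(mulmxA _ U) hU mulmx1 -(mulmxA _ (delta_mx i i)) mul_delta.
  by case: eqVneq => [->|_]; rewrite ?mulr1n // !mulr0n mulmx0 mul0mx.
have XX : X *m X = \sum_i d i ^+ 2 *: E i by rewrite eX sum_idem.
have img (M : {linear 'M[C]_n -> 'M[C]_n}) :
    (forall i j, M (E i) *m M (E j) = M (E i) *+ (i == j)) -> square_defect M X = 0.
  move=> ME; have lin c : M (\sum_i c i *: E i) = \sum_i c i *: M (E i).
    by rewrite linear_sum; apply: eq_bigr => i _; rewrite linearZ.
  by rewrite /square_defect XX eX !lin sum_idem // subrr.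
have [h|[e1 e2 h]] := basis_dichotomy kn Lproj Linj Lcomm hU; first by left; exact: img.
right; split=> //; apply: img => i j.
have fE l : trace_flip (E l) = k%:R^-1%:M - L (E l).
  by rewrite /trace_flip mxtrace_mulC mulmxA hU mul1mx tr_delta1 mulr1.
by rewrite /= !fE h.
Qed.

Lemma dual_trace X : \tr (L X) = \tr X.
Proof.
apply/eqP; rewrite -subr_eq0; apply/eqP.
apply: (@linear_form_eq0 C n k (fun X => \tr (L X) - \tr X) kn).
  by move=> a Y Z; rewrite (linearP L) !mxtraceD !mxtraceZ; ring.
by move=> P hP; rewrite hP.2.2 (Lproj hP).2.2 subrr.
Qed.

Lemma projection_preserver : exists2 V : 'M[C]_n, V *m hcmx V = 1%:M &
  (forall X, L X = hcmx V *m X *m V) \/ (forall X, L X = hcmx V *m X^T *m V) \/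
  [/\ n = (2 * k)%N, (2 < n)%N &
    (forall X, L X = (k%:R^-1 * \tr X)%:M - hcmx V *m X *m V) \/
    (forall X, L X = (k%:R^-1 * \tr X)%:M - hcmx V *m X^T *m V)].
Proof.
have sqE (M : {linear 'M[C]_n -> 'M[C]_n}) X : square_defect M X = 0 -> M (X *m X) = M X *m M X.
  by move=> /eqP; rewrite subr_eq0 => /eqP.
have [sL|/existsNP[X0 /not_implyP[hX0 X0L]]] :=
    pselect (forall X, hcmx X = X -> square_defect L X = 0).
  have jL : jordan_herm L.
    by split=> //; apply: jordan_of_square => X hX; apply: sqE; exact: sL.
  have [V hV e] := jordan_wigner jL; exists V => //; case: e; by [left|right; left].
(* The failure of [L] at [X0] yields [n = 2k] and leaves [trace_flip] as the map that preserves all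
   squares. *)
have [//|[e1 e2 _]] := square_dichotomy hX0.
have k0 : (k%:R : C) != 0 by rewrite pnatr_eq0 -lt0n (andP kn).1.
have [|sF] : (forall X, hcmx X = X -> square_defect L X = 0) \/
    (forall X, hcmx X = X -> square_defect trace_flip X = 0).
- by apply: square_alternative => X /square_dichotomy[?|[_ _ ?]]; [left|right].
- by move=> sL; case: X0L; exact: sL.
have jF : jordan_herm trace_flip.
  split.
  - have kr : Num.conj (k%:R^-1 : C) = k%:R^-1 by rewrite fmorphV rmorph_nat.
    move=> X; rewrite /trace_flip hcmxB hcmx_scalar Lherm mxtrace_hc.
    have -> : Num.conj (k%:R^-1 * \tr X) = k%:R^-1 * Num.conj (\tr X).
      by rewrite rmorphM; congr (_ * _).
    by [].
  (* If [trace_flip X = 0], then [L X] is the scalar [tr X / k]. As [L] preserves the trace and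
     [n / k = 2], this gives [tr X = 2 tr X]. *)
  - have finj X : trace_flip X = 0 -> X = 0.
      move=> /eqP; rewrite subr_eq0 => /eqP e; have tX : \tr X = 0.
        have nE : n%:R = 2 * k%:R :> C by rewrite [in LHS]e1 natrM.
        have := dual_trace X; rewrite -e mxtrace_scalar -[_ *+ n]mulr_natl nE mulrA mulfK //.
        by rewrite mulr_natl mulr2n => /eqP; rewrite -subr_eq0 addrK => /eqP.
      apply: Linj; rewrite linear0 -e tX mulr0; exact: raddf0.
    by move=> X Y e; apply/eqP; rewrite -subr_eq0; apply/eqP/finj; rewrite linearB /= e subrr.
  - by apply: jordan_of_square => X hX; apply: sqE; exact: sF.
have [V hV e] := jordan_wigner jF; exists V => //; right; right; split=> //.
have LF X : L X = (k%:R^-1 * \tr X)%:M - trace_flip X by rewrite /trace_flip opprB addrC subrK.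
by case: e => e; [left|right] => X; rewrite LF /= e.
Qed.

End Structure.
End Wigner.

From mathcomp Require Import complex reals.
From mathcomp Require classical_sets topology normedtype derive.
Local Open Scope complex_scope.

(** * Complex scalars, compactness and attainment of the radius *)

Section Scalars.
Variable R : realType.
Local Notation C := R[i].
Implicit Types (a b z w : C).

(** The squared modulus as a real polynomial in the coordinates, so that comparisons of moduli
    become polynomial inequalities. *)
Definition cnorm2 z : R := complex.Re z ^+ 2 + complex.Im z ^+ 2.

Lemma cReD z w : complex.Re (z + w) = complex.Re z + complex.Re w.
Proof. by case: z w => ? ? []. Qed.
Lemma cImD z w : complex.Im (z + w) = complex.Im z + complex.Im w.
Proof. by case: z w => ? ? []. Qed.
Lemma cReN z : complex.Re (- z) = - complex.Re z.
Proof. by case: z. Qed.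
Lemma cImN z : complex.Im (- z) = - complex.Im z.
Proof. by case: z. Qed.
Lemma cReM z w :
  complex.Re (z * w) = complex.Re z * complex.Re w - complex.Im z * complex.Im w.
Proof. by case: z w => ? ? []. Qed.
Lemma cImM z w :
  complex.Im (z * w) = complex.Re z * complex.Im w + complex.Im z * complex.Re w.
Proof. by case: z w => ? ? []. Qed.
Lemma cRe_conj z : complex.Re (Num.conj z) = complex.Re z.
Proof. by case: z. Qed.
Lemma cIm_conj z : complex.Im (Num.conj z) = - complex.Im z.
Proof. by case: z. Qed.

Definition cReIm := (cReD, cImD, cReN, cImN, cReM, cImM, cRe_conj, cIm_conj).

Lemma complexP z w :
  complex.Re z = complex.Re w -> complex.Im z = complex.Im w -> z = w.
Proof. by case: z w => ? ? [? ?] /= -> ->. Qed.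

Lemma cnorm2_ge0 z : 0 <= cnorm2 z.
Proof. by rewrite addr_ge0 ?sqr_ge0. Qed.

Lemma cnorm2M z w : cnorm2 (z * w) = cnorm2 z * cnorm2 w.
Proof. by rewrite /cnorm2 !cReIm; ring. Qed.

Lemma cnorm2E z : (cnorm2 z)%:C = z * Num.conj z.
Proof. by apply: complexP; rewrite !cReIm /cnorm2 /=; ring. Qed.

Lemma cnorm2_eq0 z : (cnorm2 z == 0) = (z == 0).
Proof.
apply/eqP/eqP => [z0|->]; last by rewrite /cnorm2 /= expr0n addr0.
have /eqP : z * Num.conj z = 0 by rewrite -cnorm2E z0.
by rewrite mulf_eq0 conjC_eq0 orbb => /eqP.
Qed.

Lemma normc_sqrt z : ComplexField.Normc.normc z = Num.sqrt (cnorm2 z).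
Proof. by case: z. Qed.

Lemma le_normc z w :
  (ComplexField.Normc.normc z <= ComplexField.Normc.normc w) = (cnorm2 z <= cnorm2 w).
Proof. by rewrite !normc_sqrt ler_psqrt // nnegrE cnorm2_ge0. Qed.

Lemma normc_eq1 z : `|z| = 1 -> ComplexField.Normc.normc z = 1.
Proof. by case. Qed.

End Scalars.

Section Maximiser.
Import classical_sets topology normedtype derive numFieldNormedType.Exports.
Local Open Scope classical_set_scope.
Variables (R : realType) (n k : nat).
Local Notation C := R[i].
Implicit Types A B P : 'M[C]_n.

Lemma trmul_adj A : \tr (A *m hcmx A) = (\sum_i \sum_j cnorm2 (A i j))%:C.
Proof.
rewrite /mxtrace rmorph_sum; apply: eq_bigr => i _; rewrite mxE rmorph_sum.
by apply: eq_bigr => j _; rewrite hcmxE -cnorm2E.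
Qed.

Lemma proj_entry_le P i j : kproj k P -> cnorm2 (P i j) <= k%:R.
Proof.
case=> hP [iP tP].
have: (\sum_i \sum_j cnorm2 (P i j))%:C = (k%:R : R)%:C.
  by rewrite -trmul_adj hP iP tP rmorph_nat.
move=> /(congr1 (@complex.Re R)) /= <-.
rewrite (bigD1 i) //= (bigD1 j) //= -addrA lerDl addr_ge0 // sumr_ge0 // => *.
  exact: cnorm2_ge0.
by rewrite sumr_ge0 // => *; exact: cnorm2_ge0.
Qed.

(* Real coordinates of a complex matrix, so that the Heine-Borel theorem for
   real row vectors applies. *)
Definition mx_of_rv (v : 'rV[R]_(n * n + n * n)) : 'M[C]_n :=
  \matrix_(i, j) (v 0 (lshift _ (mxvec_index i j)) +i* v 0 (rshift _ (mxvec_index i j))).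

Lemma mx_of_rv_surj A : exists v, mx_of_rv v = A.
Proof.
exists (row_mx (mxvec (map_mx (@complex.Re R) A)) (mxvec (map_mx (@complex.Im R) A))).
apply/matrixP => i j; rewrite mxE.
by rewrite row_mxEl row_mxEr !mxvecE !mxE; case: (A i j).
Qed.

Definition ccont (f : 'rV[R]_(n * n + n * n) -> C) :=
  continuous (fun v => complex.Re (f v)) /\ continuous (fun v => complex.Im (f v)).

Lemma ccont_cst c : ccont (fun=> c).
Proof. by split=> v; exact: cst_continuous. Qed.

Lemma ccontD f g : ccont f -> ccont g -> ccont (fun v => f v + g v).
Proof.
move=> [f1 f2] [g1 g2]; split.
  rewrite (_ : (fun _ => _) = (fun v => complex.Re (f v) + complex.Re (g v))).
    by move=> v; exact: (cvgD (f1 v) (g1 v)).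
  by apply/funext => v; rewrite cReD.
rewrite (_ : (fun _ => _) = (fun v => complex.Im (f v) + complex.Im (g v))).
  by move=> v; exact: (cvgD (f2 v) (g2 v)).
by apply/funext => v; rewrite cImD.
Qed.

Lemma ccontM f g : ccont f -> ccont g -> ccont (fun v => f v * g v).
Proof.
move=> [f1 f2] [g1 g2]; split.
  rewrite (_ : (fun _ => _) = (fun v => complex.Re (f v) * complex.Re (g v) -
                                        complex.Im (f v) * complex.Im (g v))).
    by move=> v; exact: (cvgB (cvgM (f1 v) (g1 v)) (cvgM (f2 v) (g2 v))).
  by apply/funext => v; rewrite cReM.
rewrite (_ : (fun _ => _) = (fun v => complex.Re (f v) * complex.Im (g v) +
                                      complex.Im (f v) * complex.Re (g v))).
  by move=> v; exact: (cvgD (cvgM (f1 v) (g2 v)) (cvgM (f2 v) (g1 v))).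
by apply/funext => v; rewrite cImM.
Qed.

Lemma ccont_conj f : ccont f -> ccont (fun v => Num.conj (f v)).
Proof.
move=> [f1 f2]; split.
  by rewrite (_ : (fun _ => _) = (fun v => complex.Re (f v))) //;
    apply/funext => v; rewrite cRe_conj.
rewrite (_ : (fun _ => _) = (fun v => - complex.Im (f v))).
  by move=> v; exact: (cvgN (f2 v)).
by apply/funext => v; rewrite cIm_conj.
Qed.

Lemma ccont_sum (I : Type) (r : seq I) (F : I -> _ -> C) :
  (forall i, ccont (F i)) -> ccont (fun v => \sum_(i <- r) F i v).
Proof.
move=> cF; elim: r => [|i r IH].
  by under eq_fun do rewrite big_nil; exact: ccont_cst.
under eq_fun do rewrite big_cons.
by apply: ccontD.
Qed.

Lemma ccont_entry i j : ccont (fun v => mx_of_rv v i j).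
Proof.
split.
  rewrite (_ : (fun _ => _) = (fun v : 'rV[R]_(n * n + n * n) => v 0 (lshift _ (mxvec_index i j)))).
    exact: coord_continuous.
  by apply/funext => v; rewrite mxE.
rewrite (_ : (fun _ => _) = (fun v : 'rV[R]_(n * n + n * n) => v 0 (rshift _ (mxvec_index i j)))).
  exact: coord_continuous.
by apply/funext => v; rewrite mxE.
Qed.

Lemma ccont_closed f c : ccont f -> closed [set v | f v = c].
Proof.
move=> [f1 f2].
have -> : [set v | f v = c] = ((fun v => complex.Re (f v)) @^-1` [set complex.Re c])
    `&` ((fun v => complex.Im (f v)) @^-1` [set complex.Im c]).
  apply/seteqP; split => [v <-//|v [/= e1 e2]]; exact: complexP.
apply: closedI; apply: preimage_closed; try exact: closed_eq.
  by move=> ? _; exact: f1.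
by move=> ? _; exact: f2.
Qed.

Lemma closed_mx_eq (F G : 'rV[R]_(n * n + n * n) -> 'M[C]_n) :
  (forall i j, ccont (fun v => F v i j)) -> (forall i j, ccont (fun v => G v i j)) ->
  closed [set v | F v = G v].
Proof.
move=> cF cG.
have -> : [set v | F v = G v] =
    \bigcap_(ij in [set: 'I_n * 'I_n]) [set v | F v ij.1 ij.2 + -1 * G v ij.1 ij.2 = 0].
  apply/seteqP; split => v /= => [FG [i j] _ /=|FG]; first by rewrite FG mulN1r subrr.
  apply/matrixP => i j; apply/eqP; rewrite -subr_eq0 -mulN1r.
  exact/eqP/(FG (i, j)).
apply: closed_bigI => -[i j] _ /=; apply: ccont_closed; apply: ccontD => //.
by apply: ccontM => //; exact: ccont_cst.
Qed.

(** The defining equations are closed conditions, and the squared Frobenius norm, equal to [k],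
    bounds every entry. *)
Lemma compact_proj : compact [set v | kproj k (mx_of_rv v)].
Proof.
apply: bounded_closed_compact; last first.
  have -> : [set v | kproj k (mx_of_rv v)] =
    [set v | hcmx (mx_of_rv v) = mx_of_rv v] `&`
    ([set v | mx_of_rv v *m mx_of_rv v = mx_of_rv v] `&`
     [set v | \tr (mx_of_rv v) = k%:R]) by [].
  apply: closedI; [|apply: closedI].
  - apply: closed_mx_eq => i j; last exact: ccont_entry.
    under eq_fun do rewrite hcmxE.
    exact/ccont_conj/ccont_entry.
  - apply: closed_mx_eq => i j; last exact: ccont_entry.
    under eq_fun do rewrite mxE.
    by apply: ccont_sum => l; apply: ccontM; exact: ccont_entry.
  - apply: ccont_closed; apply: ccont_sum => i; exact: ccont_entry.
exists (k%:R + 1); split; first exact: num_real.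
move=> x kx v /= Pv; apply: le_trans (ltW kx).
rewrite /Num.norm /= mx_normrE; apply: bigmax_le => [|[i j] _ /=].
  by rewrite addr_ge0.
rewrite (ord1 i) {i}.
have sq (a : R) : a ^+ 2 <= k%:R -> `|a| <= k%:R + 1.
  move=> ak; rewrite ler_norml; have := ler0n R k; nra.
apply: sq; case: (split_ordP j) => l ->; case/mxvec_indexP: l => a b;
  have := proj_entry_le a b Pv; rewrite /cnorm2 /mx_of_rv mxE /= => h; nra.
Qed.

End Maximiser.

Lemma aligning_phase (R : realType) (a b : R[i]) : exists mu : R[i], `|mu| = 1 /\
  ComplexField.Normc.normc (a + mu * b) =
  ComplexField.Normc.normc a + ComplexField.Normc.normc b.
Proof.
have suffC mu : `|a + mu * b| = `|a| + `|b| ->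
  ComplexField.Normc.normc (a + mu * b) =
  ComplexField.Normc.normc a + ComplexField.Normc.normc b.
  by move=> e; apply: (@complexI R); rewrite rmorphD; exact: e.
have [a0|a0] := eqVneq a 0.
  by exists 1; rewrite normr1; split=> //; apply: suffC; rewrite a0 mul1r normr0 !add0r.
have [b0|b0] := eqVneq b 0.
  by exists 1; rewrite normr1; split=> //; apply: suffC; rewrite b0 mulr0 normr0 !addr0.
exists ((a / `|a|) * (`|b| / b)); split.
  by rewrite !normrM !normfV !normr_id !mulfV ?normr_eq0 // mulr1.
apply: suffC; rewrite -mulrA mulfVK //.
have -> : a + a / `|a| * `|b| = a / `|a| * (`|a| + `|b|).
  by rewrite mulrDr mulfVK // normr_eq0.
rewrite normrM [X in _ * X]ger0_norm ?addr_ge0 // normrM normfV normr_id mulfV ?mul1r //.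
by rewrite normr_eq0.
Qed.

Section KRadius.
Import classical_sets topology normedtype derive numFieldNormedType.Exports.
Variables (R : realType) (n k : nat).
Local Notation C := R[i].
Local Notation normc := ComplexField.Normc.normc.
Implicit Types A B P Q : 'M[C]_n.

(* [w_k(A)] is attained at [P]. *)
Definition kmax A P := kproj k P /\
  forall Q, kproj k Q -> cnorm2 (\tr (A *m Q)) <= cnorm2 (\tr (A *m P)).

Hypothesis lekn : (k <= n)%N.

Lemma kmax_exists A : exists P, kmax A P.
Proof.
have [P0 hP0] := proj_exists C lekn.
have [v0 ev0] := mx_of_rv_surj P0.
pose f v := cnorm2 (\tr (A *m mx_of_rv v)).
have cf : continuous f.
  have cg : ccont (fun v => \tr (A *m mx_of_rv v) * Num.conj (\tr (A *m mx_of_rv v))).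
    have ct : ccont (fun v => \tr (A *m mx_of_rv v)).
      apply: ccont_sum => i; under eq_fun do rewrite mxE.
      by apply: ccont_sum => j; apply: ccontM; [exact: ccont_cst|exact: ccont_entry].
    exact: ccontM ct (ccont_conj ct).
  case: cg => cg _; rewrite (_ : f = (fun v => complex.Re (\tr (A *m mx_of_rv v) *
      Num.conj (\tr (A *m mx_of_rv v))))) //.
  by apply/funext => v; rewrite -cnorm2E.
have [|v] := @EVT_max_rV R _ f _ _ (@compact_proj R n k) (continuous_subspaceT cf).
  by exists v0 => /=; rewrite ev0.
rewrite inE /= => hv mv; exists (mx_of_rv v); split=> // Q hQ.
have [w ew] := mx_of_rv_surj Q.
by have := mv w; rewrite inE /= /f ew; exact.
Qed.

Lemma le_normc_kmax A P Q : kmax A P -> kproj k Q ->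
  normc (\tr (A *m Q)) <= normc (\tr (A *m P)).
Proof. by case=> _ h hQ; rewrite le_normc; exact: h. Qed.

Lemma knumradiusE A P : kmax A P -> knumradius k A = normc (\tr (A *m P)).
Proof.
move=> hP; rewrite /knumradius; apply/eqP; rewrite eq_le; apply/andP; split.
  apply: ge_sup => [|x [z [[Q [hQ ->]] ->]]]; last exact: le_normc_kmax.
  by exists (normc (\tr (A *m P))); exists (\tr (A *m P)); split=> //; exists P; case: hP.
apply: ub_le_sup; last by exists (\tr (A *m P)); split=> //; exists P; case: hP.
by exists (normc (\tr (A *m P))) => x [z [[Q [hQ ->]] ->]]; exact: le_normc_kmax.
Qed.

Lemma le_knumradius A P : kproj k P -> normc (\tr (A *m P)) <= knumradius k A.
Proof.
by have [Q hQ] := kmax_exists A; rewrite (knumradiusE hQ); exact: le_normc_kmax.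
Qed.

Lemma kmax_knumradius A P : kproj k P ->
  knumradius k A <= normc (\tr (A *m P)) -> kmax A P.
Proof.
move=> hP le; split=> // Q hQ; rewrite -le_normc; apply: le_trans le.
exact: le_knumradius.
Qed.

Lemma tr_lin A B (mu : C) P :
  \tr ((A + mu *: B) *m P) = \tr (A *m P) + mu * \tr (B *m P).
Proof. by rewrite mulmxDl -scalemxAl mxtraceD mxtraceZ. Qed.

(** At a maximiser of [A + mu B] the radius is at most [|tr(A P)| + |tr(B P)|], so equality makes
    both terms maximal. Conversely, aligning the phases of the two traces at [P] realises the sum of
    the radii. *)
Lemma kparallelP A B : kparallel k A B <-> exists P, kmax A P /\ kmax B P.
Proof.
split=> [[mu [mu1 e]]|[P [hA hB]]].
  have [P hP] := kmax_exists (A + mu *: B).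
  have pP := hP.1; exists P.
  have := le_normcD (\tr (A *m P)) (mu * \tr (B *m P)).
  rewrite -tr_lin -(knumradiusE hP) e ComplexField.Normc.normcM (normc_eq1 mu1) mul1r => le.
  have leA := le_knumradius A pP; have leB := le_knumradius B pP.
  by split; apply: kmax_knumradius => //; lra.
have [mu [mu1 e]] := aligning_phase (\tr (A *m P)) (\tr (B *m P)).
exists mu; split=> //.
rewrite (knumradiusE hA) (knumradiusE hB) -e -tr_lin; apply: knumradiusE; split.
  exact: hA.1.
move=> Q hQ; rewrite -le_normc !tr_lin e.
have := le_normc_kmax hA hQ; have := le_normc_kmax hB hQ.
have := le_normcD (\tr (A *m Q)) (mu * \tr (B *m Q)).
rewrite ComplexField.Normc.normcM (normc_eq1 mu1) mul1r; lra.
Qed.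

End KRadius.

(** * First-order optimality and explicit maximisers *)

Lemma first_order (R : realType) (a v d : R[i]) (m : R) :
  (forall t : R, 0 < t -> t <= 1 ->
     cnorm2 (a + t%:C * v + (t ^+ 2)%:C * d) <= cnorm2 a * (1 + t ^+ 2 * m) ^+ 2) ->
  complex.Re (Num.conj a * v) <= 0.
Proof.
case: a v d => [a1 a2] [v1 v2] [d1 d2] h.
rewrite !cReIm /=.
pose b := v1 ^+ 2 + v2 ^+ 2 + 2 * (a1 * d1 + a2 * d2).
pose c := 2 * (v1 * d1 + v2 * d2).
pose e := d1 ^+ 2 + d2 ^+ 2.
pose f := 2 * m * (a1 ^+ 2 + a2 ^+ 2).
pose g := m ^+ 2 * (a1 ^+ 2 + a2 ^+ 2).
apply: (@le0_of_small _ _ ((`|b| + `|c| + `|e| + `|f| + `|g|) / 2)) => t t0 t1.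
have := h t t0 t1; rewrite /cnorm2 !cReIm /= => ht.
have bound (x : R) (r : R) : 0 <= r -> r <= 1 -> - `|x| <= r * x /\ r * x <= `|x|.
  move=> r0 r1; have := ler_norm x; have := ler_norm (- x); rewrite normrN; nra.
have tt1 : t ^+ 2 <= 1 by rewrite expr_le1 // ltW.
have tt0 : 0 <= t ^+ 2 by rewrite sqr_ge0.
have [b1 _] := bound b 1 ler01 (lexx _).
have [c1 _] := bound c t (ltW t0) t1.
have [e1 _] := bound e _ tt0 tt1.
have [_ f1] := bound f 1 ler01 (lexx _).
have [_ g1] := bound g _ tt0 tt1.
have {ht} : 2 * t * (a1 * v1 + a2 * v2) + t ^+ 2 * (b + t * c + t ^+ 2 * e) <=
   t ^+ 2 * (f + t ^+ 2 * g) by rewrite /b /c /e /f /g; lra.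
have : t ^+ 2 * (f + t ^+ 2 * g) <= t ^+ 2 * (`|f| + `|g|).
  by apply: ler_wpM2l => //; lra.
have : t ^+ 2 * (- `|b| - `|c| - `|e|) <= t ^+ 2 * (b + t * c + t ^+ 2 * e).
  by apply: ler_wpM2l => //; lra.
lra.
Qed.

Section Critical.
Variables (R : realType) (n k : nat).
Local Notation C := R[i].
Implicit Types A B P Q : 'M[C]_n.

Lemma cnorm2_real (t : R) (z : C) : cnorm2 (t%:C * z) = t ^+ 2 * cnorm2 z.
Proof. by rewrite cnorm2M /cnorm2 /=; ring. Qed.

(* First-order condition for [|tr(AX)|] along the curves of [proj_curve] through [P]. *)
Lemma kmax_comm A P : kmax k A P ->
  P *m (Num.conj (\tr (A *m P)) *: A + \tr (A *m P) *: hcmx A) =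
  (Num.conj (\tr (A *m P)) *: A + \tr (A *m P) *: hcmx A) *m P.
Proof.
case=> hP hm; set a := \tr (A *m P).
apply: (comm_of_offdiag hP) => [|x y Px Py xx yy].
  by rewrite hcmxD !hcmxZ conjCK hcmxK addrC.
pose be := \tr (A *m (y *m ctmx x)); pose ga := \tr (A *m (x *m ctmx y)).
have tA : \tr (hcmx A *m (x *m ctmx y)) = Num.conj be.
  by rewrite /be -mxtrace_hc hcmxM hcmx_outer mxtrace_mulC.
rewrite mulmxDl -!scalemxAl mxtraceD !mxtraceZ tA -/ga.
set ka := _ + _.
(* The curve is followed in the direction [ka], which makes the first-order term exactly [|ka|^2];
   optimality bounds it by zero. *)
have eka : cnorm2 ka = complex.Re (Num.conj a * (ka * be + Num.conj ka * ga)).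
  rewrite {tA} /ka; move: a be ga hm => [a1 a2] [b1 b2] [c1 c2] _.
  by rewrite /cnorm2 !cReIm /=; ring.
move: ka eka => ka eka; apply/eqP; rewrite -cnorm2_eq0 eq_le cnorm2_ge0 andbT.
pose d := (cnorm2 ka)%:C * (a - \tr (A *m (x *m ctmx x)) + \tr (A *m (y *m ctmx y))).
rewrite [X in X <= _]eka.
apply: (@first_order _ _ _ d (cnorm2 ka)) => t _ _.
have [Q hQ /(_ A) eQ] := @proj_curve _ n k P x y (t%:C * ka) hP Px Py xx yy.
have e1 : t%:C * ka * Num.conj (t%:C * ka) = (t ^+ 2)%:C * (cnorm2 ka)%:C.
  by rewrite -cnorm2E cnorm2_real; apply: complexP; rewrite !cReIm /=; ring.
have e2 : Num.conj (t%:C * ka) = t%:C * Num.conj ka.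
  by apply: complexP; rewrite !cReIm /=; ring.
have e3 : (1 + t ^+ 2 * cnorm2 ka)%:C = 1 + (t ^+ 2)%:C * (cnorm2 ka)%:C.
  by apply: complexP; rewrite !cReIm /=; ring.
have {}eQ : (1 + t%:C * ka * Num.conj (t%:C * ka)) * \tr (A *m Q) =
    a + t%:C * ka * be + Num.conj (t%:C * ka) * ga +
    t%:C * ka * Num.conj (t%:C * ka) *
      (a - \tr (A *m (x *m ctmx x)) + \tr (A *m (y *m ctmx y))) := eQ.
rewrite {}e1 {}e2 in eQ.
have le : cnorm2 (\tr (A *m Q)) <= cnorm2 a := hm Q hQ.
have -> : a + t%:C * (ka * be + Num.conj ka * ga) + (t ^+ 2)%:C * d =
   (1 + t ^+ 2 * cnorm2 ka)%:C * \tr (A *m Q).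
  by rewrite e3 eQ /d; ring.
rewrite cnorm2_real mulrC ler_wpM2r // sqr_ge0 //.
Qed.

End Critical.

Section Maximisers.
Variables (R : realType) (n k : nat).
Local Notation C := R[i].
Implicit Types A B G P Q : 'M[C]_n.

Lemma conj_real (z : C) : Num.conj z = z -> exists r : R, z = r%:C.
Proof. by case: z => a b [e]; exists a; apply: complexP => //=; lra. Qed.

Lemma trproj_real P Q : kproj k P -> kproj k Q ->
  exists r : R, [/\ \tr (P *m Q) = r%:C, 0 <= r, r <= k%:R & (r = k%:R -> Q = P)].
Proof.
move=> hP hQ; have [r er] := conj_real (trmul_real hP.1 hQ.1).
have ek : (k%:R : C) = (k%:R : R)%:C by rewrite rmorph_nat.
exists r; split=> //.
- by have := trproj_ge0 hP hQ; rewrite er lecR.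
- by have := trproj_le hP hQ; rewrite er ek lecR.
- by move=> e; apply: (trproj_eq hP hQ); rewrite er e ek.
Qed.

(** A quadratic in [r = tr(P Q)], nondecreasing on [[0, k]] when [s] and the real part of [z] are
    nonnegative; its top value [r = k] occurs only at [Q = P]. *)
Lemma tr_affine P Q (z : C) (s r : R) : kproj k Q -> \tr (P *m Q) = r%:C ->
  cnorm2 (\tr ((z *: P + s%:C *: 1%:M) *m Q)) =
  cnorm2 z * r ^+ 2 + 2 * complex.Re z * r * s * k%:R + (s * k%:R) ^+ 2.
Proof.
move=> hQ e; rewrite tr_linear e mul1mx hQ.2.2.
have -> : (k%:R : C) = (k%:R : R)%:C by rewrite rmorph_nat.
by case: z => a b; rewrite /cnorm2 !cReIm /=; ring.
Qed.

Lemma kmax_affine P (z : C) (s : R) : kproj k P -> 0 <= complex.Re z -> 0 <= s ->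
  kmax k (z *: P + s%:C *: 1%:M) P.
Proof.
move=> hP z0 s0; split=> // Q hQ.
have [r [er r0 rk _]] := trproj_real hP hQ.
have [r' [er' _ _ _]] := trproj_real hP hP.
have rk' : r' = k%:R.
  apply: (@complexI R); rewrite -er' hP.2.1 hP.2.2; by rewrite rmorph_nat.
rewrite (tr_affine _ _ hQ er) (tr_affine _ _ hP er') rk' lerD2r lerD //.
  by rewrite ler_wpM2l ?cnorm2_ge0 // lerXn2r ?nnegrE.
rewrite -!mulrA ler_wpM2l // ler_wpM2l // ler_wpM2r // mulr_ge0 //.
Qed.

Lemma kmax_affine_uniq P Q (z : C) (s : R) : kproj k P -> z != 0 ->
  0 <= complex.Re z -> 0 <= s -> kmax k (z *: P + s%:C *: 1%:M) Q -> Q = P.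
Proof.
move=> hP z0 rz0 s0 [hQ /(_ P hP)].
have [r [er r0 rk rE]] := trproj_real hP hQ.
have [r' [er' _ _ _]] := trproj_real hP hP.
have rk' : r' = k%:R.
  apply: (@complexI R); rewrite -er' hP.2.1 hP.2.2; by rewrite rmorph_nat.
rewrite (tr_affine _ _ hQ er) (tr_affine _ _ hP er') rk' => le.
have zz : 0 < cnorm2 z by rewrite lt_def cnorm2_eq0 z0 cnorm2_ge0.
apply: rE; apply/eqP; rewrite eq_le rk /=.
have h : 0 <= complex.Re z * s * k%:R by rewrite !mulr_ge0.
rewrite leNgt; apply/negP => lt.
have d0 : 0 < k%:R - r by rewrite subr_gt0.
have p1 : 0 < cnorm2 z * ((k%:R - r) * (k%:R + r)).
  by rewrite !mulr_gt0 //; lra.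
have p2 : 0 <= complex.Re z * s * k%:R * (k%:R - r) by rewrite mulr_ge0 // ltW.
lra.
Qed.

(** With [r = tr(P Q)] and [y = tr(G Q) = tr(G (Q - P))], the squared modulus at [Q] is
    [r^2 + t^2 y^2]. Cauchy-Schwarz gives [y^2 <= 2 g (k - r)], and the bound on [t] leaves at most
    [r^2 + k (k - r) <= k^2]. *)
Lemma kmax_perturb P G (g t : R) : kproj k P -> hcmx G = G -> \tr (G *m P) = 0 ->
  \tr (G *m G) = g%:C -> 2 * t ^+ 2 * g <= k%:R -> kmax k (P + (0 +i* t) *: G) P.
Proof.
move=> hP hG GP eg tg; split=> // Q hQ.
have [r [er r0 rk _]] := trproj_real hP hQ.
have [y ey] := conj_real (trmul_real hG hQ.1).
have hD : hcmx (Q - P) = Q - P by rewrite hcmxB hP.1 hQ.1.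
have := sqr_trmul_le hG hD; rewrite (trproj_dist hP hQ) er mulmxBr linearB /= GP subr0 ey eg.
have -> : (k%:R : C) = (k%:R : R)%:C by rewrite rmorph_nat.
rewrite -rmorphXn -rmorphB -rmorphMn -rmorphM lecR => yg.
have lin X : \tr ((P + (0 +i* t) *: G) *m X) = \tr (P *m X) + (0 +i* t) * \tr (G *m X).
  by rewrite mulmxDl -scalemxAl mxtraceD mxtraceZ.
rewrite !lin GP ey er hP.2.1 hP.2.2 mulr0 addr0.
have -> : (k%:R : C) = (k%:R : R)%:C by rewrite rmorph_nat.
rewrite /cnorm2 !cReIm /=.
have : t ^+ 2 * y ^+ 2 <= t ^+ 2 * (g * ((k%:R - r) *+ 2)).
  by rewrite ler_wpM2l ?sqr_ge0.
rewrite mulr2n; have : (2 * t ^+ 2 * g) * (k%:R - r) <= k%:R * (k%:R - r).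
  by rewrite ler_wpM2r // subr_ge0.
have : 0 <= r * (k%:R - r) by rewrite mulr_ge0 // subr_ge0.
lra.
Qed.

(** In the plane, [v] and [u] are orthogonal to a nonzero vector, hence parallel; being orthogonal
    to each other and equally long, they vanish. *)
Lemma two_vectors (a v u : R * R) :
  a.1 ^+ 2 + a.2 ^+ 2 != 0 ->
  a.1 * v.1 + a.2 * v.2 = 0 -> a.1 * u.1 + a.2 * u.2 = 0 ->
  v.1 * u.1 + v.2 * u.2 = 0 -> v.1 ^+ 2 + v.2 ^+ 2 = u.1 ^+ 2 + u.2 ^+ 2 ->
  v.1 = 0 /\ v.2 = 0.
Proof.
case: a v u => [a1 a2] [v1 v2] [u1 u2] /= w av au vu e.
have : (a1 ^+ 2 + a2 ^+ 2) * (v1 ^+ 2 + v2 ^+ 2) = 0.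
  suff h : ((a1 ^+ 2 + a2 ^+ 2) * (v1 ^+ 2 + v2 ^+ 2)) ^+ 2 = 0.
    by apply/eqP; move/eqP: h; rewrite sqrf_eq0.
  have -> : ((a1 ^+ 2 + a2 ^+ 2) * (v1 ^+ 2 + v2 ^+ 2)) ^+ 2 =
    ((a1 ^+ 2 + a2 ^+ 2) * (v1 ^+ 2 + v2 ^+ 2)) * ((a1 ^+ 2 + a2 ^+ 2) * (u1 ^+ 2 + u2 ^+ 2)).
    by rewrite expr2 e.
  have -> : (a1 ^+ 2 + a2 ^+ 2) * (v1 ^+ 2 + v2 ^+ 2) =
    (a1 * v1 + a2 * v2) ^+ 2 + (a1 * v2 - a2 * v1) ^+ 2 by ring.
  have -> : (a1 ^+ 2 + a2 ^+ 2) * (u1 ^+ 2 + u2 ^+ 2) =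
    (a1 * u1 + a2 * u2) ^+ 2 + (a1 * u2 - a2 * u1) ^+ 2 by ring.
  rewrite av au !expr0n /= !add0r -exprMn.
  have -> : (a1 * v2 - a2 * v1) * (a1 * u2 - a2 * u1) =
    (a1 ^+ 2 + a2 ^+ 2) * (v1 * u1 + v2 * u2) -
    (a1 * v1 + a2 * v2) * (a1 * u1 + a2 * u2) by ring.
  by rewrite vu av !mul0r mulr0 subr0 expr0n.
move/eqP; rewrite mulf_eq0 (negPf w) /= paddr_eq0 ?sqr_ge0 // !sqrf_eq0.
by move=> /andP[/eqP -> /eqP ->].
Qed.

End Maximisers.

Lemma circle_rigid (R : realType) (a b g d : R[i]) (w : R) : w != 0 ->
  (forall s : R[i], cnorm2 (a + s * b + Num.conj s * g + s * Num.conj s * d) =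
     w * (1 + cnorm2 s) ^+ 2) -> b = 0 /\ a = d.
Proof.
move: a b g d => [a1 a2] [b1 b2] [g1 g2] [d1 d2] w0 h.
(* [v = b + g] and [u = i (b - g)] are the coefficients of the real and imaginary parts of [s]. *)
have [v1 ev1] : exists v1, v1 = b1 + g1 by eexists.
have [v2 ev2] : exists v2, v2 = b2 + g2 by eexists.
have [u1 eu1] : exists u1, u1 = - (b2 - g2) by eexists.
have [u2 eu2] : exists u2, u2 = b1 - g1 by eexists.
have F s1 s2 : (a1 + s1 * v1 + s2 * u1 + (s1 ^+ 2 + s2 ^+ 2) * d1) ^+ 2 +
    (a2 + s1 * v2 + s2 * u2 + (s1 ^+ 2 + s2 ^+ 2) * d2) ^+ 2 =
    w * (1 + (s1 ^+ 2 + s2 ^+ 2)) ^+ 2.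
  have := h (s1 +i* s2); rewrite {1}/cnorm2 !cReIm /= => <-.
  rewrite ev1 ev2 eu1 eu2; ring.
(* These points separate the coefficients of the quartic identity [F], which give the relations
   below as linear combinations. *)
have F00 := F 0 0; have F10 := F 1 0; have F01 := F 0 1; have F20 := F 2 0.
have F02 := F 0 2; have Fm0 := F (-1) 0; have F0m := F 0 (-1); have Fn0 := F (-2) 0.
have F0n := F 0 (-2); have F11 := F 1 1; have Fmm := F (-1) (-1).
have aw : a1 ^+ 2 + a2 ^+ 2 = w by lra.
have av : a1 * v1 + a2 * v2 = 0 by lra.
have au : a1 * u1 + a2 * u2 = 0 by lra.
have dw : d1 ^+ 2 + d2 ^+ 2 = w by lra.
have vv : v1 ^+ 2 + v2 ^+ 2 = 2 * w - 2 * (a1 * d1 + a2 * d2) by lra.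
have uu : u1 ^+ 2 + u2 ^+ 2 = 2 * w - 2 * (a1 * d1 + a2 * d2) by lra.
have vu : v1 * u1 + v2 * u2 = 0 by lra.
have aw0 : a1 ^+ 2 + a2 ^+ 2 != 0 by rewrite aw.
have [/= v10 v20] := @two_vectors R (a1, a2) (v1, v2) (u1, u2) aw0 av au vu
  (etrans vv (esym uu)).
have uv : u1 * v1 + u2 * v2 = 0 by lra.
have [/= u10 u20] := @two_vectors R (a1, a2) (u1, u2) (v1, v2) aw0 au av uv
  (etrans uu (esym vv)).
split; first by apply: complexP => /=; lra.
have /eqP : (a1 - d1) ^+ 2 + (a2 - d2) ^+ 2 = 0.
  by move: vv; rewrite v10 v20 => vv; lra.
rewrite paddr_eq0 ?sqr_ge0 // !sqrf_eq0 !subr_eq0 => /andP[/eqP -> /eqP ->].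
by [].
Qed.

(** Along [curve_delta] the trace, times [1 + |s|^2], is quadratic in [s] and of modulus
    proportional to that factor; [circle_rigid] removes the off-diagonal entry and equates the
    diagonal ones. *)
Lemma const_scalar (R : realType) (n k : nat) (A : 'M[R[i]]_n) (w : R) : (0 < k < n)%N ->
  (forall P, kproj k P -> cnorm2 (\tr (A *m P)) = w) -> exists a : R[i], A = a%:M.
Proof.
move=> kn h; have [w0|w0] := eqVneq w 0.
  apply: (@scalar_of_tr _ n k A 0 kn) => P /h; rewrite w0 => /eqP.
  by rewrite cnorm2_eq0 => /eqP.
have key i j : i != j -> A i j = 0 /\ A i i = A j j.
  move=> ij; have [J [cJ iJ jJ]] := ex_subset_card kn ij.
  pose a := \tr (A *m dproj R[i] J).
  have [|b0 e] := @circle_rigid R a (A i j) (A j i) (a - A i i + A j j) w w0.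
    move=> s; have [Q hQ /(_ A)] := curve_delta s cJ iJ jJ.
    rewrite -/a => <-; rewrite cnorm2M (h _ hQ) mulrC; congr (_ * _).
    by rewrite -cnorm2E; move: (cnorm2 s) => r; rewrite /cnorm2 !cReIm /=; ring.
  split=> //; apply/eqP; rewrite eq_sym -subr_eq0; apply/eqP.
  by move: e => /(congr1 (fun z => z - a)); rewrite subrr => ->; ring.
have i0 : 'I_n by exact: (Ordinal (leq_ltn_trans (leq0n _) (andP kn).2)).
exists (A i0 i0); apply/matrixP => i j; rewrite mxE.
have [<-|ij] := eqVneq i j; last by rewrite (key _ _ ij).1 mulr0n.
rewrite mulr1n; have [->//|ii] := eqVneq i i0; exact: (key _ _ ii).2.
Qed.

(** * The preserver and its dual pairs of projections *)

Section Preserver.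
Variables (R : realType) (n k : nat).
Local Notation C := R[i].
Variables (T : {linear 'M[C]_n -> 'M[C]_n}) (Ti : 'M[C]_n -> 'M[C]_n).
Hypothesis kn : (0 < k < n)%N.
Hypotheses (TiK : cancel T Ti) (TK : cancel Ti T).
Hypothesis Tpar : forall A B, (exists P, kmax k A P /\ kmax k B P) ->
  exists Q, kmax k (T A) Q /\ kmax k (T B) Q.
Implicit Types A B G P Q X : 'M[C]_n.

Let lekn : (k <= n)%N := ltnW (andP kn).2.

Lemma kmax_proj P : kproj k P -> kmax k P P.
Proof.
move=> hP; have := @kmax_affine R n k P 1 0 hP ler01 (lexx _).
by rewrite scale1r scale0r addr0.
Qed.

Lemma kmax_proj_uniq P Q : kproj k P -> kmax k P Q -> Q = P.
Proof.
move=> hP hQ; apply: (@kmax_affine_uniq R n k P Q 1 0 hP (oner_neq0 _) ler01 (lexx _)).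
by rewrite scale1r scale0r addr0.
Qed.

(** Every projection maximises [1], so [1] shares a maximiser with [Ti P] and [T 1] shares one with
    [P], necessarily [P] itself. Hence [|tr(T(1) P)|] is constant in [P]. *)
Lemma image_one : exists2 c : C, c != 0 & T 1%:M = c%:M.
Proof.
have all P : kproj k P -> kmax k (T 1%:M) P.
  move=> hP; have [P0 h0] := kmax_exists lekn (Ti P).
  have h1 : kmax k 1%:M P0.
    have := @kmax_affine R n k P0 0 1 h0.1 (lexx _) ler01.
    by rewrite scale0r scale1r add0r.
  have [Q [q1 q2]] := Tpar (ex_intro _ P0 (conj h1 h0)).
  by rewrite TK in q2; rewrite -(kmax_proj_uniq hP q2).
have [P0 h0] := proj_exists C lekn.
have [|c ec] := @const_scalar R n k (T 1%:M) (cnorm2 (\tr (T 1%:M *m P0))) kn.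
  by move=> P hP; apply/eqP; rewrite eq_le (all _ h0).2 // (all _ hP).2.
exists c => //; apply/eqP => c0.
have : (1%:M : 'M[C]_n) = 0.
  rewrite -[LHS]TiK ec c0 -[RHS]TiK linear0; congr (Ti _).
  by apply/matrixP => i j; rewrite !mxE mul0rn.
have i0 : 'I_n by exact: (Ordinal (leq_ltn_trans (leq0n _) (andP kn).2)).
by move=> /matrixP /(_ i0 i0); rewrite !mxE eqxx => /eqP; rewrite oner_eq0.
Qed.

Hypothesis T1 : T 1%:M = 1%:M.

(* [iP + s] and [-iP + s] have the sole common maximiser [P]; let [s] tend to infinity in the
   maximality of a common maximiser of their images. *)
Lemma im_const_le P Q1 Q2 : kproj k P -> kproj k Q1 -> kproj k Q2 ->
  complex.Im (\tr (T P *m Q1)) <= complex.Im (\tr (T P *m Q2)).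
Proof.
move=> hP h1 h2; have [Pm hm] := kmax_exists lekn (T P).
pose M := cnorm2 (\tr (T P *m Pm)).
have k0 : 0 < (k%:R : R) by rewrite ltr0n (andP kn).1.
(* Maximality for [iP + s] against [Q2] and for [-iP + s] against [Q1] are added: [(s k)^2] and the
   cross terms at the common maximiser cancel, leaving a bound linear in [s]. *)
have key (s : R) : 0 <= s -> s * (k%:R *
    (complex.Im (\tr (T P *m Q1)) - complex.Im (\tr (T P *m Q2)))) <= M.
  move=> s0.
  have hA := @kmax_affine R n k P (0 +i* 1) s hP (lexx _) s0.
  have hB : kmax k ((0 +i* (-1)) *: P + s%:C *: 1%:M) P.
    exact: (@kmax_affine R n k P (0 +i* (-1)) s hP (lexx _) s0).
  have [Q [qA qB]] := Tpar (ex_intro _ P (conj hA hB)).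
  have ex (e : R) X : kproj k X -> cnorm2 (\tr (T ((0 +i* e) *: P + s%:C *: 1%:M) *m X)) =
     (s * k%:R - e * complex.Im (\tr (T P *m X))) ^+ 2 +
     (e * complex.Re (\tr (T P *m X))) ^+ 2.
    move=> hX; rewrite linearD !linearZ T1 tr_linear mul1mx hX.2.2.
    have -> : (k%:R : C) = (k%:R : R)%:C by rewrite rmorph_nat.
    by rewrite /cnorm2 !cReIm /=; ring.
  have a1 := qA.2 _ h2; rewrite (ex 1 _ h2) (ex 1 _ qA.1) in a1.
  have b1 := qB.2 _ h1; rewrite (ex (-1) _ h1) (ex (-1) _ qA.1) in b1.
  have mQ := hm.2 _ qA.1; rewrite -/M /cnorm2 in mQ.
  move: a1 b1 mQ; set q := \tr (T P *m Q); set q1 := \tr (T P *m Q1).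
  set q2 := \tr (T P *m Q2).
  move: (M) (q) (q1) (q2) => m [x y] [x1 y1] [x2 y2] /=.
  have := sqr_ge0 x1; have := sqr_ge0 x2; have := sqr_ge0 y1; have := sqr_ge0 y2.
  lra.
rewrite leNgt; apply/negP => lt.
set d := complex.Im (\tr (T P *m Q1)) - complex.Im (\tr (T P *m Q2)) in key.
have d0 : 0 < k%:R * d by rewrite mulr_gt0 // subr_gt0.
have M0 : 0 <= M := cnorm2_ge0 _.
have := key ((M + 1) / (k%:R * d)); rewrite mulfVK ?gt_eqF //.
move=> /(_ (divr_ge0 (addr_ge0 M0 ler01) (ltW d0))); lra.
Qed.

Lemma im_scalar P : kproj k P -> exists a : C, T P - hcmx (T P) = a%:M.
Proof.
move=> hP; have [P0 h0] := proj_exists C lekn.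
apply: (@scalar_of_tr _ n k _ (\tr ((T P - hcmx (T P)) *m P0)) kn) => Q hQ.
have e X : kproj k X -> \tr ((T P - hcmx (T P)) *m X) =
    0 +i* (2 * complex.Im (\tr (T P *m X))).
  move=> hX; rewrite mulmxBl linearB /=.
  have -> : \tr (hcmx (T P) *m X) = Num.conj (\tr (T P *m X)).
    by rewrite -mxtrace_hc hcmxM hX.1 mxtrace_mulC.
  by apply: complexP; rewrite !cReIm /=; ring.
rewrite !e //; congr (_ +i* (_ * _)).
by apply/eqP; rewrite eq_le !im_const_le.
Qed.

(** The inner [hcmx] makes the difference complex linear in [G], so the property passes from
    projections to their span. *)
Lemma im_scalar_all G : exists a : C, T G - hcmx (T (hcmx G)) = a%:M.
Proof.
pose M X := T X - hcmx (T (hcmx X)).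
have lM (a : C) X Y : M (a *: X + Y) = a *: M X + M Y.
  rewrite /M hcmxD hcmxZ !(linearP T) hcmxD hcmxZ conjCK.
  by rewrite scalerBr opprD addrACA.
have off i j : i != j -> M G i j = 0.
  move=> ij; apply: (@linear_form_eq0 C n k (fun X => M X i j) kn).
    by move=> a X Y; rewrite lM !mxE.
  move=> P hP; have [a e] := im_scalar hP.
  by rewrite /M hP.1 e mxE (negPf ij) mulr0n.
have dia i j : M G i i = M G j j.
  apply/eqP; rewrite -subr_eq0; apply/eqP.
  apply: (@linear_form_eq0 C n k (fun X => M X i i - M X j j) kn).
    by move=> a X Y; rewrite lM !mxE; ring.
  move=> P hP; have [a e] := im_scalar hP.
  by rewrite /M hP.1 e !mxE !eqxx subrr.
have i0 : 'I_n by exact: (Ordinal (leq_ltn_trans (leq0n _) (andP kn).2)).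
exists (M G i0 i0); apply/matrixP => i j; rewrite [RHS]mxE mulrb -/(M G).
have [<-|ij] := eqVneq i j; first exact: dia.
exact: off.
Qed.

Lemma im_scalar_herm G : hcmx G = G -> exists a : C, hcmx (T G) = T G + a%:M.
Proof.
move=> hG; have [a] := im_scalar_all G; rewrite hG => e.
by exists (- a); rewrite -scaleN1r -scale_scalar_mx scaleN1r -e opprB addrC subrK.
Qed.

(* The trace adjoint of [T] will send [Q] to [P]. *)
Definition dual_pair P Q := [/\ complex.Im (\tr (T P *m Q)) = 0 &
  forall X, hcmx X = X -> complex.Re (\tr (T X *m Q)) = complex.Re (\tr (X *m P))].

Section DualPair.
Variables (A P Q : 'M[C]_n).
Hypotheses (hQ : kproj k Q) (uQ : forall Q', kmax k (T A) Q' -> Q' = Q) (AP : kmax k A P).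

Lemma kmax_image B : kmax k B P -> kmax k (T B) Q.
Proof.
move=> hB; have [Q' [h1 h2]] := Tpar (ex_intro _ P (conj AP hB)).
by rewrite -(uQ h1).
Qed.

(** Optimality for [P + s]: as [T P] is hermitian up to a scalar, [2 (Re tr(T(P) Q) + s k) T P]
    commutes with [Q], and [s = 0] or [s = 1] makes the coefficient nonzero. *)
Lemma image_proj_comm : comm_mx Q (T P).
Proof.
have hP := AP.1; have [a ea] := im_scalar_herm hP.1.
have key (s : R) : 0 <= s -> complex.Re (\tr (T P *m Q)) + s * k%:R != 0 -> comm_mx Q (T P).
  move=> s0 ne; have hB := @kmax_affine R n k P 1 s hP ler01 s0.
  have := kmax_comm (kmax_image hB); rewrite -/(comm_mx _ _).
  have -> : T (1 *: P + s%:C *: 1%:M) = T P + s%:C *: 1%:M.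
    by rewrite scale1r linearD linearZ /= T1.
  rewrite hcmxD hcmxZ hcmx1 ea.
  set al := \tr _ => h.
  have : comm_mx Q ((Num.conj al + al) *: T P).
    rewrite (_ : (Num.conj al + al) *: T P =
       (Num.conj al *: (T P + s%:C *: 1%:M) + al *: (T P + a%:M + Num.conj s%:C *: 1%:M))
       - (Num.conj al * s%:C + al * a + al * Num.conj s%:C)%:M); last first.
      rewrite !scalerDr !scalerA !scalemx1 scale_scalar_mx !raddfD /= scalerDl.
      by apply/matrixP => i j; rewrite !mxE; ring.
    by apply: comm_mxB => //; exact: comm_mx_scalar.
  have ale : Num.conj al + al = (2 * (complex.Re (\tr (T P *m Q)) + s * k%:R))%:C.
    rewrite /al mulmxDl -scalemxAl mul1mx mxtraceD mxtraceZ hQ.2.2.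
    have -> : (k%:R : C) = (k%:R : R)%:C by rewrite rmorph_nat.
    by apply: complexP; rewrite !cReIm /=; ring.
  have al0 : Num.conj al + al != 0.
    by rewrite ale fmorph_eq0 mulf_neq0 // pnatr_eq0.
  by rewrite /comm_mx -scalemxAr -scalemxAl => /(scalerI al0).
have k0 : 0 < (k%:R : R) by rewrite ltr0n (andP kn).1.
have [e0|e0] := eqVneq (complex.Re (\tr (T P *m Q))) 0.
  by apply: (key 1 ler01); rewrite e0 add0r mul1r gt_eqF.
by apply: (key 0 (lexx _)); rewrite mul0r addr0.
Qed.

(** Optimality for [P + i t G]: as [T P] and scalars commute with [Q], the coefficient
    [2 t (Im tr(T(P) Q) + t Re tr(T(G) Q))] of [T G] must vanish, for two admissible values of
    [t]. *)
Lemma image_perturb G : hcmx G = G -> \tr (G *m P) = 0 -> ~ comm_mx Q (T G) ->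
  complex.Im (\tr (T P *m Q)) = 0 /\ complex.Re (\tr (T G *m Q)) = 0.
Proof.
move=> hG GP nc; have hP := AP.1.
have [a ea] := im_scalar_herm hP.1; have [b eb] := im_scalar_herm hG.
have [g eg] := conj_real (trmul_real hG hG).
have g0 : 0 <= g.
  by have := trmul_hc_ge0 G; rewrite hG eg lecR.
have k0 : 0 < (k%:R : R) by rewrite ltr0n (andP kn).1.
have key (t : R) : t != 0 -> 2 * t ^+ 2 * g <= k%:R ->
    complex.Im (\tr (T P *m Q)) + t * complex.Re (\tr (T G *m Q)) = 0.
  move=> t0 tg; have hB := kmax_perturb hP hG GP eg tg.
  have := kmax_comm (kmax_image hB); rewrite -/(comm_mx _ _).
  have -> : T (P + (0 +i* t) *: G) = T P + (0 +i* t) *: T G by rewrite linearD linearZ.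
  rewrite hcmxD hcmxZ ea eb.
  set al := \tr _ => h.
  pose w : C := 0 +i* t.
  have hw : Num.conj w = - w by apply: complexP; rewrite !cReIm /= ?oppr0.
  have : comm_mx Q ((w * (Num.conj al - al)) *: T G).
    rewrite (_ : _ *: T G =
       (Num.conj al *: (T P + w *: T G) + al *: (T P + a%:M + Num.conj w *: (T G + b%:M)))
       - ((Num.conj al + al) *: T P + (al * a - al * w * b)%:M)); last first.
      by rewrite hw; apply/matrixP => i j; rewrite !mxE; ring.
    apply: comm_mxB => //; apply: comm_mxD; last exact: comm_mx_scalar.
    by rewrite /comm_mx -scalemxAr -scalemxAl image_proj_comm.
  have ale : w * (Num.conj al - al) =
    (2 * t * (complex.Im (\tr (T P *m Q)) + t * complex.Re (\tr (T G *m Q))))%:C.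
    rewrite /al mulmxDl -scalemxAl mxtraceD mxtraceZ.
    move: (\tr (T P *m Q)) (\tr (T G *m Q)) => x y.
    by apply: complexP; rewrite !cReIm /=; ring.
  have [e0|ne] := eqVneq (complex.Im (\tr (T P *m Q)) + t * complex.Re (\tr (T G *m Q))) 0.
    by [].
  have al0 : w * (Num.conj al - al) != 0.
    by rewrite ale fmorph_eq0 !mulf_neq0 // pnatr_eq0.
  by rewrite /comm_mx -scalemxAr -scalemxAl => /(scalerI al0).
have d0 : 0 < 2 * g + k%:R by lra.
(* Chosen so that [t <= 1] and [2 t g <= k]; then [t] and [t / 2] both satisfy the bound of
   [kmax_perturb]. *)
pose t := k%:R / (2 * g + k%:R).
have t0 : 0 < t by rewrite divr_gt0.
have t1 : t <= 1 by rewrite ler_pdivrMr //; lra.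
have tg : 2 * t * g <= k%:R.
  rewrite /t mulrAC mulrA ler_pdivrMr //.
  have := mulr_ge0 (ltW k0) (ltW k0); lra.
have tt : t ^+ 2 <= t by rewrite expr2 ler_piMl // ltW.
have tt0 := sqr_ge0 t.
have tg2 : 2 * t ^+ 2 * g <= 2 * t * g by rewrite ler_wpM2r // ler_wpM2l.
have e1 : _ := key t (lt0r_neq0 t0) (le_trans tg2 tg).
have e2 : complex.Im (\tr (T P *m Q)) + t / 2 * complex.Re (\tr (T G *m Q)) = 0.
  apply: key; first by rewrite mulf_neq0 ?lt0r_neq0 // invr_gt0.
  have : 0 <= t ^+ 2 * g by rewrite mulr_ge0.
  rewrite exprMn; lra.
have : t * complex.Re (\tr (T G *m Q)) = 0 by lra.
move=> /eqP; rewrite mulf_eq0 (negPf (lt0r_neq0 t0)) /= => /eqP re0.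
by split=> //; move: e1; rewrite re0 mulr0 addr0.
Qed.

(** Otherwise [Q] commutes with the image of every projection, hence with all matrices since [T] is
    onto; but a scalar idempotent has trace [0] or [n]. *)
Lemma ex_noncomm : exists G, [/\ hcmx G = G, \tr (G *m P) = 0 & ~ comm_mx Q (T G)].
Proof.
apply: contrapT => nex.
have k0 : (k%:R : C) != 0 by rewrite pnatr_eq0 -lt0n (andP kn).1.
have hP := AP.1.
have cproj P' : kproj k P' -> comm_mx Q (T P').
  move=> hP'; pose c := \tr (P' *m P) / k%:R.
  have cr : Num.conj c = c.
    by rewrite /c rmorphM fmorphV /= rmorph_nat (trmul_real hP'.1 hP.1).
  have e : T P' = T (P' - c *: 1%:M) + c *: 1%:M by rewrite linearB linearZ /= T1 subrK.
  rewrite e; apply: comm_mxD; last by rewrite scalemx1; exact: comm_mx_scalar.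
  apply: contrapT => nc; apply: nex; exists (P' - c *: 1%:M); split=> //.
    by rewrite hcmxB hcmxZ hcmx1 cr hP'.1.
  by rewrite mulmxBl -scalemxAl mul1mx linearB /= mxtraceZ hP.2.2 /c mulfVK // subrr.
have call X : comm_mx Q (T X).
  apply/matrixP => i j; apply/eqP; rewrite -subr_eq0; apply/eqP.
  apply: (@linear_form_eq0 C n k (fun X => (Q *m T X) i j - (T X *m Q) i j) kn).
    move=> a Y Z; rewrite (linearP T) mulmxDl mulmxDr -scalemxAl -scalemxAr !mxE; ring.
  by move=> P' hP'; rewrite (cproj _ hP') subrr.
have [|B|a ea] := @comm_all_scalar C n Q; first by rewrite (leq_trans _ (andP kn).2).
  by rewrite -(TK B).
have [_ [iQ tQ]] := hQ.
have a1 : a * a = a.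
  move: iQ; rewrite ea -scalar_mxM => /matrixP.
  pose i0 : 'I_n := Ordinal (leq_ltn_trans (leq0n _) (andP kn).2).
  by move=> /(_ i0 i0); rewrite !mxE eqxx !mulr1n.
move/eqP: a1; rewrite -subr_eq0 -{3}[a]mulr1 -mulrBr mulf_eq0 subr_eq0 => /orP[] /eqP a1;
  move: tQ; rewrite ea a1 mxtrace_scalar.
  by rewrite mul0rn => /esym/eqP; rewrite (negPf k0).
move=> /eqP; rewrite eqr_nat => /eqP nk; by have := (andP kn).2; rewrite nk ltnn.
Qed.

Lemma dual_pair_of_max : dual_pair P Q.
Proof.
have hP := AP.1; have [G0 [hG0 G0P nc0]] := ex_noncomm.
have [e1 e2] := image_perturb hG0 G0P nc0; split=> //.
have k0 : (k%:R : C) != 0 by rewrite pnatr_eq0 -lt0n (andP kn).1.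
(* If [T G] commutes with [Q], then [T (G + G0)] does not, and [G0] contributes zero. *)
have key G : hcmx G = G -> \tr (G *m P) = 0 -> complex.Re (\tr (T G *m Q)) = 0.
  move=> hG GP; have [c|nc] := pselect (comm_mx Q (T G)); last exact: (image_perturb hG GP nc).2.
  have [||| _] := @image_perturb (G + G0).
  - by rewrite hcmxD hG hG0.
  - by rewrite mulmxDl mxtraceD GP G0P addr0.
  - move=> c'; apply: nc0; rewrite -[G0](addKr G) linearD linearN addrC.
    exact: comm_mxB.
  by rewrite linearD mulmxDl mxtraceD cReIm e2 addr0.
move=> X hX; pose c := \tr (X *m P) / k%:R.
have cr : Num.conj c = c.
  by rewrite /c rmorphM fmorphV /= rmorph_nat (trmul_real hX hP.1).
have -> : T X = T (X - c *: 1%:M) + c *: 1%:M by rewrite linearB linearZ /= T1 subrK.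
rewrite mulmxDl mxtraceD cReIm key; last first.
- by rewrite mulmxBl -scalemxAl mul1mx linearB /= mxtraceZ hP.2.2 /c mulfVK // subrr.
- by rewrite hcmxB hcmxZ hcmx1 cr hX.
by rewrite add0r -scalemxAl mul1mx mxtraceZ hQ.2.2 /c mulfVK.
Qed.

End DualPair.

Lemma dual_pair_onto Q : kproj k Q -> exists2 P, kproj k P & dual_pair P Q.
Proof.
move=> hQ; have [P hP] := kmax_exists lekn (Ti Q).
exists P; first exact: hP.1.
by apply: (dual_pair_of_max hQ _ hP) => Q'; rewrite TK; exact: kmax_proj_uniq.
Qed.

Lemma dual_pair_uniq P P' Q : kproj k P -> kproj k P' -> dual_pair P Q -> dual_pair P' Q -> P = P'.
Proof.
move=> hP hP' [_ g] [_ g'].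
have hD : hcmx (P - P') = P - P' by rewrite hcmxB hP.1 hP'.1.
apply/eqP; rewrite -subr_eq0; apply/eqP; apply: trmul_hc_eq0; rewrite hD.
have [r er] := conj_real (trmul_real hD hD); rewrite er.
have : complex.Re (\tr ((P - P') *m (P - P'))) = 0.
  by rewrite mulmxBr linearB /= !cReIm -g // -g' // subrr.
by rewrite er /= => ->.
Qed.

Lemma kmax_image_neq0 P Q : kproj k P -> kmax k (T P) Q -> \tr (T P *m Q) != 0.
Proof.
move=> hP hQ; apply/eqP => e0.
have k0 : (k%:R : C) != 0 by rewrite pnatr_eq0 -lt0n (andP kn).1.
have h Q' : kproj k Q' -> \tr (T P *m Q') = 0.
  move=> hQ'; apply/eqP; rewrite -cnorm2_eq0 eq_le cnorm2_ge0 andbT.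
  by apply: le_trans (hQ.2 _ hQ') _; rewrite e0 /cnorm2 /= expr0n addr0.
have [a ea] := @scalar_of_tr _ n k _ 0 kn h.
have := h _ hP; rewrite ea mul_scalar_mx mxtraceZ hP.2.2 => /eqP.
rewrite mulf_eq0 (negPf k0) orbF => /eqP a0.
have P0 : P = 0.
  rewrite -[LHS]TiK ea a0 -[RHS]TiK linear0; congr (Ti _).
  by apply/matrixP => i j; rewrite !mxE mul0rn.
by move: hP.2.2; rewrite P0 mxtrace0 => /esym/eqP; rewrite (negPf k0).
Qed.

(* [P + t al T^-1(Q)], for [t > 0], has an image with unique maximiser [Q], hence a
   maximiser independent of [t]; at [t = 0] it must be [P]. *)
Lemma dual_pair_exists P : kproj k P -> exists2 Q, kproj k Q & dual_pair P Q.
Proof.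
move=> hP; have [Q hQ] := kmax_exists lekn (T P).
have al0 := kmax_image_neq0 hP hQ; set al := \tr _ in al0.
exists Q; first exact: hQ.1.
(* The factor [al] gives both terms of [tr(T(A t) Q)] the same phase, so another maximiser would
   lose on the second term without gaining on the first. *)
pose A (t : R) := P + (t%:C * al) *: Ti Q.
have TA t : T (A t) = T P + (t%:C * al) *: Q by rewrite linearD linearZ /= TK.
have ek : (k%:R : C) = (k%:R : R)%:C by rewrite rmorph_nat.
have nal : 0 < ComplexField.Normc.normc al.
  by rewrite normc_sqrt sqrtr_gt0 lt_def cnorm2_eq0 al0 cnorm2_ge0.
have uQ (t : R) Q' : 0 < t -> kmax k (T (A t)) Q' -> Q' = Q.
  move=> t0 [hQ' /(_ Q hQ.1)]; rewrite -le_normc TA !mulmxDl -!scalemxAl !mxtraceD !mxtraceZ.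
  have [r [er r0 rk rE]] := trproj_real hQ.1 hQ'.
  rewrite er hQ.1.2.1 hQ.1.2.2 ek -/al => le; apply: rE; apply/eqP; rewrite eq_le rk /=.
  have le2 := le_normcD (\tr (T P *m Q')) (t%:C * al * r%:C).
  have le3 := le_normc_kmax hQ hQ'.
  have e (x : R) : 0 <= x -> ComplexField.Normc.normc (t%:C * al * x%:C) =
      ComplexField.Normc.normc al * (t * x).
    move=> x0; rewrite !normc_sqrt !cnorm2M sqrtrM ?mulr_ge0 ?cnorm2_ge0 //.
    rewrite sqrtrM ?cnorm2_ge0 // /cnorm2 /= !expr0n /= !addr0 !sqrtr_sqr.
    by rewrite !ger0_norm // ?ltW //; ring.
  have e' : al + t%:C * al * (k%:R : R)%:C = al * (1 + t * k%:R)%:C.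
    by apply: complexP; rewrite !cReIm /=; ring.
  have e'' : ComplexField.Normc.normc (al * (1 + t * k%:R)%:C) =
      ComplexField.Normc.normc al * (1 + t * k%:R).
    have p0 : 0 <= 1 + t * k%:R by rewrite addr_ge0 // mulr_ge0 // ltW.
    rewrite !normc_sqrt cnorm2M sqrtrM ?cnorm2_ge0 //; congr (_ * _).
    by rewrite /cnorm2 /= expr0n addr0 sqrtr_sqr ger0_norm.
  rewrite e' e'' in le; rewrite e // in le2.
  have : ComplexField.Normc.normc al * (t * k%:R) <= ComplexField.Normc.normc al * (t * r).
    by move: le3; rewrite -/al; lra.
  by rewrite !ler_pM2l.
have [P' hP'] := kmax_exists lekn (A 1).
have gP' := dual_pair_of_max hQ.1 (uQ 1 ^~ ltr01) hP'.
suff -> : P = P' by [].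
have all t : 0 < t -> kmax k (A t) P'.
  move=> t0; have [Pt hPt] := kmax_exists lekn (A t).
  have gPt := dual_pair_of_max hQ.1 (fun Q' => uQ t Q' t0) hPt.
  by rewrite (dual_pair_uniq hP'.1 hPt.1 gP' gPt).
have [r [er r0 rk rE]] := trproj_real hP hP'.1.
apply/esym/rE/eqP; rewrite eq_le rk /=.
(* Comparing [A t] at [P'] and at [P] gives [k^2 - r^2 <= t K], and [t] is arbitrarily small. *)
suff : k%:R ^+ 2 - r ^+ 2 <= 0.
  by rewrite subr_le0 ler_pXn2r ?nnegrE // => ->.
pose x := al * \tr (Ti Q *m P'); pose y := al * \tr (Ti Q *m P).
pose K := `|2 * r * complex.Re x - 2 * k%:R * complex.Re y| + `|cnorm2 x - cnorm2 y|.
apply: (@le0_of_small _ _ K) => t t0 t1.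
have := (all t t0).2 P hP; rewrite /A !mulmxDl -!scalemxAl !mxtraceD !mxtraceZ.
rewrite er hP.2.1 hP.2.2 ek -!mulrA -/x -/y.
have -> : cnorm2 ((k%:R : R)%:C + t%:C * y) =
    k%:R ^+ 2 + t * (2 * k%:R * complex.Re y) + t ^+ 2 * cnorm2 y.
  by rewrite /cnorm2 !cReIm /=; ring.
have -> : cnorm2 (r%:C + t%:C * x) =
    r ^+ 2 + t * (2 * r * complex.Re x) + t ^+ 2 * cnorm2 x.
  by rewrite /cnorm2 !cReIm /=; ring.
set u := 2 * r * complex.Re x; set v := 2 * k%:R * complex.Re y => le.
have h1 := ler_norm (u - v); have h2 := ler_norm (cnorm2 x - cnorm2 y).
have m1 : t * (u - v) <= t * `|u - v| by rewrite ler_wpM2l // ltW.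
have m2 : t ^+ 2 * (cnorm2 x - cnorm2 y) <= t * `|cnorm2 x - cnorm2 y|.
  have tt : t ^+ 2 <= t by rewrite expr2 ler_piMl // ltW.
  apply: (le_trans (ler_wpM2l (sqr_ge0 t) h2)).
  by rewrite ler_wpM2r.
have m3 : k%:R ^+ 2 - r ^+ 2 <= t * K by rewrite /K mulrDr; lra.
have -> : K * t ^+ 2 = t * (t * K) by move: {m3} K => K; ring.
by rewrite ler_pM2l.
Qed.

(** The scalar by which [T P] could fail to be hermitian is tested against the dual [Q], where
    [tr(T(P) Q)] is real, and vanishes. *)
Lemma image_herm G : hcmx (T (hcmx G)) = T G.
Proof.
have k0 : (k%:R : C) != 0 by rewrite pnatr_eq0 -lt0n (andP kn).1.
apply/esym/matrixP => i j; apply/eqP; rewrite -subr_eq0; apply/eqP.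
apply: (@linear_form_eq0 C n k (fun X => T X i j - hcmx (T (hcmx X)) i j) kn).
  move=> a Y Z; rewrite hcmxD hcmxZ !(linearP T) hcmxD hcmxZ conjCK !mxE; ring.
move=> P hP; have [Q hQ [im0 _]] := dual_pair_exists hP; rewrite hP.1.
have [a ea] := im_scalar_herm hP.1.
have : \tr (hcmx (T P) *m Q) = Num.conj (\tr (T P *m Q)).
  by rewrite -mxtrace_hc hcmxM hQ.1 mxtrace_mulC.
rewrite ea mulmxDl mul_scalar_mx mxtraceD mxtraceZ hQ.2.2.
have -> : Num.conj (\tr (T P *m Q)) = \tr (T P *m Q).
  by apply: complexP; rewrite !cReIm ?im0 ?oppr0.
move=> /eqP; rewrite -subr_eq0 addrAC subrr add0r mulf_eq0 (negPf k0) orbF => /eqP ->.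
by rewrite !mxE mul0rn addr0 subrr.
Qed.

Lemma dual_pair_tr P Q : kproj k P -> kproj k Q -> dual_pair P Q ->
  forall X, \tr (T X *m Q) = \tr (X *m P).
Proof.
move=> hP hQ [_ g] X; apply/eqP; rewrite -subr_eq0; apply/eqP.
apply: (@linear_form_eq0 C n k (fun X => \tr (T X *m Q) - \tr (X *m P)) kn).
  move=> a Y Z; rewrite (linearP T) !mulmxDl -!scalemxAl !mxtraceD !mxtraceZ; ring.
move=> P' hP'; have hT : hcmx (T P') = T P' by rewrite -{1}hP'.1 image_herm.
have [x ex] := conj_real (trmul_real hT hQ.1).
have [y ey] := conj_real (trmul_real hP'.1 hP.1).
by have := g _ hP'.1; rewrite ex ey /= => ->; rewrite subrr.
Qed.

Lemma dual_proj_l P : kproj k P ->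
  exists2 Q, kproj k Q & forall X, \tr (T X *m Q) = \tr (X *m P).
Proof. by move=> hP; have [Q hQ g] := dual_pair_exists hP; exists Q => //; exact: dual_pair_tr g. Qed.

Lemma dual_proj_r Q : kproj k Q ->
  exists2 P, kproj k P & forall X, \tr (T X *m Q) = \tr (X *m P).
Proof. by move=> hQ; have [P hP g] := dual_pair_onto hQ; exists P => //; exact: dual_pair_tr g. Qed.

End Preserver.

(** * The trace adjoint on projections and their commutativity *)

Section Dual.
Variables (R : realType) (n k : nat).
Local Notation C := R[i].
Variables (T : {linear 'M[C]_n -> 'M[C]_n}) (Ti : 'M[C]_n -> 'M[C]_n).
Hypothesis kn : (0 < k < n)%N.
Hypotheses (TiK : cancel T Ti) (TK : cancel Ti T).
Hypothesis Therm : forall X, hcmx (T (hcmx X)) = T X.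
Hypothesis dual_l : forall P, kproj k P ->
  exists2 Q, kproj k Q & forall X, \tr (T X *m Q) = \tr (X *m P).
Hypothesis dual_r : forall Q, kproj k Q ->
  exists2 P, kproj k P & forall X, \tr (T X *m Q) = \tr (X *m P).
Implicit Types A B G P Q X : 'M[C]_n.
Local Notation L := (trace_adj T).

Lemma dual_proj Q : kproj k Q -> kproj k (L Q).
Proof.
move=> hQ; have [P hP e] := dual_r hQ; suff -> : L Q = P by [].
by apply: trmul_inj => A; rewrite -trace_adjE e.
Qed.

Lemma dual_onto P : kproj k P -> exists2 Q, kproj k Q & L Q = P.
Proof.
move=> hP; have [Q hQ e] := dual_l hP; exists Q => //.
by apply: trmul_inj => A; rewrite -trace_adjE e.
Qed.

Lemma dual_inv X Y : \tr (Ti X *m L Y) = \tr (X *m Y).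
Proof. by rewrite -trace_adjE TK. Qed.

Lemma dual_inj : injective L.
Proof.
by move=> X Y e; apply: trmul_inj => A; rewrite -(dual_inv A X) -(dual_inv A Y) e.
Qed.

Lemma dual_herm X : L (hcmx X) = hcmx (L X).
Proof.
apply: trmul_inj => A; rewrite -trace_adjE.
have e Y Z : \tr (Y *m hcmx Z) = Num.conj (\tr (hcmx Y *m Z)).
  by rewrite -mxtrace_hc hcmxM hcmxK mxtrace_mulC.
by rewrite !e -trace_adjE -{1}[A]hcmxK -[in RHS](hcmxK A) -Therm !hcmxK.
Qed.

Lemma inv_herm X : hcmx X = X -> hcmx (Ti X) = Ti X.
Proof.
by move=> hX; apply: (can_inj TiK); rewrite TK -[LHS]Therm hcmxK TK.
Qed.

Lemma kmax_comm_herm A P : hcmx A = A -> kmax k A P -> \tr (A *m P) != 0 -> comm_mx P A.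
Proof.
move=> hA hP a0; have := kmax_comm hP; rewrite hA (trmul_real hA hP.1.1).
rewrite -scalerDl -scalemxAr -scalemxAl; apply: scalerI.
by rewrite -mulr2n mulrn_eq0.
Qed.

Lemma kmax_inv A Q : kproj k Q -> kmax k A Q -> kmax k (Ti A) (L Q).
Proof.
move=> hQ hA; split; first exact: dual_proj.
by move=> P hP; have [Q' hQ' <-] := dual_onto hP; rewrite !dual_inv; exact: hA.2.
Qed.

Lemma kmax_inv_uniq Q P : kproj k Q -> kmax k (Ti Q) P -> P = L Q.
Proof.
move=> hQ hP; have [Q' hQ' e] := dual_onto hP.1; rewrite -e; congr L.
apply: (kmax_proj_uniq hQ); split=> // Q0 hQ0.
by rewrite -(dual_inv Q Q0) -(dual_inv Q Q') e; apply: hP.2; exact: dual_proj.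
Qed.

Lemma kmax_comm_proj P Q : kproj k P -> kproj k Q -> comm_mx P Q -> kmax k (P + Q) Q.
Proof.
move=> hP hQ c; split=> // X hX; have le := tr_comm_proj_le hP hQ hX c.
have hS : hcmx (P + Q) = P + Q by rewrite hcmxD hP.1 hQ.1.
have [x ex] := conj_real (trmul_real hS hX.1).
have [y ey] := conj_real (trmul_real hS hQ.1).
have x0 : 0 <= \tr ((P + Q) *m X).
  by rewrite mulmxDl mxtraceD addr_ge0 //; apply: (@trproj_ge0 _ _ k).
move: le x0; rewrite ex ey lecR lecR => le x0.
by rewrite /cnorm2 /= expr0n !addr0 lerXn2r ?nnegrE // (le_trans x0).
Qed.

(** [Q] maximises both [Q] and [P + Q], so [L Q] maximises their preimages, commutes with them by
    the first-order condition, and hence with [Ti P]. Conjugation by the reflection [V = 2 L(Q) - 1]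
    then fixes [Ti P], so it fixes the sole maximiser [L P]. *)
Lemma dual_comm P Q : kproj k P -> kproj k Q -> comm_mx P Q -> comm_mx (L P) (L Q).
Proof.
move=> hP hQ c.
have k0 : (k%:R : C) != 0 by rewrite pnatr_eq0 -lt0n (andP kn).1.
have c1 : comm_mx (L Q) (Ti Q).
  apply: kmax_comm_herm; [exact: inv_herm hQ.1 | exact: kmax_inv (kmax_proj hQ) |].
  by rewrite dual_inv hQ.2.1 hQ.2.2.
have c2 : comm_mx (L Q) (Ti (P + Q)).
  apply: kmax_comm_herm.
  - by apply: inv_herm; rewrite hcmxD hP.1 hQ.1.
  - exact: kmax_inv (kmax_comm_proj hP hQ c).
  rewrite dual_inv mulmxDl mxtraceD hQ.2.1 hQ.2.2 gt_eqF // ltr_wpDl ?trproj_ge0 //.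
    exact: (@trproj_ge0 _ _ k).
  by rewrite lt_def k0 ler0n.
have c3 : comm_mx (L Q) (Ti P).
  have -> : Ti P = Ti (P + Q) - Ti Q.
    by apply: (can_inj TiK); rewrite linearB /= !TK addrK.
  exact: comm_mxB.
pose V := L Q *+ 2 - 1%:M.
have [hL [iL _]] := dual_proj hQ.
have hV : hcmx V = V by rewrite /V mulr2n hcmxB hcmxD hcmx1 hL.
have VV : V *m V = 1%:M.
  rewrite /V mulr2n mulmxBr mulmx1 mulmxBl mul1mx mulmxDl !mulmxDr iL.
  by apply/matrixP => i j; rewrite !mxE; ring.
have cV : V *m Ti P = Ti P *m V.
  by apply/comm_mx_sym/comm_mxB; [rewrite mulr2n; apply: comm_mxD; exact: comm_mx_sym|exact: comm_mx1].
have e : V *m L P *m V = L P.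
  apply: (kmax_inv_uniq hP); have hm := kmax_inv hP (kmax_proj hP).
  split; first by rewrite -{1}hV; apply: kproj_conj (dual_proj hP); rewrite hV.
  move=> X hX; have -> : \tr (Ti P *m (V *m L P *m V)) = \tr (Ti P *m L P).
    by rewrite (mulmxA (Ti P)) mxtrace_mulC (mulmxA V) cV -mulmxA (mulmxA V V) VV mul1mx.
  exact: hm.2.
have : V *m L P = L P *m V by rewrite -[in RHS]e -!mulmxA VV mulmx1.
rewrite /V mulmxBl mulmxBr mul1mx mulmx1 => /addIr.
rewrite mulr2n mulmxDl mulmxDr -!mulr2n => h.
apply: comm_mx_sym; move: h.
rewrite -[X in X = _]scaler_nat -[X in _ = X]scaler_nat; apply: scalerI.
by rewrite pnatr_eq0.
Qed.

End Dual.

Local Close Scope complex_scope.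

(** * Isometries of the radius *)

Section KProjOps.
Variables (C : numClosedFieldType) (n k : nat).
Implicit Types P X Y : 'M[C]_n.

Lemma kproj_tr P : kproj k P -> kproj k P^T.
Proof.
move=> [hP [iP tP]]; split; [|split]; last by rewrite mxtrace_tr.
  by rewrite -[in RHS]hP /hcmx map_trmx.
by rewrite -trmx_mul iP.
Qed.

Lemma kproj_compl P : n = (2 * k)%N -> kproj k P -> kproj k (1%:M - P).
Proof.
move=> nk [hP [iP tP]]; split; [|split].
- by rewrite hcmxB hcmx1 hP.
- by rewrite mulmxBl mul1mx mulmxBr mulmx1 iP subrr subr0.
rewrite linearB /= mxtrace_scalar tP; have -> : 1 *+ n = k%:R + k%:R :> C.
  by rewrite [in LHS]nk mul2n -addnn natrD.
by rewrite addrK.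
Qed.

Lemma trmul_tr X Y : \tr (X *m Y^T) = \tr (X^T *m Y).
Proof. by rewrite -mxtrace_tr trmx_mul trmxK mxtrace_mulC. Qed.

Lemma trmul_injl X Y : (forall A, \tr (X *m A) = \tr (Y *m A)) -> X = Y.
Proof. by move=> h; apply: trmul_inj => A; rewrite mxtrace_mulC h mxtrace_mulC. Qed.

Lemma unitary_tr (V : 'M[C]_n) : V *m hcmx V = 1%:M -> V^T *m hcmx V^T = 1%:M.
Proof.
move=> hV; have -> : hcmx V^T = (hcmx V)^T by apply/matrixP => i j; rewrite !mxE.
by rewrite -trmx_mul (mulmx1C hV) trmx1.
Qed.

Lemma trmul_conj (V A X : 'M[C]_n) :
  \tr (A *m (hcmx V *m X *m V)) = \tr (V *m A *m hcmx V *m X).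
Proof. by rewrite mulmxA mxtrace_mulC !mulmxA. Qed.

Lemma trmul_conj_tr (V A X : 'M[C]_n) :
  \tr (A *m (hcmx V *m X^T *m V)) = \tr (hcmx V^T *m A^T *m V^T *m X).
Proof.
rewrite trmul_conj trmul_tr !trmx_mul mulmxA; congr (\tr (_ *m _ *m _ *m _)).
by apply/matrixP => i j; rewrite !mxE.
Qed.

Lemma trmul_flip (c : C) (A X Z : 'M[C]_n) :
  \tr (A *m ((c * \tr X)%:M - Z)) = c * \tr A * \tr X - \tr (A *m Z).
Proof.
by rewrite mulmxBr linearB /= mul_mx_scalar mxtraceZ; congr (_ - _); rewrite mulrAC.
Qed.

End KProjOps.

Lemma scaled_add (F : fieldType) (m x y z x' y' z' : F) : m != 0 ->
  m * x = x' -> m * y = y' -> m * z = z' -> z' = x' + y' -> z = x + y.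
Proof. by move=> m0 <- <- <-; rewrite -mulrDr; exact: mulfI. Qed.

Section Radius.
Variables (R : realType) (n k : nat).
Local Notation C := R[i].
Local Notation normc := ComplexField.Normc.normc.
Implicit Types A B P Q X U : 'M[C]_n.
Hypothesis lekn : (k <= n)%N.

Lemma kmaxZ (a : C) A P : kmax k A P -> kmax k (a *: A) P.
Proof.
move=> [hP h]; split=> // Q hQ; rewrite -!scalemxAl !mxtraceZ !cnorm2M.
by apply: ler_wpM2l; [exact: cnorm2_ge0|exact: h].
Qed.

Lemma knumradiusZ (a : C) A : knumradius k (a *: A) = normc a * knumradius k A.
Proof.
have [P hP] := kmax_exists lekn A.
rewrite (knumradiusE (kmaxZ a hP)) (knumradiusE hP) -scalemxAl mxtraceZ.
exact: ComplexField.Normc.normcM.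
Qed.

(** The substitution [f] matches the two trace functions, and its right inverse [g] makes it onto
    the projections, so the maxima agree. *)
Lemma knumradius_reparam A B (f g : 'M[C]_n -> 'M[C]_n) :
  (forall Q, kproj k Q -> kproj k (f Q) /\ \tr (B *m Q) = \tr (A *m f Q)) ->
  (forall P, kproj k P -> kproj k (g P) /\ f (g P) = P) ->
  knumradius k B = knumradius k A.
Proof.
move=> hf hg; have [P hP] := kmax_exists lekn A.
have [gP fgP] := hg P hP.1.
have hB : kmax k B (g P).
  split=> // Q hQ; rewrite (hf _ gP).2 fgP (hf _ hQ).2.
  by apply: hP.2; exact: (hf _ hQ).1.
by rewrite (knumradiusE hB) (knumradiusE hP) (hf _ gP).2 fgP.
Qed.

Section Isometries.
Variables (U : 'M[C]_n) (hU : U *m hcmx U = 1%:M).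

Let hU' : hcmx U *m U = 1%:M. Proof. exact: mulmx1C. Qed.

Let conj_proj Q : kproj k Q -> kproj k (U *m Q *m hcmx U).
Proof. by move=> hQ; rewrite -{1}[U]hcmxK; apply: kproj_conj => //; rewrite hcmxK. Qed.

Let conj_tr A Q : \tr (hcmx U *m A *m U *m Q) = \tr (A *m (U *m Q *m hcmx U)).
Proof. by have := trmul_conj (hcmx U) A Q; rewrite hcmxK. Qed.

Let conjK P : U *m (hcmx U *m P *m U) *m hcmx U = P.
Proof. by rewrite !mulmxA hU mul1mx -mulmxA hU mulmx1. Qed.

Lemma knumradius_conj A : knumradius k (hcmx U *m A *m U) = knumradius k A.
Proof.
apply: (knumradius_reparam (f := fun Q => U *m Q *m hcmx U)
  (g := fun P => hcmx U *m P *m U)) => Q hQ; split; rewrite ?conjK //.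
  exact: conj_proj.
exact: kproj_conj.
Qed.

Lemma knumradius_conj_tr A : knumradius k (hcmx U *m A^T *m U) = knumradius k A.
Proof.
rewrite knumradius_conj.
apply: (knumradius_reparam (f := trmx) (g := trmx)) => Q hQ; split; rewrite ?trmxK //.
- exact: kproj_tr.
- by rewrite trmul_tr.
- exact: kproj_tr.
Qed.

(** Since [tr Q = k], the flipped matrix has trace [tr(A (1 - Q))] against [Q], and [1 - Q] again
    has rank [k]. *)
Lemma knumradius_flip A : (0 < k)%N -> n = (2 * k)%N ->
  knumradius k ((k%:R^-1 * \tr A)%:M - A) = knumradius k A.
Proof.
move=> k0 nk; apply: (knumradius_reparam (f := fun Q => 1%:M - Q) (g := fun Q => 1%:M - Q)) => Q hQ.
  split; first exact: kproj_compl.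
  rewrite mulmxBl mulmxBr mulmx1 mul_scalar_mx !linearB /= mxtraceZ hQ.2.2.
  by rewrite mulrAC mulVf ?mul1r // pnatr_eq0 -lt0n.
by split; [exact: kproj_compl|rewrite opprB addrC subrK].
Qed.

End Isometries.

Lemma TEA_of_scaled_isometry (T G : 'M[C]_n -> 'M[C]_n) (mu : C) : mu != 0 ->
  {morph T : A B / A + B} -> (forall A, mu *: T A = G A) ->
  (forall A, knumradius k (G A) = knumradius k A) ->
  forall A B, kTEA k A B -> kTEA k (T A) (T B).
Proof.
move=> mu0 Tadd TG iso A B AB.
have e X : normc mu * knumradius k (T X) = knumradius k X.
  by rewrite -knumradiusZ TG iso.
have m0 : normc mu != 0 by apply: contraNneq mu0 => /ComplexField.Normc.eq0_normc ->.
have eAB := e (A + B); rewrite (Tadd A B) in eAB.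
exact: (scaled_add m0 (e A) (e B) eAB AB).
Qed.

Lemma parallel_of_TEA (T : {linear 'M[C]_n -> 'M[C]_n}) :
  (forall A B, kTEA k A B -> kTEA k (T A) (T B)) ->
  forall A B, kparallel k A B -> kparallel k (T A) (T B).
Proof.
move=> h A B [mu [mu1 e]]; exists mu; split=> //.
have hAB : kTEA k A (mu *: B).
  by rewrite /kTEA e knumradiusZ (normc_eq1 mu1) mul1r.
have := h _ _ hAB; rewrite /kTEA linearZ /= => ->.
by rewrite knumradiusZ (normc_eq1 mu1) mul1r.
Qed.

End Radius.

(** * Classification and the equivalence *)

Section Classification.
Variables (R : realType) (n k : nat).
Local Notation C := R[i].
Variables (T : {linear 'M[C]_n -> 'M[C]_n}).
Hypothesis kn : (0 < k < n)%N.
Hypothesis Tbij : bijective T.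
Hypothesis Tpar : forall A B, kparallel k A B -> kparallel k (T A) (T B).

Lemma parallel_preserver_form : exists2 c : C, c != 0 &
  exists2 U : 'M[C]_n, U *m hcmx U = 1%:M &
  (forall A, c *: T A = hcmx U *m A *m U) \/ (forall A, c *: T A = hcmx U *m A^T *m U) \/
  [/\ n = (2 * k)%N, (2 < n)%N &
    (forall A, c *: T A = (k%:R^-1 * \tr A)%:M - hcmx U *m A *m U) \/
    (forall A, c *: T A = (k%:R^-1 * \tr A)%:M - hcmx U *m A^T *m U)].
Proof.
have lekn : (k <= n)%N := ltnW (andP kn).2.
case: Tbij => Ti TiK TK.
have Tpar' A B : (exists P, kmax k A P /\ kmax k B P) ->
    exists Q, kmax k (T A) Q /\ kmax k (T B) Q.
  by move=> /(kparallelP lekn)/Tpar/(kparallelP lekn).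
have [c c0 T1] := image_one kn TiK TK Tpar'.
pose T' : {linear 'M[C]_n -> 'M[C]_n} := c^-1 \*: T.
pose Ti' X := Ti (c *: X).
have TE A : T' A = c^-1 *: T A by [].
have cV0 : c^-1 != 0 by rewrite invr_eq0.
have Ti'K : cancel T' Ti' by move=> A; rewrite TE /Ti' scalerA mulfV // scale1r TiK.
have T'K : cancel Ti' T' by move=> A; rewrite TE /Ti' TK scalerA mulVf // scale1r.
have T'par A B : (exists P, kmax k A P /\ kmax k B P) ->
    exists Q, kmax k (T' A) Q /\ kmax k (T' B) Q.
  by move=> /Tpar'[Q [hA hB]]; exists Q; split; exact: kmaxZ.
have T'1 : T' 1%:M = 1%:M by rewrite TE T1 scale_scalar_mx mulVf.
have dl := dual_proj_l kn Ti'K T'K T'par T'1.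
have dr := dual_proj_r kn Ti'K T'K T'par T'1.
have hm := image_herm kn Ti'K T'K T'par T'1.
have Lh := dual_herm hm.
have [V hV form] := projection_preserver kn (dual_proj dr) (dual_inj T'K) Lh
  (dual_comm kn Ti'K T'K hm dl dr).
exists c^-1 => //.
have hVV : hcmx V *m hcmx (hcmx V) = 1%:M by rewrite hcmxK (mulmx1C hV).
have hVt := unitary_tr hV.
(* Conjugation by [V] and by [hcmx V] are adjoint for the trace form; with a transpose the unitary
   becomes [V^T]. *)
case: form => [e|[e|[n2 n3 [e|e]]]].
- exists (hcmx V) => //; left=> A; rewrite -TE; apply: trmul_injl => X.
  by rewrite hcmxK trace_adjE e trmul_conj.
- exists V^T => //; right; left=> A; rewrite -TE; apply: trmul_injl => X.
  by rewrite trace_adjE e trmul_conj_tr.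
- exists (hcmx V) => //; right; right; split=> //; left=> A.
  rewrite -TE; apply: trmul_injl => X.
  by rewrite hcmxK trace_adjE e trmul_flip trmul_conj mulmxBl linearB /= mul_scalar_mx mxtraceZ.
- exists V^T => //; right; right; split=> //; right=> A.
  rewrite -TE; apply: trmul_injl => X.
  by rewrite trace_adjE e trmul_flip trmul_conj_tr mulmxBl linearB /= mul_scalar_mx mxtraceZ.
Qed.

End Classification.

Theorem theorem1p1 (R : realType) (n k : nat) (hn : (2 <= n)%N)
  (hk1 : (1 <= k)%N) (hkn : (k < n)%N)
  (T : {linear 'M[R[i]]_n -> 'M[R[i]]_n}) (hT : bijective T) :
  (((forall A B : 'M[R[i]]_n, kparallel k A B -> kparallel k (T A) (T B))
        <-> (forall A B : 'M[R[i]]_n, kTEA k A B -> kTEA k (T A) (T B))) /\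
      ((forall A B : 'M[R[i]]_n, kTEA k A B -> kTEA k (T A) (T B))
        <-> (exists (mu : R[i]) (U : 'M[R[i]]_n), mu != 0 /\ unitary U /\
            ( (forall A, mu *: T A = adjmx U *m A *m U)
           \/ (forall A, mu *: T A = adjmx U *m A^T *m U)
           \/ (n = (2 * k)%N /\ (2 < n)%N /\
                ( (forall A, mu *: T A =
                      ((k%:R)^-1 * \tr A)%:M - adjmx U *m A *m U)
               \/ (forall A, mu *: T A =
                      ((k%:R)^-1 * \tr A)%:M - adjmx U *m A^T *m U))))))).

Proof.
have lekn : (k <= n)%N := ltnW hkn.
have kn : (0 < k < n)%N by rewrite hk1.
have ba := @parallel_of_TEA R n k lekn T.
have ac (h : forall A B : 'M[R[i]]_n, kparallel k A B -> kparallel k (T A) (T B)) :=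
  parallel_preserver_form kn hT h.
pose form := exists2 c : R[i], c != 0 &
  exists2 U : 'M[R[i]]_n, U *m hcmx U = 1%:M &
  (forall A, c *: T A = hcmx U *m A *m U) \/ (forall A, c *: T A = hcmx U *m A^T *m U) \/
  [/\ n = (2 * k)%N, (2 < n)%N &
    (forall A, c *: T A = (k%:R^-1 * \tr A)%:M - hcmx U *m A *m U) \/
    (forall A, c *: T A = (k%:R^-1 * \tr A)%:M - hcmx U *m A^T *m U)].
have cb : form -> forall A B : 'M[R[i]]_n, kTEA k A B -> kTEA k (T A) (T B).
  move=> [c c0 [U hU hform]].
  have Tadd : {morph T : A B / A + B} by move=> A B; rewrite linearD.
  have flipE (A B : 'M[R[i]]_n) : \tr B = \tr A -> knumradius k B = knumradius k A -> n = (2 * k)%N ->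
      knumradius k ((k%:R^-1 * \tr A)%:M - B) = knumradius k A.
    by move=> <- <- n2; exact: (knumradius_flip lekn _ hk1 n2).
  have trc (A : 'M[R[i]]_n) : \tr (hcmx U *m A *m U) = \tr A.
    by rewrite mxtrace_mulC mulmxA hU mul1mx.
  case: hform => [e|[e|[n2 n3 [e|e]]]]; apply: (TEA_of_scaled_isometry lekn c0 Tadd e) => A.
  - exact: knumradius_conj.
  - exact: knumradius_conj_tr.
  - by apply: flipE => //; exact: knumradius_conj.
  - by apply: flipE; rewrite ?trc ?mxtrace_tr //; exact: knumradius_conj_tr.
(* Both equivalences follow from the cycle parallel preserver, explicit form, TEA preserver,
   parallel preserver. *)
split; split.
- by move/ac/cb.
- exact: ba.
- move=> /ba/ac[c c0 [U hU h]]; exists c, U; split=> //; split=> //.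
  case: h => [h|[h|[n2 n3 h]]]; [by left|by right; left|by right; right].
move=> [c [U [c0 [hU h]]]]; apply: cb; exists c => //; exists U => //.
case: h => [h|[h|[n2 [n3 h]]]]; [by left|by right; left|by right; right; split].
Qed.
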